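(* Let $C_3^{(3)}$ denote the $3$-uniform loose cycle with $3$ edges. Then, as $n\to\infty$, \[ \left(\frac{4}{3}+o(1)\right)n\leq \mathrm{sat}_3(n,C_3^{(3)})\leq \frac{3}{2}n+O(1). \]
   Context: A $3$-uniform hypergraph is a hypergraph all of whose edges have exactly $3$ vertices. The $3$-uniform loose cycle $C_3^{(3)}$ is the $3$-uniform hypergraph on $6$ vertices $v_1,\dots,v_6$ with the three edges $\{v_1,v_2,v_3\}$, $\{v_3,v_4,v_5\}$, $\{v_5,v_6,v_1\}$. For $3$-uniform hypergraphs $F$ and $H$, $H$ is $F$-saturated if $H$ contains no subhypergraph isomorphic to $F$, but $H+e$ does for every $3$-set $e\subseteq V(H)$ with $e\notin E(H)$. The saturation number $\mathrm{sat}_3(n,F)$ is the minimum number of edges of an $F$-saturated $3$-uniform hypergraph on $n$ vertices. *)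

(* Defs.v *)
From mathcomp Require Import all_boot.

Set Implicit Arguments.
Unset Strict Implicit.
Unset Printing Implicit Defensive.

(* A hypergraph with vertex set [T] is given by its edge set. *)
Definition hypergraph (T : finType) := {set {set T}}.

Definition uniform3 (T : finType) (H : hypergraph T) : bool :=
  [forall e in H, #|e| == 3].

(* An injective [f] is an isomorphism from [F] onto the subhypergraph with
   vertex set [f @: setT] and edge set [[set f @: e | e in F]]. *)
Definition contains (U T : finType) (F : hypergraph U) (H : hypergraph T)
  : bool :=
  [exists f : {ffun U -> T},
     injectiveb f && ([set f @: (e : {set U}) | e in F] \subset H)].

Definition saturated3 (U T : finType) (F : hypergraph U) (H : hypergraph T)
  : bool :=
  [&& uniform3 H, ~~ contains F H
    & [forall e : {set T},
         (#|e| == 3) && (e \notin H) ==> contains F (e |: H)]].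

(* The index 'C(n, 3) bounds the size of every 3-uniform hypergraph, so it is
   only relevant when no saturated hypergraph exists; [sat3_attained] rules
   this out as soon as [F] has an edge. *)
Definition sat3 (U : finType) (n : nat) (F : hypergraph U) : nat :=
  \big[minn/'C(n, 3)]_(H : hypergraph 'I_n | saturated3 F H) #|H|.

(* The vertex v_i of the loose cycle is encoded as i - 1. *)
Definition loose_cycle3 : hypergraph 'I_6 :=
  let v (i : nat) : 'I_6 := inord i.-1 in
  [set [set v 1; v 2; v 3]; [set v 3; v 4; v 5]; [set v 5; v 6; v 1]].

Lemma uniform3_card n (H : hypergraph 'I_n) : uniform3 H -> #|H| <= 'C(n, 3).
Proof.
move=> /forall_inP H3; rewrite -[n in 'C(n, _)]card_ord -card_draws.
by apply/subset_leq_card/subsetP => e He; rewrite inE H3.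
Qed.

Lemma sat3_le (U : finType) n (F : hypergraph U) (H : hypergraph 'I_n) :
  saturated3 F H -> sat3 n F <= #|H|.
Proof.
move=> sH; rewrite /sat3; have: H \in index_enum (hypergraph 'I_n).
  by rewrite mem_index_enum.
elim: (index_enum _) => //= G s IHs; rewrite inE big_cons => /orP[/eqP<-|/IHs].
  by rewrite sH geq_minl.
by case: ifP => // _; apply: leq_trans; rewrite geq_minr.
Qed.

Lemma saturated3_exists (U : finType) n (F : hypergraph U) :
  F != set0 -> exists H : hypergraph 'I_n, saturated3 F H.
Proof.
move=> F0; pose P (H : hypergraph 'I_n) := uniform3 H && ~~ contains F H.
have P0 : P set0.
  apply/andP; split; first by apply/forall_inP => e; rewrite inE.
  apply/existsP => -[f /andP[_]]; rewrite subset0 => /eqP E0.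
  by case/set0Pn: F0 => e /(imset_f (fun e : {set U} => f @: e)); rewrite E0 inE.
have [H /maxsetP[/andP[H3 HF] Hmax] _] := maxset_exists P0.
exists H; rewrite /saturated3 H3 HF; apply/forallP => e.
apply/implyP => /andP[e3 eH]; apply: contraT => eF.
have PeH : P (e |: H).
  rewrite /P eF andbT; apply/forall_inP => d /setU1P[-> //|].
  exact: (forall_inP H3).
by move: eH; rewrite -(Hmax _ PeH (subsetUr _ _)) setU11.
Qed.

Lemma sat3_attained (U : finType) n (F : hypergraph U) :
  F != set0 -> exists2 H : hypergraph 'I_n, saturated3 F H & sat3 n F = #|H|.
Proof.
move=> /(@saturated3_exists U n)[H0 sH0].
case: (arg_minnP (fun H : hypergraph 'I_n => #|H|) sH0) => H sH Hmin.
exists H => //; apply/eqP; rewrite eqn_leq sat3_le //=.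
rewrite /sat3; elim/big_ind: _ => [|x y Hx Hy|//].
  by apply: uniform3_card; case/and3P: sH.
by rewrite leq_min Hx.
Qed.

(* Main.v *)
Require Import Defs.
From mathcomp Require Import all_boot all_order.
From mathcomp Require Import boolp.
From mathcomp Require Import zify.

Set Implicit Arguments.
Unset Strict Implicit.
Unset Printing Implicit Defensive.

(* Lower bound. Call a vertex high if its degree exceeds a constant K; there are
   O(|H| / K) high vertices. Every edge hands out a charge of 1 to its low
   vertices: all of it to a single low vertex, 1/3 to each of three, and 1/2 to
   each of two unless one of them claims up to the whole edge because its degree
   is too small. Saturation forces the partner of a claiming vertex to have
   enough further edges, so that every low vertex receives at least 4/3, apart
   from the vertices close to some bad vertex. Of three low vertices that are
   pairwise far apart two have a common high neighbour, since saturation joins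
   two of them by a loose path with a high middle vertex; two bad vertices of the
   same kind cannot have one. Hence there are boundedly many bad vertices, and
   4n/3 <= |H| (1 + O(1 / K)) + O_K(1).

   Upper bound. Attach to two hub vertices of a core on 5 to 8 vertices petals of
   four vertices and six edges each. This has no loose triangle and every
   non-edge that meets a petal would create one, so that a saturated extension
   adds edges inside the core only. Both properties involve at most three petals
   and are checked by computation on the flower with three petals. *)

(** Before any claim, a low vertex gets 2, 3 or 6 sixths from an edge with zero, one or two high
    vertices. Apart from bad vertices, the total falls below the target of 8 sixths only in degree 2
    (3 + 2 in [type2], 3 + 3 in [type1]) and in degree 3 with a single high edge (3 + 2 + 2 in
    [type3]). Such a vertex claims the missing charge from its partner, the other low vertex of a
    mixed edge. The obstacle is that the partner may fall short in turn: this is why there are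
    secondary claims ([poor], [centre]), and one configuration in which local saturation yields too
    little and the global notion [forcing] is required.

    Two distant bad vertices x, y cannot share a high neighbour w for the following reason.
    Saturation at the non-edge {x, y, w} gives a path that avoids the third vertex, so it does not
    join x to y through w: it ends in w, or it passes through a second common high neighbour. Each
    kind of badness excludes both, at this triple or at one shifted to a partner.

    Highness means degree above a constant so that balls taken along low vertices have bounded
    size. *)

Section Edges.

Variables (T : finType) (H : hypergraph T).

Definition edge3 (x y z : T) : bool :=
  [&& x != y, x != z, y != z & [set x; y; z] \in H].

Lemma edge3_rot x y z : edge3 x y z = edge3 y z x.
Proof.
rewrite /edge3 [y == x]eq_sym [z == x]eq_sym -finset.setUA finset.setUC.
by case: (x == y); case: (x == z); case: (y == z).
Qed.

Lemma edge3_swap x y z : edge3 x y z = edge3 x z y.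
Proof.
rewrite /edge3 [z == y]eq_sym finset.setUAC.
by case: (x == y); case: (x == z); case: (y == z).
Qed.

Lemma edge3N12 x y z : edge3 x y z -> x != y. Proof. by case/and4P. Qed.
Lemma edge3N13 x y z : edge3 x y z -> x != z. Proof. by case/and4P. Qed.
Lemma edge3N23 x y z : edge3 x y z -> y != z. Proof. by case/and4P. Qed.

Lemma edge3_132 x y z : edge3 x y z -> edge3 x z y.
Proof. by rewrite edge3_swap. Qed.
Lemma edge3_231 x y z : edge3 x y z -> edge3 y z x.
Proof. by rewrite edge3_rot. Qed.
Lemma edge3_312 x y z : edge3 x y z -> edge3 z x y.
Proof. by rewrite edge3_rot edge3_rot. Qed.
Lemma edge3_213 x y z : edge3 x y z -> edge3 y x z.
Proof. by rewrite edge3_rot edge3_swap. Qed.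
Lemma edge3_321 x y z : edge3 x y z -> edge3 z y x.
Proof. by rewrite edge3_swap edge3_rot. Qed.

Definition path3 (p q r : T) : Prop := exists x v y,
  [/\ uniq [:: p; x; v; y; q; r], edge3 p x v & edge3 v y q].

Lemma path3_sym p q r : path3 p q r -> path3 q p r.
Proof.
case=> x [v [y [U e1 e2]]]; exists y, v, x; split; last 2 first.
- exact: edge3_321.
- exact: edge3_321.
by rewrite (perm_uniq (s2 := [:: p; x; v; y; q; r])) //; apply/permP => a /=; lia.
Qed.

Definition loose_triangle_free : Prop := forall a x b y c z,
  uniq [:: a; x; b; y; c; z] ->
  edge3 a x b -> edge3 b y c -> edge3 c z a -> False.

(* In a triangle created by the edge {p, q, r}, two of p, q, r are corners and a
   loose path joins them. *)
Definition triangle_saturated : Prop := forall p q r,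
  uniq [:: p; q; r] -> ~~ edge3 p q r ->
  [\/ path3 p q r, path3 p r q | path3 q r p].

Lemma loose_cycle3E (U : finType) (f : 'I_6 -> U) (G : hypergraph U) :
  ([set [set f i | i in (e : {set _})] | e in loose_cycle3] \subset G) =
  [&& [set f ord0; f (inord 1); f (inord 2)] \in G,
      [set f (inord 2); f (inord 3); f (inord 4)] \in G
    & [set f (inord 4); f (inord 5); f ord0] \in G].
Proof.
have inord0 : inord 0 = ord0 :> 'I_6 by apply/val_inj; rewrite /= inordK.
rewrite /loose_cycle3 /= inord0.
rewrite !finset.imsetU !finset.imset_set1 !finset.subUset !finset.sub1set.
by rewrite !finset.imsetU !finset.imset_set1 -!andbA.
Qed.

End Edges.

Lemma contains_loose_cycle3P (T : finType) (G : hypergraph T) :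
  reflect (exists a x b y c z : T, [/\ uniq [:: a; x; b; y; c; z],
     [set a; x; b] \in G, [set b; y; c] \in G & [set c; z; a] \in G])
    (contains loose_cycle3 G).
Proof.
apply: (iffP existsP) => [[f /andP[/injectiveP finj]]|].
  rewrite loose_cycle3E => /and3P[e1 e2 e3].
  exists (f ord0), (f (inord 1)), (f (inord 2)), (f (inord 3)).
  exists (f (inord 4)), (f (inord 5)); split=> //.
  have -> : [:: f ord0; f (inord 1); f (inord 2); f (inord 3); f (inord 4);
                f (inord 5)]
     = map f [:: ord0; inord 1; inord 2; inord 3; inord 4; inord 5] by [].
  rewrite map_inj_uniq // -(map_inj_uniq val_inj) /=.
  by rewrite !inordK.
case=> a [x [b [y [c [z [U e1 e2 e3]]]]]].
pose s := [:: a; x; b; y; c; z].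
have [g gE] : exists g : {ffun 'I_6 -> T}, forall i : 'I_6, g i = nth a s i.
  by exists (finfun (fun i : 'I_6 => nth a s i)) => i; rewrite ffunE.
have ginj : injective g.
  by move=> i j; rewrite !gE => /eqP; rewrite nth_uniq // => /eqP/val_inj.
exists g; apply/andP; split; first exact/injectiveP.
by rewrite (loose_cycle3E g) /= !gE /= !inordK //= e1 e2 e3.
Qed.

Lemma card_set3 (T : finType) (x y z : T) :
  uniq [:: x; y; z] -> #|[set x; y; z]| = 3.
Proof.
move=> U; rewrite -[RHS](card_uniqP U); apply: eq_card => w.
by rewrite !inE orbA.
Qed.

Lemma saturated3_triangle_free (T : finType) (H : hypergraph T) :
  saturated3 loose_cycle3 H -> loose_triangle_free H.
Proof.
case/and3P => _ /contains_loose_cycle3P Hno _ a x b y c z U.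
case/and4P => _ _ _ e1 /and4P[_ _ _ e2] /and4P[_ _ _ e3].
by apply: Hno; exists a, x, b, y, c, z.
Qed.

Lemma saturated3_triangle_saturated (T : finType) (H : hypergraph T) :
  saturated3 loose_cycle3 H -> triangle_saturated H.
Proof.
case/and3P => /forall_inP H3 /contains_loose_cycle3P Hno /forallP Hsat p q r U.
move=> nE; set e : {set T} := [set p; q; r].
have eH : e \notin H.
  move: nE; rewrite /edge3; move: U; rewrite /= !inE negb_or andbT.
  by case/andP=> /andP[-> ->] ->.
have := implyP (Hsat e); rewrite card_set3 // eH => /(_ isT).
case/contains_loose_cycle3P => a [x [b [y [c [z [U6 e1 e2 e3]]]]]].
have mk u v w : uniq [:: u; v; w] -> [set u; v; w] \in H -> edge3 H u v w.
  by rewrite /= !inE negb_or andbT /edge3 => /andP[/andP[-> ->] ->] ->.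
(* The new edge may enter the triangle in any of six orders; reversing the path leaves the three
   alternatives. *)
have perm3 u v w : uniq [:: u; v; w] -> [set u; v; w] = e ->
    path3 H w u v -> [\/ path3 H p q r, path3 H p r q | path3 H q r p].
  move=> U' E3 P; have E' t : (t \in [:: u; v; w]) = (t \in [:: p; q; r]).
    by have /setP/(_ t) := E3; rewrite /e !inE -!orbA.
  have := E' p; have := E' q; have := E' r.
  move: U; rewrite !inE !eqxx ?orbT /= !inE !negb_or.
  case/andP=> /andP[pq pr] /andP[qr _].
  do ![case/or3P => /eqP ?]; subst; rewrite ?eqxx in pq pr qr => //;
    first [ by apply: Or31 | by apply: Or31; apply: path3_sym
          | by apply: Or32 | by apply: Or32; apply: path3_sym
          | by apply: Or33 | by apply: Or33; apply: path3_sym ].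
move: (U6); rewrite /= !inE !negb_or -!andbA.
case/and5P=> ax ab ay ac; case/and5P=> az xb xy xc; case/and5P=> xz By bc bz.
case/and4P=> yc yz cz _.
have ne12 : [set a; x; b] != [set b; y; c].
  apply/eqP => /setP/(_ a); rewrite !inE eqxx (negbTE ab) (negbTE ay) (negbTE ac).
  by [].
have ne13 : [set a; x; b] != [set c; z; a].
  apply/eqP => /setP/(_ b).
  by rewrite !inE eqxx !orbT (negbTE bc) (negbTE bz) [b == a]eq_sym (negbTE ab).
have ne23 : [set b; y; c] != [set c; z; a].
  apply/eqP => /setP/(_ b).
  by rewrite !inE eqxx (negbTE bc) (negbTE bz) [b == a]eq_sym (negbTE ab).
have inH f g : f \in e |: H -> f != g -> g = e -> f \in H.
  by move=> /setU1P[->|//] fg ge; move: fg; rewrite ge eqxx.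
have u1 : uniq [:: a; x; b] by rewrite /= !inE negb_or ax ab xb.
have u2 : uniq [:: b; y; c] by rewrite /= !inE negb_or By bc yc.
have u3 : uniq [:: c; z; a].
  by rewrite /= !inE negb_or cz [c == a]eq_sym ac [z == a]eq_sym az.
case/setU1P: (e1) => [E1|h1].
  apply: (perm3 a x b) => //; exists y, c, z; split.
  - by rewrite -[X in is_true X]/(uniq (rot 2 [:: a; x; b; y; c; z])) rot_uniq.
  - by apply: mk u2 _; apply: inH e2 _ E1; rewrite eq_sym.
  - by apply: mk u3 _; apply: inH e3 _ E1; rewrite eq_sym.
case/setU1P: (e2) => [E2|h2].
  apply: (perm3 b y c) => //; exists z, a, x; split.
  - by rewrite -[X in is_true X]/(uniq (rot 4 [:: a; x; b; y; c; z])) rot_uniq.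
  - by apply: mk u3 _; apply: inH e3 _ E2; rewrite eq_sym.
  - exact: mk u1 h1.
case/setU1P: (e3) => [E3|h3].
  apply: (perm3 c z a) => //; exists x, b, y; split=> //.
  - exact: mk u1 h1.
  - exact: mk u2 h2.
by case: Hno; exists a, x, b, y, c, z.
Qed.

(** * Tactics for distinctness and for reordered edges *)

Ltac neq :=
  match goal with
  | h : is_true (?x != ?y) |- is_true (?x != ?y) => exact h
  | h : is_true (?y != ?x) |- is_true (?x != ?y) => rewrite eq_sym; exact h
  | h : is_true (edge3 _ ?x ?y _) |- is_true (?x != ?y) => exact (edge3N12 h)
  | h : is_true (edge3 _ ?x _ ?y) |- is_true (?x != ?y) => exact (edge3N13 h)
  | h : is_true (edge3 _ _ ?x ?y) |- is_true (?x != ?y) => exact (edge3N23 h)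
  | h : is_true (edge3 _ ?y ?x _) |- is_true (?x != ?y) =>
      rewrite eq_sym; exact (edge3N12 h)
  | h : is_true (edge3 _ ?y _ ?x) |- is_true (?x != ?y) =>
      rewrite eq_sym; exact (edge3N13 h)
  | h : is_true (edge3 _ _ ?y ?x) |- is_true (?x != ?y) =>
      rewrite eq_sym; exact (edge3N23 h)
  | h : is_true (?f ?x), h' : is_true (~~ ?f ?y) |- is_true (?x != ?y) =>
      let e := fresh in apply/eqP => e; move: h'; rewrite -e h; by []
  | h : is_true (?f ?y), h' : is_true (~~ ?f ?x) |- is_true (?x != ?y) =>
      let e := fresh in apply/eqP => e; move: h'; rewrite e h; by []
  end.

Ltac uniq_hyps :=
  repeat match goal with
  | h : is_true (uniq _) |- _ => move: h; rewrite /= !inE !negb_or => h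
  | h : is_true (_ \notin _) |- _ => move: h; rewrite /= !inE !negb_or => h
  | h : is_true (_ && _) |- _ =>
      let h1 := fresh "N" in let h2 := fresh "N" in
      case/andP: h => h1 h2
  | h : is_true true |- _ => clear h
  end.

Ltac split_andb :=
  match goal with
  | |- is_true (_ && _) => apply/andP; split; split_andb
  | _ => idtac
  end.

Ltac uniq_goal := rewrite /= ?inE ?negb_or; split_andb; first [neq | by []].

Ltac edge :=
  match goal with
  | h : is_true (edge3 ?H ?x ?y ?z) |- is_true (edge3 ?H ?x ?y ?z) => exact h
  | h : is_true (edge3 ?H ?x ?z ?y) |- is_true (edge3 ?H ?x ?y ?z) =>
      exact (edge3_132 h)
  | h : is_true (edge3 ?H ?y ?x ?z) |- is_true (edge3 ?H ?x ?y ?z) =>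
      exact (edge3_213 h)
  | h : is_true (edge3 ?H ?z ?y ?x) |- is_true (edge3 ?H ?x ?y ?z) =>
      exact (edge3_321 h)
  | h : is_true (edge3 ?H ?y ?z ?x) |- is_true (edge3 ?H ?x ?y ?z) =>
      exact (edge3_312 h)
  | h : is_true (edge3 ?H ?z ?x ?y) |- is_true (edge3 ?H ?x ?y ?z) =>
      exact (edge3_231 h)
  end.

Ltac absurd_neq :=
  match goal with
  | h : is_true (?x != ?x) |- _ => by rewrite eqxx in h
  | h : is_true (edge3 _ ?x ?x _) |- _ => by have := edge3N12 h; rewrite eqxx
  | h : is_true (edge3 _ ?x _ ?x) |- _ => by have := edge3N13 h; rewrite eqxx
  | h : is_true (edge3 _ _ ?x ?x) |- _ => by have := edge3N23 h; rewrite eqxx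
  | h : is_true (?f ?x), h' : is_true (~~ ?f ?x) |- _ => by rewrite h in h'
  end.

Ltac absurd_edge :=
  match goal with
  | h : is_true (~~ edge3 ?H ?x ?y ?z) |- _ =>
      exfalso; apply: (negP h); edge
  end.

(* Case analysis on an edge at a vertex [a] all of whose edges are listed. *)
Ltac cases_at eE :=
  case: eE => [[[? ?]|[? ?]]|[[? ?]|[? ?]]]; subst; try absurd_neq.

Ltac cases3_at eE :=
  case: eE => [[[? ?]|[? ?]]|[[? ?]|[? ?]]|[[? ?]|[? ?]]]; subst; try absurd_neq.

Lemma card_bigcup_leq (I S : finType) (A : {set I}) (F : I -> {set S}) k :
  (forall i, i \in A -> #|F i| <= k) -> #|\bigcup_(i in A) F i| <= k * #|A|.
Proof.
move=> Fk; rewrite mulnC -sum_nat_const.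
elim/big_rec2: _ => [|i n B iA IH]; first by rewrite cards0.
by apply: leq_trans (leq_card_setU _ _) _; apply: leq_add IH; apply: Fk.
Qed.

(** * Low vertices of small degree *)

Section Structure.

Variables (T : finType) (H : hypergraph T) (hi : pred T).
Hypothesis notri : loose_triangle_free H.
Hypothesis sat : triangle_saturated H.
Local Notation E := (edge3 H).
Local Notation low x := (~~ hi x).

Ltac tri a x b y c z :=
  exfalso; apply: (@notri a x b y c z); [uniq_goal|edge..].

(** Otherwise the path and {p, q, w} form a loose triangle. With [sat], this is the main tool: a
    path supplied by saturation is pinned down by a known edge through both of its ends. *)
Lemma edge_meets_path p q w x v y :
  uniq [:: p; x; v; y; q] -> E p x v -> E v y q -> E p q w ->
  [\/ x = w, v = w | y = w].
Proof.
move=> U e1 e2 e3; case: (eqVneq x w) => [|wx]; first by constructor 1.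
case: (eqVneq v w) => [|wv]; first by constructor 2.
case: (eqVneq y w) => [|wy]; first by constructor 3.
uniq_hyps; tri p x v y q w.
Qed.

(** Otherwise {p, p', u}, {u, q', q}, {q, r, p} is a loose triangle. *)
Lemma link_nbr_eq u p q r p' q' :
  E p q r -> E u p p' -> E u q q' ->
  u != r -> p' != q -> p' != r -> q' != p -> q' != r -> p' = q'.
Proof.
move=> e e1 e2 ur pq pr qp qr; apply/eqP/negP => /negP pq'.
tri p p' u q' q r.
Qed.

Definition lpath p q := exists x v y,
  [/\ uniq [:: p; x; v; y; q], E p x v & E v y q].

Lemma path3_lpath p q r : path3 H p q r -> lpath p q.
Proof.
case=> x [v [y [U e1 e2]]]; exists x, v, y; split=> //; uniq_hyps; uniq_goal.
Qed.

Definition hinb u p : Prop := hi u /\ exists x, E p u x.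

Definition only_hi u p := hinb u p /\ forall w, hinb w p -> w = u.

(** The pair {a, u} has codegree one; [b] is the partner from which [a] will claim. *)
Definition leaf u a b := E a b u /\ forall x, E a u x -> x = b.

(** The edge {a, b, u} meets the path, and [a] cannot lie in the path's edge at [u], which would
    then contain [b]. *)
Lemma leaf_path u a b x v y :
  leaf u a b -> uniq [:: u; x; v; y; b] -> E u x v -> E v y b -> y = a.
Proof.
case=> e L U e1 e2; have e' : E u b a by edge.
case: (edge_meets_path U e1 e2 e') => [ax|av|//]; subst; uniq_hyps.
- by have := L v ltac:(edge) => ?; subst; absurd_neq.
- by have := L x ltac:(edge) => ?; subst; absurd_neq.
Qed.

Definition same_pair (x y b u : T) : Prop :=
  (x = b /\ y = u) \/ (x = u /\ y = b).

Definition edges2 a b u c v : Prop :=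
  [/\ E a b u, E a c v
    & forall x y, E a x y -> same_pair x y b u \/ same_pair x y c v].

Lemma edges2_swap a b u c v : edges2 a b u c v -> edges2 a c v b u.
Proof. by case=> e1 e2 He; split=> // x y /He[]; [right|left]. Qed.

Lemma edges2_flip a b u c v : edges2 a b u c v -> edges2 a b u v c.
Proof.
case=> e1 e2 He; split=> //; first by edge.
by move=> x y /He[|[] []->->]; [left | right; right | right; left].
Qed.

(* Low vertices of degree two, with one ([type2]) or two ([type1]) edges
   containing a high vertex. *)
Definition type2 a b u c d : Prop :=
  [/\ hi u, low a, low b, low c & low d] /\ edges2 a b u c d.

Definition type1 a b u c w : Prop :=
  [/\ hi u, hi w & u != w] /\ [/\ low a, low b & low c] /\ edges2 a b u c w.

Lemma type2_flip a b u c d : type2 a b u c d -> type2 a b u d c.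
Proof. by case=> -[? ? ? ? ?] /edges2_flip. Qed.

Lemma type1_swap a b u c w : type1 a b u c w -> type1 a c w b u.
Proof. by case=> -[? ? uw] [[? ? ?] /edges2_swap ?]; split; rewrite 1?eq_sym. Qed.

Lemma type2_only_hi a b u c d : type2 a b u c d -> only_hi u a.
Proof.
case=> -[hu la lb lc ld] [e1 e2 He]; split.
  by split=> //; exists b; edge.
move=> w [hw [x /He]].
by case=> [[[E1 _]|[E1 _]]|[[E1 _]|[E1 _]]]; rewrite E1 in hw *;
  rewrite ?hw in lb lc ld.
Qed.

Lemma type2_leaf a b u c d : type2 a b u c d -> leaf u a b.
Proof.
case=> -[hu la lb lc ld] [e1 e2 He]; split=> // x /He.
case=> [[[E1 E2]|[//]]|[[E1 _]|[E1 _]]]; rewrite -?E1 ?hu // in lb lc ld.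
Qed.

Lemma type1_leaf a b u c w : type1 a b u c w -> b != c -> leaf u a b.
Proof.
case=> -[hu hw uw] [[la lb lc] [e1 e2 He]] bc; split=> // x /He.
case=> [[[E1 E2]|[//]]|[[E1 _]|[E1 _]]]; first by rewrite -E1 hu in lb.
- by rewrite -E1 hu in lc.
- by rewrite E1 eqxx in uw.
Qed.

(** What [type2] and [type1] have in common when their two edges share only [a]; [d] may be low or
    high. *)
Definition leaf_side a b u c d : Prop :=
  [/\ leaf u a b, edges2 a b u c d & [/\ u != c, u != d, b != c & b != d]].

Lemma leaf_side_link a b u c d x :
  leaf_side a b u c d -> E u c x -> x = b \/ x = d.
Proof.
case=> Lf [e1 e2 eE] [uc ud bc bd].
move=> e; case: (eqVneq x d) => [|xd]; first by right.
have xa : x != a.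
  by apply/eqP => ?; subst x; have := Lf.2 c ltac:(edge) => ?; subst; absurd_neq.
left; apply/esym; apply: (@link_nbr_eq u a c d b x); first [edge|neq].
Qed.

(** The last edge of the path contains [a] but not [u], so it is {a, c, d}; since {u, a, b} meets
    the path, [b] lies in the first edge. *)
Lemma leaf_side_lpath a b u c d :
  leaf_side a b u c d -> lpath u a -> E u b c \/ E u b d.
Proof.
case=> Lf [e1 e2 eE] [uc ud bc bd].
case=> p [m [q [U f1 f2]]]; have e' : E u a b by edge.
case: (edge_meets_path U f1 f2 e') => ?; subst; uniq_hyps.
- case: (eE m q ltac:(edge)).
  + by case=> -[? ?]; subst; absurd_neq.
  + by case=> -[? ?]; subst; [left|right]; edge.
- case: (eE b q ltac:(edge)).
  + by case=> -[? ?]; subst; absurd_neq.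
  + by case=> -[? ?]; subst; absurd_neq.
- case: (eE m b ltac:(edge)).
  + by case=> -[? ?]; subst; absurd_neq.
  + by case=> -[? ?]; subst; absurd_neq.
Qed.

(* Saturation at the non-edge {a, u, c}. *)
Lemma leaf_side_third a b u c d : leaf_side a b u c d -> E u b c ->
  (exists t y, [/\ E u b t, E t y c, uniq [:: a; b; c; u; t] & y \notin [:: u;
    b; a]])
  \/ (E b d c /\ exists p, E u b p /\ uniq [:: a; c; d; p]).
Proof.
case=> Lf [e1 e2 eE] [uc ud bc bd] g.
have N : ~~ E a u c.
  apply/negP => f; have := Lf.2 c ltac:(edge) => ?; subst; absurd_neq.
have U3 : uniq [:: a; u; c] by uniq_goal.
case: (sat U3 N).
- move=> [x [v [y [U f1 f2]]]]; uniq_hyps.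
  by case: (eE _ _ f1) => [[[? ?]|[? ?]]|[[? ?]|[? ?]]]; subst; absurd_neq.
- move=> [x [v [y [U f1 f2]]]]; uniq_hyps.
  by case: (eE _ _ f1) => [[[? ?]|[? ?]]|[[? ?]|[? ?]]]; subst; absurd_neq.
move=> [p [m [q [U f1 f2]]]].
have Us : uniq [:: u; p; m; q; c] by uniq_hyps; uniq_goal.
have g' : E u c b by edge.
case: (edge_meets_path Us f1 f2 g') => ?; subst; uniq_hyps.
- left; exists m, q; split; [edge|edge|uniq_goal|uniq_goal].
- case: (eqVneq q d) => [?|qd]; last by tri a u b q c d.
  subst; right; split; first edge.
  by exists p; split; [edge|uniq_goal].
- case: (eqVneq m d) => [?|md]; last by tri a u b m c d.
  subst; case: (eqVneq p b) => [?|pb]; first by subst; absurd_neq.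
  have pb' : b = p by apply: (@link_nbr_eq u a d c); first [edge|neq].
  by subst; absurd_neq.
Qed.

(** Both edges at [a] meet {b, c}, so the path completing the non-edge {a, b, c} joins [b] to [c];
    it meets {u, b, c} in [u]. *)
Lemma leaf_side_third' a b u c d : leaf_side a b u c d -> E u b c ->
  (exists t y, [/\ E u b t, E t y c, uniq [:: a; b; c; u; t]
     & y \notin [:: u; b; a]]) \/ E u c d.
Proof.
move=> LS; case: (LS) => Lf [e1 e2 eE] [uc ud bc bd] g.
have N : ~~ E a b c.
  apply/negP => f.
  by case: (eE _ _ f) => [[[? ?]|[? ?]]|[[? ?]|[? ?]]]; subst; absurd_neq.
have U3 : uniq [:: a; b; c] by uniq_goal.
case: (sat U3 N).
- move=> [x [v [y [U f1 f2]]]]; uniq_hyps.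
  by case: (eE _ _ f1) => [[[? ?]|[? ?]]|[[? ?]|[? ?]]]; subst; absurd_neq.
- move=> [x [v [y [U f1 f2]]]]; uniq_hyps.
  by case: (eE _ _ f1) => [[[? ?]|[? ?]]|[[? ?]|[? ?]]]; subst; absurd_neq.
move=> [p [m [q [U f1 f2]]]].
have Us : uniq [:: b; p; m; q; c] by uniq_hyps; uniq_goal.
have g' : E b c u by edge.
case: (edge_meets_path Us f1 f2 g') => ?; subst; uniq_hyps.
- left; exists m, q; split; [edge|edge|uniq_goal|uniq_goal].
- case: (leaf_side_link LS (x := q) ltac:(edge)) => ?; subst.
  + absurd_neq.
  + by right; edge.
- case: (leaf_side_link LS (x := m) ltac:(edge)) => ?; subst.
  + absurd_neq.
  + by right; edge.
Qed.

(* Counts ordered pairs, hence is twice the degree. *)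
Definition dg v : nat := #|[pred xy : T * T | E v xy.1 xy.2]|.

Definition swap (xy : T * T) : T * T := (xy.2, xy.1).

(** Uniqueness together with the swapped pairs makes the edges distinct as unordered pairs, in
    accordance with the double count in [dg]. *)
Definition star v (s : seq (T * T)) : bool :=
  uniq (s ++ map swap s) && all (fun xy => E v xy.1 xy.2) s.

Lemma star_sub v s : star v s ->
  {subset s ++ map swap s <= [pred xy : T * T | E v xy.1 xy.2]}.
Proof.
case/andP => _ /allP sE [x y]; rewrite mem_cat => /orP[/sE//|].
by case/mapP => -[x' y'] /sE /= e [-> ->]; rewrite inE /=; edge.
Qed.

Lemma star_dg v s : star v s -> 2 * size s <= dg v.
Proof.
move=> Ss; have /andP[U _] := Ss.
have -> : 2 * size s = size (s ++ map swap s).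
  by rewrite size_cat size_map; lia.
rewrite -(card_uniqP U); apply/subset_leq_card/fintype.subsetP.
exact: star_sub.
Qed.

Definition has1 v : Prop := exists x y, [/\ E v x y, hi x & hi y].

(* A robust vertex can give up two thirds of every edge. *)
Definition robust v : Prop := 8 <= dg v \/ has1 v.

(* Each of the following properties holds at boundedly many low vertices only:
   two such vertices that are far apart cannot share a high neighbour. *)
Definition bad_dominated p : Prop :=
  forall w, hinb w p -> forall x y, E p x y -> w = x \/ w = y.

Definition bad_unreached p : Prop := exists u, only_hi u p /\ ~ lpath u p.

Definition bad_leaf a : Prop := exists u b,
  [/\ only_hi u a, leaf u a b, low b & forall x, E b u x -> x = a].

(** For a [type1] vertex with [b != c], a loose path from [u] yields the first or third edge and one
    from [w] the second or fourth, by [leaf_side_lpath]. *)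
Definition reached_type1 b u c w : Prop :=
  [\/ E u b w, E u c w, E u b c | E w b c].

Definition bad_type1 a : Prop := exists b u c w,
  [/\ type1 a b u c w, b != c & ~ reached_type1 b u c w].

(** Steps run between low vertices only: this bounds the size of a ball, and a loose path between
    low vertices at distance more than 2 must have a high middle vertex. *)
Fixpoint ball n x : {set T} :=
  if n is m.+1 then
    [set y | [exists z in ball m x,
       (z == y) || [&& low z, low y & [exists w, E z y w]]]]
  else [set x].

(* Every vertex far from [a] and [q] must then have [u] as a neighbour. *)
Definition forcing u a : Prop := only_hi u a /\ low a /\ exists q,
  [/\ low q, q \in ball 2 a, only_hi u q, a != q & ~ lpath a q].

(** Of two distant vertices of this kind with the same [u], each forces [u] on the exceptional
    vertex [z] near the other. *)
Definition bad_forcing a : Prop := exists u,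
  forcing u a /\ exists z, [/\ low z, z \in ball 3 a & ~ hinb u z].

Definition bad_forcing_leaf a : Prop := exists u b,
  [/\ forcing u a, leaf u a b, low b, (forall d, E a b d -> d = u)
    & forall x v, E b x v -> hi v -> v != u -> low x /\ ~~ E b u x].

Definition bad p : Prop :=
  bad_dominated p \/ bad_unreached p \/ bad_leaf p \/ bad_type1 p \/
  bad_forcing p \/ bad_forcing_leaf p.

Lemma nbad_dominated p : ~ bad p -> ~ bad_dominated p.
Proof. by move=> nb h; apply: nb; left. Qed.
Lemma nbad_unreached p : ~ bad p -> ~ bad_unreached p.
Proof. by move=> nb h; apply: nb; right; left. Qed.
Lemma nbad_leaf p : ~ bad p -> ~ bad_leaf p.
Proof. by move=> nb h; apply: nb; do 2!right; left. Qed.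
Lemma nbad_type1 p : ~ bad p -> ~ bad_type1 p.
Proof. by move=> nb h; apply: nb; do 3!right; left. Qed.
Lemma nbad_forcing p : ~ bad p -> ~ bad_forcing p.
Proof. by move=> nb h; apply: nb; do 4!right; left. Qed.
Lemma nbad_forcing_leaf p : ~ bad p -> ~ bad_forcing_leaf p.
Proof. by move=> nb h; apply: nb; do 5!right. Qed.

Definition good p : Prop := forall q, q \in ball 4 p -> ~ bad q.

Lemma ball_refl n x : x \in ball n x.
Proof.
elim: n => [|n IH] /=; first by rewrite inE.
by rewrite inE; apply/exists_inP; exists x; rewrite ?eqxx.
Qed.

Lemma ball_step n x y z w :
  y \in ball n x -> low y -> low z -> E y z w -> z \in ball n.+1 x.
Proof.
move=> yB ly lz e; rewrite inE; apply/exists_inP; exists y => //.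
by rewrite ly lz /=; apply/orP; right; apply/existsP; exists w.
Qed.

Lemma ball_leq m n x : m <= n -> ball m x \subset ball n x.
Proof.
elim: n => [|n IH]; first by rewrite leqn0 => /eqP->.
rewrite leq_eqVlt => /orP[/eqP->//|/IH sub]; apply: fintype.subset_trans sub _.
apply/fintype.subsetP => y yB; rewrite inE; apply/exists_inP.
by exists y; rewrite ?eqxx.
Qed.

Lemma good_nbad n p q : good p -> n <= 4 -> q \in ball n p -> ~ bad q.
Proof. by move=> gp n4 qB; apply: gp; apply: (fintype.subsetP (ball_leq _ n4)). Qed.

Lemma nbad_only_hi_lpath u p : ~ bad p -> only_hi u p -> lpath u p.
Proof.
move=> /nbad_unreached nb ou; apply: contrapT => nl.
by apply: nb; exists u.
Qed.

Lemma nbad_leaf_second u a b : ~ bad a -> only_hi u a -> leaf u a b -> low b ->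
  exists2 x, E b u x & x != a.
Proof.
move=> /nbad_leaf nb ou lf lb; apply: contrapT => nx.
apply: nb; exists u, b; split=> // x e; apply/eqP/negP => /negP xa.
by apply: nx; exists x.
Qed.

(** * Partners of low vertices of degree two *)

Ltac star_goal :=
  rewrite /star /= ?mem_cat ?inE ?xpair_eqE ?negb_or ?negb_and ?andbT /=;
  split_andb;
  first [neq | edge | by [] | apply/orP; first [left; neq | right; neq]].

Lemma type2_leaf_side a b u c d :
  type2 a b u c d -> b != c -> b != d -> leaf_side a b u c d.
Proof.
move=> t2 bc bd; split; first exact: type2_leaf t2.
  by case: t2.
by case: t2 => -[hu la lb lc ld] _; split=> //; neq.
Qed.

Lemma type1_leaf_side a b u c w :
  type1 a b u c w -> b != c -> leaf_side a b u c w.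
Proof.
move=> t1 bc; split; first exact: type1_leaf t1 bc.
  by case: t1 => _ [].
by case: t1 => -[hu hw uw] [[la lb lc] _]; split=> //; neq.
Qed.

(** A third edge {b, u, x} exists because [a] is no [bad_leaf]. Both edges at [a] contain [b], so
    the non-edge {a, u, d} (if x = d) or {a, b, x} is completed by a path avoiding [a], which
    uncovers a fourth edge at [b]. *)
Lemma type2B_dg a b u d : type2 a b u b d -> ~ bad a -> 8 <= dg b.
Proof.
move=> t2 nb; have ou := type2_only_hi t2; have lf := type2_leaf t2.
case: (t2) => -[hu la lb _ ld] [e1 e2 eE].
have [x ex xa] := nbad_leaf_second nb ou lf lb.
case: (eqVneq x d) => [?|xd].
  subst x; have N : ~~ E a u d.
    by apply/negP => f; cases_at (eE _ _ f).
  have U3 : uniq [:: a; u; d] by uniq_goal.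
  case: (sat U3 N) => -[p [m [q [U f1 f2]]]]; uniq_hyps.
  - by cases_at (eE _ _ f1).
  - by cases_at (eE _ _ f1).
  have Us : uniq [:: u; p; m; q; d] by uniq_goal.
  have g : E u d b by edge.
  case: (edge_meets_path Us f1 f2 g) => ?; subst.
  - by apply: (@star_dg _ [:: (a, u); (a, d); (u, d); (u, m)]); star_goal.
  - by apply: (@star_dg _ [:: (a, u); (a, d); (u, d); (u, p)]); star_goal.
  - by apply: (@star_dg _ [:: (a, u); (a, d); (u, d); (m, d)]); star_goal.
have N : ~~ E a b x.
  by apply/negP => f; cases_at (eE _ _ f).
have U3 : uniq [:: a; b; x] by uniq_goal.
case: (sat U3 N) => -[p [m [q [U f1 f2]]]]; uniq_hyps.
- by cases_at (eE _ _ f1).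
- by cases_at (eE _ _ f1).
by apply: (@star_dg _ [:: (a, u); (a, d); (u, x); (p, m)]); star_goal.
Qed.

(** No path completes the non-edge {a, u, c}: every edge at [a] contains [u] or [c], and every edge
    at [c] contains [u] or [a]. *)
Lemma type2_twins a b u c d d' :
  type2 a b u c d -> type2 c b u a d' -> b != c -> b != d -> False.
Proof.
move=> t2 t2' bc bd; case: (t2) => -[hu la lb lc ld] [e1 e2 eE].
case: (t2') => -[_ _ _ _ ld'] [e1' e2' eE'].
have N : ~~ E a u c by apply/negP => f; cases_at (eE _ _ f).
have U3 : uniq [:: a; u; c] by uniq_goal.
case: (sat U3 N) => -[p [m [q [U f1 f2]]]]; uniq_hyps.
- by cases_at (eE _ _ f1).
- by cases_at (eE _ _ f1).
- by have f3 : E c m q := ltac:(edge); cases_at (eE' _ _ f3).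
Qed.

(* A loose path from [u] to [b] would have to use [a], whose other edge misses
   [b]. *)
Lemma leaf_side_second_hi a b u c d :
  leaf_side a b u c d -> hi u -> ~ bad b -> exists w, hinb w b /\ w != u.
Proof.
move=> LS hu nb; case: (LS) => Lf [e1 e2 eE] [uc ud bc bd].
apply: contrapT => nw; have ou : only_hi u b.
  split; first by split=> //; exists a; edge.
  move=> w hw; apply/eqP/negP => /negP wu; apply: nw; by exists w.
have [x [v [y [U f1 f2]]]] := nbad_only_hi_lpath nb ou.
have ? := leaf_path Lf U f1 f2; subst y; uniq_hyps.
by have f3 : E a v b := ltac:(edge); cases_at (eE _ _ f3).
Qed.

(** Besides {a, b, u} and {b, c, u} there is an edge through a second high neighbour, and
    [leaf_side_third] gives the fourth. If the former edge also contains [u], then [has1] holds. *)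
Lemma leaf_side_robust a b u c d :
  leaf_side a b u c d -> hi u -> ~ bad b -> E u b c -> robust b.
Proof.
move=> LS hu nb g; have [w [[hw [x e]] wu]] := leaf_side_second_hi LS hu nb.
case: (eqVneq x u) => [?|xu].
  by subst; right; exists w, u; split.
case: (LS) => Lf [e1 e2 eE] [uc ud bc bd].
left; case: (leaf_side_third LS g).
  move=> [t [y [g1 g2 U N]]]; uniq_hyps.
  by apply: (@star_dg _ [:: (a, u); (c, u); (t, u); (w, x)]); star_goal.
move=> [g1 [p [g2 U]]]; uniq_hyps.
by apply: (@star_dg _ [:: (a, u); (c, u); (p, u); (d, c)]); star_goal.
Qed.

(** Normal form of [type2] when the two edges share only [a]: the low edge is oriented so that the
    path from [u] to [a] starts with {u, b, c}. The remaining form, [type2 a b u b d], is the one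
    called 2B below. *)
Definition type2A a b u c d : Prop :=
  type2 a b u c d /\ [/\ b != c, b != d & E u b c].

Lemma type2A_orient a b u c d : type2 a b u c d -> ~ bad a ->
  b != c -> b != d -> type2A a b u c d \/ type2A a b u d c.
Proof.
move=> t2 nb bc bd; have LS := type2_leaf_side t2 bc bd.
have lp := nbad_only_hi_lpath nb (type2_only_hi t2).
case: (leaf_side_lpath LS lp) => g; first by left.
by right; split; first exact: type2_flip.
Qed.

Lemma type2_cases a b u c d : type2 a b u c d -> ~ bad a ->
  [\/ exists c' d', type2A a b u c' d' | exists d', type2 a b u b d'].
Proof.
move=> t2 nb; case: (eqVneq b c) => [?|bc]; first by subst; right; exists d.
case: (eqVneq b d) => [?|bd].
  by subst; right; exists c; exact: type2_flip.
by left; case: (type2A_orient t2 nb bc bd) => ?; do 2 eexists; eassumption.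
Qed.

Lemma type2A_leaf_side a b u c d : type2A a b u c d -> leaf_side a b u c d.
Proof. by case=> t2 [bc bd _]; exact: type2_leaf_side. Qed.

Lemma type2_robust a b u c d :
  type2 a b u c d -> ~ bad a -> ~ bad b -> robust b.
Proof.
move=> t2 na nb; case: (type2_cases t2 na) => [[c' [d' t]]|[d' t]].
  case: (t) => -[-[hu _ _ _ _] _] [_ _ g].
  exact: leaf_side_robust (type2A_leaf_side t) hu nb g.
by left; exact: type2B_dg t na.
Qed.

Lemma type2A_c_dg a b u c d : type2A a b u c d -> 6 <= dg c.
Proof.
move=> t; have LS := type2A_leaf_side t; case: t => t2 [bc bd g].
case: (t2) => -[hu la lb lc ld] [e1 e2 eE].
case: (leaf_side_third LS g) => [[t [y [g1 g2 U N]]]|[g1 _]].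
  by uniq_hyps; apply: (@star_dg _ [:: (a, d); (u, b); (t, y)]); star_goal.
by apply: (@star_dg _ [:: (a, d); (u, b); (d, b)]); star_goal.
Qed.

Lemma star_cons v s x y : star v s -> E v x y ->
  (x, y) \notin s ++ map swap s -> star v ((x, y) :: s).
Proof.
move=> Ss e n; have /andP[U /= A] := Ss; rewrite /star /= e A andbT.
have n' : (y, x) \notin s ++ map swap s.
  apply: contra n; rewrite !mem_cat => /orP[i|/mapP[[p q] i [-> ->]]].
    by apply/orP; right; apply/mapP; exists (y, x).
  by rewrite i.
have P : perm_eq (s ++ swap (x, y) :: map swap s)
                 (swap (x, y) :: (s ++ map swap s)).
  by rewrite perm_catC /= perm_cons perm_catC.
rewrite (perm_uniq P) (perm_mem P) inE negb_or n /= n' U !andbT.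
rewrite xpair_eqE negb_and; apply/orP; left; neq.
Qed.

Lemma star_full_lt v s x y : star v s -> dg v < 2 * (size s).+1 -> E v x y ->
  (x, y) \in s ++ map swap s.
Proof.
move=> Ss lt e; apply: contraT => n.
by have := star_dg (star_cons Ss e n); rewrite leqNgt /= lt.
Qed.

Lemma same_pairE (x y p q : T) : ((x, y) == (p, q)) || ((x, y) == (q, p)) ->
  same_pair x y p q.
Proof. by rewrite !xpair_eqE => /orP[] /andP[/eqP-> /eqP->]; [left | right]. Qed.

Lemma same_pairC (x y p q : T) : same_pair x y p q -> same_pair x y q p.
Proof. by case; [right | left]. Qed.

Lemma star2_full v p1 q1 p2 q2 x y : star v [:: (p1, q1); (p2, q2)] ->
  dg v < 6 -> E v x y -> same_pair x y p1 q1 \/ same_pair x y p2 q2.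
Proof.
move=> Ss lt /(star_full_lt Ss lt).
rewrite /= !inE /swap /= => /or4P[] h.
- by left; apply: same_pairE; rewrite h.
- by right; apply: same_pairE; rewrite h.
- by left; apply: same_pairE; rewrite h orbT.
- by right; apply: same_pairE; rewrite h orbT.
Qed.

Lemma star3_full v p1 q1 p2 q2 p3 q3 x y :
  star v [:: (p1, q1); (p2, q2); (p3, q3)] -> dg v < 8 -> E v x y ->
  [\/ same_pair x y p1 q1, same_pair x y p2 q2 | same_pair x y p3 q3].
Proof.
move=> Ss lt /(star_full_lt Ss lt).
rewrite /= !inE /swap /=.
case/or3P => [h|h|/or4P[] h].
- by constructor 1; apply: same_pairE; rewrite h.
- by constructor 2; apply: same_pairE; rewrite h.
- by constructor 3; apply: same_pairE; rewrite h.
- by constructor 1; apply: same_pairE; rewrite h orbT.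
- by constructor 2; apply: same_pairE; rewrite h orbT.
- by constructor 3; apply: same_pairE; rewrite h orbT.
Qed.

(** If [u] lay in every edge at [v], a second high neighbour would share an edge with [u], against
    [~ has1 v]; so [u] would dominate [v]. *)
Lemma edge_missing u v : ~ bad v -> ~ has1 v -> hi u ->
  exists p q, [/\ E v p q, p != u & q != u].
Proof.
move=> nb n1 hu; apply: contrapT => nx; apply: (nbad_dominated nb).
have In x y : E v x y -> u = x \/ u = y.
  move=> e; case: (eqVneq x u) => [->|xu]; first by left.
  case: (eqVneq y u) => [->|yu]; first by right.
  by case: nx; exists x, y.
move=> w [hw [z e]] x y e'; case: (In _ _ e) => ?; subst; first exact: In.
by case: n1; exists w, z.
Qed.

Lemma type1_double_other a b u w z : type1 a b u b w ->
  uniq [:: a; b; u; w; z] -> exists p q, [/\ E b p q, p != a, q != a, p != z &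
    q != z].
Proof.
case=> -[hu hw uw] [[la lb _] [e1 e2 eE]] U; uniq_hyps.
have M : ~~ E a b z by apply/negP => f; cases_at (eE _ _ f).
have U3 : uniq [:: a; b; z] by uniq_goal.
case: (sat U3 M) => -[p [m [q [U f1 f2]]]]; uniq_hyps.
- by cases_at (eE _ _ f1).
- by cases_at (eE _ _ f1).
by exists p, m; split; first [edge|neq].
Qed.

(** [type1_double_other] is applied twice, the second time to a vertex [p] of the edge it found
    first, so that the two new edges differ. If [p] cannot be chosen outside {u, w}, that edge is
    {b, u, w} and [has1] holds. *)
Lemma type1_double_robust a b u w : type1 a b u b w -> robust b.
Proof.
move=> t1; case: (t1) => -[hu hw uw] [[la lb _] [e1 e2 eE]].
have M : ~~ E a u w by apply/negP => f; cases_at (eE _ _ f).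
have U3 : uniq [:: a; u; w] by uniq_goal.
have [z Uz] : exists z, uniq [:: a; b; u; w; z].
  case: (sat U3 M) => -[p [m [q [U f1 f2]]]]; uniq_hyps.
  - by cases_at (eE _ _ f1).
  - by cases_at (eE _ _ f1).
  case: (eqVneq p b) => [?|pb]; last by exists p; uniq_goal.
  by subst; exists m; uniq_goal.
have [p [q [f pa qa pz qz]]] := type1_double_other t1 Uz.
wlog : p q f pa qa pz qz / p != u /\ p != w.
  move=> W; case: (boolP ((p != u) && (p != w))) => [/andP h|np];
    first exact: (W p q).
  case: (boolP ((q != u) && (q != w))) => [/andP h|nq].
    by apply: (W q p) => //; edge.
  move: np nq; rewrite !negb_and !negbK => /orP[] /eqP ? /orP[] /eqP ?; subst;
    try absurd_neq; right; do 2 eexists; split; eassumption.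
case=> pu pw; have Up : uniq [:: a; b; u; w; p] by uniq_goal.
have [p' [q' [f' pa' qa' pp qp]]] := type1_double_other t1 Up.
left; apply: (@star_dg _ [:: (a, u); (a, w); (p, q); (p', q')]).
star_goal.
Qed.

(** * Low vertices of degree three and their partners *)

Definition type3 a b u c d c' d' : Prop :=
  [/\ hi u, low a, low b, low c & low d] /\ [/\ low c', low d',
     star a [:: (b, u); (c, d); (c', d')]
   & forall x y, E a x y ->
       [\/ same_pair x y b u, same_pair x y c d | same_pair x y c' d']].

Lemma type3_edges a b u c d c' d' : type3 a b u c d c' d' ->
  [/\ E a b u, E a c d & E a c' d'].
Proof. by case=> _ [_ _ /andP[_] /= /and4P[]]. Qed.

Lemma type3_only_hi a b u c d c' d' : type3 a b u c d c' d' -> only_hi u a.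
Proof.
move=> t; have [e1 _ _] := type3_edges t.
case: t => -[hu la lb lc ld] [lc' ld' _ eE]; split.
  by split=> //; exists b; edge.
by move=> w [hw [x e]]; cases3_at (eE _ _ e).
Qed.

Lemma type3_leaf a b u c d c' d' : type3 a b u c d c' d' -> leaf u a b.
Proof.
move=> t; have [e1 _ _] := type3_edges t.
case: t => -[hu la lb lc ld] [lc' ld' _ eE]; split=> // x e.
by cases3_at (eE _ _ e).
Qed.

Lemma type3_low a b u c d c' d' x y : type3 a b u c d c' d' ->
  E a x y -> x != u -> y != u -> low x /\ low y.
Proof.
move=> [[hu la lb lc ld] [lc' ld' _ eE]] e xu yu.
by cases3_at (eE _ _ e); split.
Qed.

(* [b] has degree 3 and [u] as its only high neighbour, so that it must pass the
   claim of [a] on to [x]. *)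
Definition poor a b u d x : Prop :=
  [/\ only_hi u a, leaf u a b, [/\ low a, low b, low d & low x],
      star b [:: (a, u); (a, d); (x, u)]
    & forall y z, E b y z ->
        [\/ same_pair y z a u, same_pair y z a d | same_pair y z x u]].

Definition three_hi a b u x y w : Prop :=
  [/\ [/\ hi u, hi w & w != u], [/\ low a, low x & low y],
      star b [:: (a, u); (x, u); (y, w)]
    & forall p q, E b p q ->
        [\/ same_pair p q a u, same_pair p q x u | same_pair p q y w]].

Lemma poor_neq a b u d x : poor a b u d x -> ~ bad b -> x != d.
Proof.
move=> [oa lf [la lb ld lx] /andP[_ /= /and4P[e1 e2 e3 _]] bE] nb.
apply/eqP => ?; subst x.
have N : ~~ E a u d.
  apply/negP => f; have ? := lf.2 d ltac:(edge); subst; absurd_neq.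
have U3 : uniq [:: a; u; d] by uniq_goal.
case: (sat U3 N) => -[p [m [q [U f1 f2]]]].
- have g : E a u b by edge.
  have U' : uniq [:: a; p; m; q; u] by uniq_hyps; uniq_goal.
  case: (edge_meets_path U' f1 f2 g) => ?; subst; uniq_hyps.
  + have f3 : E b a m by edge. by cases3_at (bE _ _ f3).
  + have f3 : E b a p by edge. by cases3_at (bE _ _ f3).
  + have f3 : E b m u by edge. by cases3_at (bE _ _ f3).
- have g : E a d b by edge.
  have U' : uniq [:: a; p; m; q; d] by uniq_hyps; uniq_goal.
  case: (edge_meets_path U' f1 f2 g) => ?; subst; uniq_hyps.
  + have f3 : E b a m by edge. by cases3_at (bE _ _ f3).
  + have f3 : E b a p by edge. by cases3_at (bE _ _ f3).
  + have f3 : E b m d by edge. by cases3_at (bE _ _ f3).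
have g : E u d b by edge.
have U' : uniq [:: u; p; m; q; d] by uniq_hyps; uniq_goal.
case: (edge_meets_path U' f1 f2 g) => ?; subst; uniq_hyps.
- have f3 : E b u m by edge. by cases3_at (bE _ _ f3).
- have f3 : E b u p by edge. by cases3_at (bE _ _ f3).
- have f3 : E b m d by edge. by cases3_at (bE _ _ f3).
Qed.

Lemma poor_only_hi a b u d x : poor a b u d x -> only_hi u b.
Proof.
move=> [oa lf [la lb ld lx] /andP[_ /= /and4P[e1 e2 e3 _]] bE].
have hu : hi u by case: oa => -[].
split; first by split=> //; exists a; edge.
by move=> w [hw [z e]]; cases3_at (bE _ _ e).
Qed.

(** The path from [u] to [b] must run through {a, d, b}, which forces the edge {u, x, d}. Saturation
    at {b, d, u} adds a third edge {x, w, u}, and [edge_missing] a fourth one that avoids [u]. *)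
Lemma poor_robust a b u d x : poor a b u d x -> ~ bad b -> ~ bad x ->
  robust x.
Proof.
move=> pr nb nx; have xd := poor_neq pr nb.
case: (pr) => oa lf [la lb ld lx] /andP[_ /= /and4P[e1 e2 e3 _]] bE.
have hu : hi u by case: oa => -[].
have ob := poor_only_hi pr.
have xa : x != a.
  apply/eqP => ?; subst x; have := lf.2 b; move: pr => [_ _ _ /andP[U _] _].
  by move: U; rewrite /= !inE /= !eqxx ?orbT ?andbF.
have exd : E u x d.
  have [p [m [q [U f1 f2]]]] := nbad_only_hi_lpath nb ob.
  have ? := leaf_path lf U f1 f2; subst q; uniq_hyps.
  have f3 : E b m a by edge.
  cases3_at (bE _ _ f3).
  have ? : x = p by apply: (@link_nbr_eq u b d a); first [edge|neq].
  by subst; edge.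
have N : ~~ E b d u by apply/negP => f; cases3_at (bE _ _ f).
have U3 : uniq [:: b; d; u] by uniq_goal.
have [w [ew wb wd]] : exists w, [/\ E x w u, w != b & w != d].
  case: (sat U3 N) => -[p [m [q [U f1 f2]]]].
  - by uniq_hyps; cases3_at (bE _ _ f1).
  - by uniq_hyps; cases3_at (bE _ _ f1).
  have g : E d u x by edge.
  have U' : uniq [:: d; p; m; q; u] by uniq_hyps; uniq_goal.
  case: (edge_meets_path U' f1 f2 g) => ?; subst; uniq_hyps.
  - have ? : b = q by apply: (@link_nbr_eq u x m d); first [edge|neq].
    by subst; absurd_neq.
  - by exists q; split; first [edge|neq].
  - by exists m; split; first [edge|neq].
case: (pselect (has1 x)) => [|n1]; first by right.
have [p [q [f pu qu]]] := edge_missing nx n1 hu.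
left; apply: (@star_dg _ [:: (b, u); (d, u); (w, u); (p, q)]); star_goal.
Qed.

(** A partner that is not robust has exactly the edges {a, u}, {x, u} and one that misses [u]. If
    the latter contains [a], the partner is [poor]. If not, [u] is not its only high neighbour:
    [leaf_path] would produce another edge through [a]. *)
Lemma type3_partner a b u c d c' d' : type3 a b u c d c' d' ->
  ~ bad a -> ~ bad b -> ~ robust b ->
  (exists d0 x, poor a b u d0 x) \/ (exists x y w, three_hi a b u x y w).
Proof.
move=> t na nb nr; have oa := type3_only_hi t; have lf := type3_leaf t.
have e1 : E a b u by case: lf.
case: (t) => -[hu la lb lc ld] [lc' ld' _ eE].
have n1 : ~ has1 b by move=> h; apply: nr; right.
have ltb : dg b < 8 by rewrite ltnNge; apply/negP => h; apply: nr; left.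
have [x ex xa] := nbad_leaf_second na oa lf lb.
have lx : low x by apply/negP => hx; apply: n1; exists u, x; split.
have [p [q [f pu qu]]] := edge_missing nb n1 hu.
have Sb : star b [:: (a, u); (x, u); (p, q)] by star_goal.
have bE y z := star3_full (x := y) (y := z) Sb ltb.
case: (boolP (a \in [:: p; q])) => apq.
  left; have [d0 [ed d0u]] : exists d0, E b a d0 /\ d0 != u.
    move: apq; rewrite !inE => /orP[] /eqP ?; subst.
    - by exists q; split; [edge|neq].
    - by exists p; split; [edge|neq].
  have bu : b != u by neq.
  have [_ ld0] := type3_low t (x := b) (y := d0) ltac:(edge) bu d0u.
  have ax : a != x by neq.
  have S2 : star b [:: (a, u); (a, d0); (x, u)] by star_goal.
  exists d0, x; split=> // y z e.
  exact: star3_full S2 ltb e.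
move: apq; rewrite !inE negb_or => /andP[ap aq].
right; case: (pselect (only_hi u b)) => [ob|nob].
  have [y [v [z [U f1 f2]]]] := nbad_only_hi_lpath nb ob.
  have ? := leaf_path lf U f1 f2; subst z; uniq_hyps.
  have f3 : E b v a by edge.
  by cases3_at (bE _ _ f3).
have [w [hw [z ew]] wu] : exists2 w, hinb w b & w != u.
  apply: contrapT => nw; apply: nob; split.
    by split=> //; exists a; edge.
  move=> w hw; apply/eqP/negP => /negP wu; apply: nw; by exists w.
have lz : low z by apply/negP => hz; apply: n1; exists w, z; split.
have S2 : star b [:: (a, u); (x, u); (z, w)].
  have zu : z != u by neq.
  by star_goal.
exists x, z, w; split=> // y v e.
exact: star3_full S2 ltb e.
Qed.

(* Excluded by [twin_leavesF]. *)
Definition twin_leaves a x b u y w d p m q : Prop :=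
  [/\ [/\ hi u, hi w, leaf u a b & leaf u x b],
      [/\ low a, low x, low b & low d] /\ [/\ low p, low m & low q],
      uniq [:: a; p; m; q; x; b] /\ [/\ E a x d, E a p m & E m q x],
      (forall y z, E a y z -> [\/ same_pair y z b u, same_pair y z x d |
        same_pair y z p m])
      /\ (forall y z, E x y z -> [\/ same_pair y z b u, same_pair y z a d |
        same_pair y z m q])
    & forall y' z, E b y' z ->
       [\/ same_pair y' z a u, same_pair y' z x u | same_pair y' z y w]].

Lemma twin_leaves_sym a x b u y w d p m q :
  twin_leaves a x b u y w d p m q -> twin_leaves x a b u y w d q m p.
Proof.
move=> [[hu hw l1 l2] [[la lx lb ld] [lp lm lq]] [U [e1 e2 e3]] [aE xE] bE].
split; first by split.
- by split; split.
- by split; [uniq_hyps; uniq_goal | split; edge].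
- split.
  by move=> y' z /xE[]; [constructor 1 | constructor 2 |
    case=> -[-> ->]; constructor 3; [right | left]].
  by move=> y' z /aE[]; [constructor 1 | constructor 2 |
    case=> -[-> ->]; constructor 3; [right | left]].
- by move=> y' z /bE[]; [constructor 2 | constructor 1 | constructor 3].
Qed.

Lemma twin_leaves_no_edge a x b u y w d p m q :
  twin_leaves a x b u y w d p m q -> ~ E b p m /\ ~ E u p m.
Proof.
move=> [[hu hw l1 l2] [[la lx lb ld] [lp lm lq]] [U [e1 e2 e3]] [aE xE] bE].
split=> f; uniq_hyps; first by cases3_at (bE _ _ f).
have ux : E u x b by case: l2 => g _; edge.
by have ? : b = p by [apply: (@link_nbr_eq u x m q); first [edge|neq]];
  subst; absurd_neq.
Qed.

(** If [m] and [d] differ, no path completes the non-edge {a, x, m}. *)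
Lemma twin_leaves_mid a x b u y w d p m q :
  twin_leaves a x b u y w d p m q -> m = d.
Proof.
move=> tw; have [nbp nup] := twin_leaves_no_edge tw.
have [nbq nuq] := twin_leaves_no_edge (twin_leaves_sym tw).
case: tw => [[hu hw l1 l2] [[la lx lb ld] [lp lm lq]] [U [e1 e2 e3]] [aE xE] bE].
apply/eqP/negP => /negP md; uniq_hyps.
have M : ~~ E a x m by apply/negP => f; cases3_at (aE _ _ f).
have U3 : uniq [:: a; x; m] by uniq_goal.
case: (sat U3 M) => -[p' [m' [q' [U f1 f2]]]].
- uniq_hyps; have f3 : E x m' q' by edge.
  cases3_at (aE _ _ f1); cases3_at (xE _ _ f3).
- have g : E a m p by edge.
  have U' : uniq [:: a; p'; m'; q'; m] by uniq_hyps; uniq_goal.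
  case: (edge_meets_path U' f1 f2 g) => ?; subst; uniq_hyps.
  + by cases3_at (aE _ _ f1).
  + by cases3_at (aE _ _ f1).
  + cases3_at (aE _ _ f1); [case: nup | case: nbp]; edge.
- have g : E x m q by edge.
  have U' : uniq [:: x; p'; m'; q'; m] by uniq_hyps; uniq_goal.
  case: (edge_meets_path U' f1 f2 g) => ?; subst; uniq_hyps.
  + by cases3_at (xE _ _ f1).
  + by cases3_at (xE _ _ f1).
  + cases3_at (xE _ _ f1); [case: nuq | case: nbq]; edge.
Qed.

(** The path completing {a, d, q} has to leave [a] through {a, b, u} and then use the third edge {b,
    y, w} at [b]; [q] is low, so it is [y]. *)
Lemma twin_leaves_end a x b u y w d p q :
  twin_leaves a x b u y w d p d q -> q = y.
Proof.
move=> [[hu hw l1 l2] [[la lx lb ld] [lp lm lq]] [U [e1 e2 e3]] [aE xE] bE].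
have ux : E u x b by case: l2 => g _; edge.
uniq_hyps.
have M : ~~ E a d q by apply/negP => f; cases3_at (aE _ _ f).
have U3 : uniq [:: a; d; q] by uniq_goal.
case: (sat U3 M) => -[p' [m' [q' [U f1 f2]]]].
- have g : E a d x by edge.
  have g' : E a d p by edge.
  have U' : uniq [:: a; p'; m'; q'; d] by uniq_hyps; uniq_goal.
  case: (edge_meets_path U' f1 f2 g) => ?; subst; uniq_hyps.
  + by cases3_at (aE _ _ f1).
  + by cases3_at (aE _ _ f1).
  + have {}U' : uniq [:: a; p'; m'; x; d] by uniq_goal.
    by case: (edge_meets_path U' f1 f2 g') => ?; subst; try absurd_neq;
      cases3_at (aE _ _ f1).
- uniq_hyps; cases3_at (aE _ _ f1).
  + case: (eqVneq q' x) => [?|qx].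
      by subst; have ? := l2.2 q ltac:(edge); subst; absurd_neq.
    have ? : b = q' by apply: (@link_nbr_eq u x q d); first [edge|neq].
    by subst; absurd_neq.
  + by cases3_at (bE _ _ f2).
- have g : E d q x by edge.
  have U' : uniq [:: d; p'; m'; q'; q] by uniq_hyps; uniq_goal.
  case: (edge_meets_path U' f1 f2 g) => ?; subst; uniq_hyps.
  + have f3 : E x d m' by edge. by cases3_at (xE _ _ f3).
  + have f3 : E x d p' by edge. by cases3_at (xE _ _ f3).
  + have f3 : E x m' q by edge. by cases3_at (xE _ _ f3).
Qed.

Lemma twin_leavesF a x b u y w d p m q : ~ twin_leaves a x b u y w d p m q.
Proof.
move=> tw; have ? := twin_leaves_mid tw; subst m.
have ? := twin_leaves_end tw; have ? := twin_leaves_end (twin_leaves_sym tw).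
by case: tw => _ _ [U _] _ _; subst; uniq_hyps; absurd_neq.
Qed.

Lemma type3_third a b u c d c' d' x z : type3 a b u c d c' d' -> E a x z ->
  x != u -> z != u ->
  exists r s, [/\ E a r s, low r, low s & forall y v, E a y v ->
    [\/ same_pair y v b u, same_pair y v x z | same_pair y v r s]].
Proof.
move=> t e xu zu; have [e1 e2 e3] := type3_edges t.
case: (t) => -[hu la lb lc ld] [lc' ld' _ eE].
cases3_at (eE _ _ e).
- by exists c', d'.
- exists c', d'; split=> // y v /eE[?|/same_pairC ?|?];
    [by constructor 1|by constructor 2|by constructor 3].
- exists c, d; split=> // y v /eE[?|?|?];
    [by constructor 1|by constructor 3|by constructor 2].
- exists c, d; split=> // y v /eE[?|?|/same_pairC ?];
    [by constructor 1|by constructor 3|by constructor 2].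
Qed.

(** Rules out that [a] and [x] both claim from [b]. Reaching [a] from [u] requires an edge {a, x,
    z}, and then saturation at {a, x, b} leaves only a path from [a] to [x], that is,
    [twin_leaves]. *)
Lemma three_hi_twins a b u x y w c d c' d' s r s' r' :
  three_hi a b u x y w -> type3 a b u c d c' d' -> type3 x b u s r s' r' ->
  ~ bad a -> False.
Proof.
move=> [[hu hw wu] [la lx ly] /andP[_ /= /and4P[b1 b2 b3 _]] bE] ta tx na.
have oa := type3_only_hi ta; have l1 := type3_leaf ta; have l2 := type3_leaf tx.
have lb : low b by case: ta => -[].
have ay : a != y.
  apply/eqP => ?; subst y; have /oa.2 ? : hinb w a by split=> //; exists b; edge.
  by subst; absurd_neq.
have xy : x != y.
  apply/eqP => ?; subst y; have ox := type3_only_hi tx.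
  have /ox.2 ? : hinb w x by split=> //; exists b; edge.
  by subst; absurd_neq.
have [z ez] : exists z, E a x z.
  have [p [m [q [U f1 f2]]]] := nbad_only_hi_lpath na oa.
  have g : E u a b by edge.
  case: (edge_meets_path U f1 f2 g) => ?; subst; uniq_hyps.
  + have f3 : E b m u by edge.
    by cases3_at (bE _ _ f3); exists q; edge.
  + by cases3_at (bE _ _ f2).
  + have f3 : E b a m by edge. by cases3_at (bE _ _ f3).
have zu : z != u.
  apply/eqP => ?; subst z; have ? := l1.2 x ltac:(edge); subst; absurd_neq.
have xu : x != u by neq.
have au : a != u by neq.
have [_ lz] := type3_low ta ez xu zu.
have [r1 [r2 [er lr1 lr2 aE]]] := type3_third ta ez xu zu.
have [s1 [s2 [es ls1 ls2 xE]]] := type3_third tx (x := a) (z := z) ltac:(edge)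
  au zu.
have M : ~~ E a x b by apply/negP => f; have f3 : E b a x := ltac:(edge);
  cases3_at (bE _ _ f3).
have U3 : uniq [:: a; x; b] by uniq_goal.
have lowst y' v' : E a y' v' -> y' != b -> v' != b -> low y' /\ low v'.
  by move=> f fy fv; cases3_at (aE _ _ f); split.
have lowst' y' v' : E x y' v' -> y' != b -> v' != b -> low y' /\ low v'.
  by move=> f fy fv; cases3_at (xE _ _ f); split.
case: (sat U3 M) => -[p [m [q [U f1 f2]]]].
- uniq_hyps; have f3 : E x m q by edge.
  have [lp lm] : low p /\ low m by apply: lowst; first [edge|neq].
  have [_ lq] : low m /\ low q by apply: lowst'; first [edge|neq].
  apply: (@twin_leavesF a x b u y w z p m q); split=> //.
    by split; [uniq_goal | split].
  split.
  + move=> y' v' e'; case: (aE _ _ e') => h; [by constructor 1|by constructor 2|].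
    constructor 3; cases3_at (aE _ _ f1); case: h => -[-> ->];
      by [left | right].
  + move=> y' v' e'; case: (xE _ _ e') => h; [by constructor 1|by constructor 2|].
    constructor 3; cases3_at (xE _ _ f3); case: h => -[-> ->];
      by [left | right].
- have g : E a b u by edge.
  have U' : uniq [:: a; p; m; q; b] by uniq_hyps; uniq_goal.
  have [lp lm] : low p /\ low m by apply: lowst => //; uniq_hyps; neq.
  case: (edge_meets_path U' f1 f2 g) => ?; subst; uniq_hyps; try absurd_neq.
  have f3 : E b m u by edge. by cases3_at (bE _ _ f3).
- have g : E x b u by edge.
  have U' : uniq [:: x; p; m; q; b] by uniq_hyps; uniq_goal.
  have [lp lm] : low p /\ low m by apply: lowst' => //; uniq_hyps; neq.
  case: (edge_meets_path U' f1 f2 g) => ?; subst; uniq_hyps; try absurd_neq.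
  have f3 : E b m u by edge. by cases3_at (bE _ _ f3).
Qed.

(** * Discharging *)

(* [v] is a degree-2 vertex with edges {v, x, u}, {v, c, w} whose missing
   charge is carried by [x]. *)
Definition strong v x u : Prop := exists c w,
  [/\ type1 v x u c w, x != c
    & E u x w \/ [/\ ~~ E u c w, E u x c & ~~ E w x c]].

(** Symmetric under exchange of the two edges at [v], so each of [x] and [c] gives one extra sixth
    instead of one of them giving two. *)
Definition balanced v x u : Prop := exists c w,
  [/\ type1 v x u c w, x != c, ~~ E u x w, ~~ E u c w & E u x c /\ E w x c].

(** [v] loses all of {a, v, u} to the degree-2 vertex [a], and takes a sixth back from [x], which
    has at least four edges. *)
Definition centre v x u : Prop :=
  exists a d, [/\ type2A a v u x d, ~ bad a & 8 <= dg x].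

(** The reasons to claim one sixth above the half: a deficit of one ([type3]), a deficit of two
    split over both edges ([type1] with equal partners, [balanced]), or compensation for a claim
    suffered ([poor], [centre]). *)
Definition four v x u : Prop :=
  (exists c d c' d', type3 v x u c d c' d') \/ (exists w, type1 v x u x w) \/
  balanced v x u \/ (exists p d, poor p v u d x) \/ centre v x u.

(* Charge, in sixths, that [v] claims from the edge {v, x, u} with [u] high. *)
Definition demand v x u : nat :=
  if `[< ~ good v >] then 3
  else if `[< exists c d, type2 v x u c d >] then 6
  else if `[< strong v x u >] then 5
  else if `[< four v x u >] then 4
  else 3.

Variant demand_spec v x u : nat -> Prop :=
  | DemandType2 c d of good v & type2 v x u c d : demand_spec v x u 6
  | DemandStrong of good v & strong v x u : demand_spec v x u 5
  | DemandFour of good v & four v x u : demand_spec v x u 4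
  | DemandNone of (good v -> [/\ forall c d, ~ type2 v x u c d, ~ strong v x u
      & ~ four v x u]) : demand_spec v x u 3.

Lemma demandP v x u : demand_spec v x u (demand v x u).
Proof.
rewrite /demand; case: asboolP => [ng|/contrapT g]; first by constructor.
case: asboolP => [[c [d t]]|n2]; first exact: DemandType2 t.
case: asboolP => [s|ns]; first exact: DemandStrong.
case: asboolP => [f|nf]; first exact: DemandFour.
by constructor=> _; split=> // c d t; apply: n2; exists c, d.
Qed.

Lemma four_demand v x u : good v -> four v x u -> 3 < demand v x u.
Proof. by move=> g f; case: demandP => // n; have [] := n g. Qed.

Lemma strong_demand v x u : good v -> strong v x u -> 4 < demand v x u.
Proof.
rewrite /demand; case: asboolP => // g _ s; case: asboolP => // _.
by case: asboolP.
Qed.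

Lemma type2_demand v x u c d : good v -> type2 v x u c d -> 5 < demand v x u.
Proof.
rewrite /demand => g t; case: asboolP => // _.
by case: asboolP => // n; case: n; exists c, d.
Qed.

Lemma demand_good v x u : 3 < demand v x u -> good v.
Proof. by case: demandP. Qed.

Lemma good_self v : good v -> ~ bad v.
Proof. by move=> g; apply: (good_nbad g (n := 0)) => //; apply: ball_refl. Qed.

Lemma good_nbr v x y : good v -> low v -> low x -> E v x y -> ~ bad x.
Proof.
move=> g lv lx e; apply: (good_nbad g (n := 1)) => //.
by apply: ball_step lv lx e; apply: ball_refl.
Qed.

Lemma type1_low a b u c w : type1 a b u c w -> [/\ low a, low b & low c].
Proof. by case=> _ []. Qed.

Lemma type1_robust a b u c w : type1 a b u c w -> b != c -> ~ bad b ->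
  E u b c -> robust b.
Proof.
move=> t bc nb g; have hu : hi u by case: t => -[].
exact: leaf_side_robust (type1_leaf_side t bc) hu nb g.
Qed.

Lemma demand_partner v x u : 3 < demand v x u -> E v x u ->
  robust x \/ (exists c d c' d', type3 v x u c d c' d') /\
     ((exists d y, poor v x u d y) \/ (exists y y' w, three_hi v x u y y' w)).
Proof.
case: demandP => // [c d g t|g [c [w [t xc s]]]|g f] _ e.
- have [lv lx] : low v /\ low x by case: (t) => -[].
  left; apply: (type2_robust t (good_self g)).
  exact: good_nbr g lv lx e.
- have [lv lx _] := type1_low t; have nx := good_nbr g lv lx e.
  left; case: s => [h|[_ h _]]; last exact: type1_robust t xc nx h.
  by right; exists u, w; case: (t) => -[hu hw _] _; split=> //; edge.
case: f => [[c [d [c' [d' t]]]]|[[w t]|[[c [w [t xc n1 n2 [h _]]]]|]]].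
- have [lv lx] : low v /\ low x by case: (t) => -[].
  have nx := good_nbr g lv lx e.
  case: (pselect (robust x)) => [|nr]; first by left.
  right; split; first by exists c, d, c', d'.
  exact: type3_partner t (good_self g) nx nr.
- by left; apply: type1_double_robust t.
- have [lv lx _] := type1_low t; have nx := good_nbr g lv lx e.
  by left; apply: type1_robust t xc nx h.
- case=> [[p [d pr]]|[a [d [_ _ d8]]]]; last by left; left.
  have [_ _ [lp lv ld lx] _ _] := pr.
  by left; apply: (poor_robust pr (good_self g) (good_nbr g lv lx e)).
Qed.

Lemma edges2_dg a b u c d : edges2 a b u c d -> dg a <= 4.
Proof.
move=> [_ _ eE].
have sub : [pred xy : T * T | E a xy.1 xy.2] \subset
   [:: (b, u); (u, b); (c, d); (d, c)].
  apply/fintype.subsetP => -[x y]; rewrite inE /= => /eE.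
  by case=> -[] [-> ->]; rewrite !inE eqxx ?orbT.
exact: leq_trans (subset_leq_card sub) (card_size _).
Qed.

Lemma edges2_has1 a b u c w : edges2 a b u c w -> low a -> low b -> low c ->
  ~ has1 a.
Proof. by move=> [_ _ eE] la lb lc [x [y [e hx hy]]]; cases_at (eE _ _ e). Qed.

Lemma demand_not_robust v x u : 3 < demand v x u -> ~ centre v x u ->
  ~ has1 v /\ dg v < 8.
Proof.
case: demandP => // [c d g t|g [c [w [t xc s]]]|g f] _ nc.
- case: t => -[hu la lb lc ld] t; split; last by have := edges2_dg t; lia.
  exact: edges2_has1 t la lb lc.
- have [la lb lc] := type1_low t; case: t => _ [_ t].
  by split; [exact: edges2_has1 t la lb lc | have := edges2_dg t; lia].
case: f => [[c [d [c' [d' t]]]]|[[w t]|[[c [w [t xc n1 n2 [h _]]]]|]]].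
- case: t => -[hu la lb lc ld] [lc' ld' _ eE]; split.
    by move=> [y [z [e hy hz]]]; cases3_at (eE _ _ e).
  have sub : [pred xy : T * T | E v xy.1 xy.2] \subset
     [:: (x, u); (u, x); (c, d); (d, c); (c', d'); (d', c')].
    apply/fintype.subsetP => -[y z]; rewrite inE /= => /eE.
    by case=> -[] [-> ->]; rewrite !inE eqxx ?orbT.
  exact: leq_ltn_trans (leq_trans (subset_leq_card sub) (card_size _)) _.
- have [la lb lc] := type1_low t; case: t => _ [_ t].
  by split; [exact: edges2_has1 t la lb lc | have := edges2_dg t; lia].
- have [la lb lc] := type1_low t; case: t => _ [_ t].
  by split; [exact: edges2_has1 t la lb lc | have := edges2_dg t; lia].
case=> // -[p [d [_ _ [lp lv ld lx] _ eE]]]; split.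
  by move=> [y [z [e hy hz]]]; cases3_at (eE _ _ e).
have sub : [pred xy : T * T | E v xy.1 xy.2] \subset
   [:: (p, u); (u, p); (p, d); (d, p); (x, u); (u, x)].
  apply/fintype.subsetP => -[y z]; rewrite inE /= => /eE.
  by case=> -[] [-> ->]; rewrite !inE eqxx ?orbT.
exact: leq_ltn_trans (leq_trans (subset_leq_card sub) (card_size _)) _.
Qed.

Lemma centre_asym v x u : centre v x u -> ~ centre x v u.
Proof.
move=> [a [d [t1 _ _]]] [a' [d' [t2 _ _]]].
have L1 := type2A_leaf_side t1.
have [e1 e2 eE] : edges2 a v u x d by case: (t1) => -[_].
have [f1 f2 fE] : edges2 a' x u v d' by case: (t2) => -[_].
case: (leaf_side_link L1 (x := a') ltac:(edge)) => ?; subst.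
  absurd_neq.
have [_ [_ _ g]] := t1; have h : E d a x by edge.
by cases_at (fE _ _ h).
Qed.

(** By [centre_asym] the claim of [x] may be taken not to be a [centre] claim, so [x] has degree at
    most 3 and is not robust. Hence [v] is [type3] and [x] has a second edge through [u] besides {v,
    x, u}. The claims of [x] as a leaf are thus impossible, a degree-2 claim contradicts three
    edges, and a [poor] claim would make [v] robust. *)
Lemma demand_no_conflict v x u : E v x u -> low v -> low x ->
  3 < demand v x u -> demand x v u <= 3.
Proof.
move=> e lv lx dv; rewrite leqNgt; apply/negP => dx.
have e' : E x v u by edge.
wlog nc : v x e lv lx dv dx e' / ~ centre x v u.
  move=> W; case: (pselect (centre x v u)) => [c|nc]; last exact: (W v x).
  by apply: (W x v) => //; apply: centre_asym.
have [n1 lt8] := demand_not_robust dx nc.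
have nr : ~ robust x by case=> //; rewrite leqNgt lt8.
case: (demand_partner dv e) => // -[[c0 [d0 [c0' [d0' t0]]]] s].
have nrv : ~ robust v.
  have [n1v ltv] : ~ has1 v /\ dg v < 8.
    apply: (demand_not_robust dv) => -[a [d [[t _] _ d8]]].
    by rewrite leqNgt lt8 in d8.
  by case=> //; rewrite leqNgt ltv.
have [s3 Ss] : exists s3, star x s3 /\ size s3 = 3.
  by case: s => [[d [y [_ _ _ Ss _]]]|[y [y' [w [_ _ Ss _]]]]]; eexists; split;
    try exact Ss.
have ge6 : 6 <= dg x by case: Ss => Ss s33; have := star_dg Ss; rewrite s33.
have nl : ~ leaf u x v.
  case: s => [[d [y [_ _ _ S _]]]|[y [y' [w [_ _ S _]]]]] l;
    have /andP[U /= A] := S; (have ? : y = v by apply: l.2; move: A;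
      case/and4P=> _ A1 A2 _; edge); subst;
    by move: U; rewrite /= !inE /= !eqxx ?orbT ?andbF.
move: dx; case: demandP => // [c d g t|g [c [w [t xc _]]]|g f] _.
- by apply: nl; exact: type2_leaf t.
- by apply: nl; exact: type1_leaf t xc.
case: f => [[c [d [c' [d' t]]]]|[[w t]|[[c [w [t xc n2 n3 _]]]|[]]]] //.
- by apply: nl; exact: type3_leaf t.
- by case: t => _ [_ /edges2_dg]; rewrite leqNgt (leq_trans _ ge6).
- by apply: nl; exact: type1_leaf t xc.
case=> p [d pr]; apply: nrv.
by apply: (poor_robust pr (good_self g) (good_nbr g lx lv e')).
Qed.

Lemma demand_le6 v x u : demand v x u <= 6.
Proof. by case: demandP. Qed.

Definition share2 v x u : nat :=
  if 3 < demand v x u then demand v x u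
  else if 3 < demand x v u then 6 - demand x v u else 3.

(* The charge, in sixths, that [v] receives from the edge {v, x, y}. *)
Definition share v x y : nat :=
  if hi v then 0
  else if hi x then (if hi y then 6 else share2 v y x)
  else (if hi y then share2 v x y else 2).

Lemma share_sym v x y : share v x y = share v y x.
Proof. by rewrite /share; case: (hi v); case: (hi x); case: (hi y). Qed.

Lemma share2_sum v x u : E v x u -> low v -> low x ->
  share2 v x u + share2 x v u <= 6.
Proof.
move=> e lv lx; rewrite /share2; have := demand_le6 v x u; have := demand_le6 x v u.
case: (ltnP 3 (demand v x u)) => [dv|dv].
  have := demand_no_conflict e lv lx dv.
  by case: (ltnP 3 (demand x v u)); lia.
by case: (ltnP 3 (demand x v u)); lia.
Qed.

Lemma share_edge v x y : E v x y -> share v x y + share x y v + share y v x <= 6.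
Proof.
move=> e; have e2 : E x y v by edge. have e3 : E y v x by edge.
have e4 : E v y x by edge. have e5 : E x v y by edge.
rewrite /share; case hv: (hi v); case hx: (hi x); case hy: (hi y) => //=.
- by rewrite add0n; apply: share2_sum; rewrite ?hx ?hy.
- by rewrite addn0; apply: share2_sum; rewrite ?hv ?hy.
- by rewrite addn0 addnC addnC; apply: share2_sum; rewrite ?hv ?hx.
Qed.

(* Every edge is counted twice, so that a charge of 8 sixths is a weight of 16. *)
Definition weight v : nat :=
  \sum_(xy : T * T | E v xy.1 xy.2) share v xy.1 xy.2.

(** * Lower bounds for the charge of a single vertex *)

Lemma weight_uniq v (s : seq (T * T)) : uniq s ->
  {subset s <= [pred xy : T * T | E v xy.1 xy.2]} ->
  \sum_(xy <- s) share v xy.1 xy.2 <= weight v.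
Proof.
move=> U sub; rewrite big_uniq //=.
rewrite /weight [leqRHS](bigID (fun xy => xy \in s)) /=.
rewrite [X in X + _](_ : _ = \sum_(xy in s) share v xy.1 xy.2) ?leq_addr //.
by apply: eq_bigl => xy; case: (boolP (xy \in s)) => [/sub|]; rewrite ?andbF ?andbT.
Qed.

Lemma weight_star v s : star v s ->
  2 * \sum_(xy <- s) share v xy.1 xy.2 <= weight v.
Proof.
move=> Ss; have /andP[U _] := Ss.
apply: leq_trans (weight_uniq U (star_sub Ss)).
rewrite big_cat big_map /= mul2n -addnn leq_add2l.
by under [leqRHS]eq_bigr => xy _ do rewrite share_sym.
Qed.

Lemma weight2 v p1 q1 p2 q2 k1 k2 : star v [:: (p1, q1); (p2, q2)] ->
  k1 <= share v p1 q1 -> k2 <= share v p2 q2 -> 8 <= k1 + k2 -> 16 <= weight v.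
Proof. by move=> /weight_star; rewrite !big_cons big_nil /=; lia. Qed.

Lemma weight3 v p1 q1 p2 q2 p3 q3 k1 k2 k3 :
  star v [:: (p1, q1); (p2, q2); (p3, q3)] ->
  k1 <= share v p1 q1 -> k2 <= share v p2 q2 -> k3 <= share v p3 q3 ->
  8 <= k1 + k2 + k3 -> 16 <= weight v.
Proof. by move=> /weight_star; rewrite !big_cons big_nil /=; lia. Qed.

Lemma weight4 v p1 q1 p2 q2 p3 q3 p4 q4 k1 k2 k3 k4 :
  star v [:: (p1, q1); (p2, q2); (p3, q3); (p4, q4)] ->
  k1 <= share v p1 q1 -> k2 <= share v p2 q2 -> k3 <= share v p3 q3 ->
  k4 <= share v p4 q4 -> 8 <= k1 + k2 + k3 + k4 -> 16 <= weight v.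
Proof. by move=> /weight_star; rewrite !big_cons big_nil /=; lia. Qed.

Lemma share_low v x y : low v -> low x -> low y -> share v x y = 2.
Proof. by rewrite /share => /negbTE-> /negbTE-> /negbTE->. Qed.

Lemma share_hi v x y : low v -> hi x -> hi y -> share v x y = 6.
Proof. by rewrite /share => /negbTE-> -> ->. Qed.

Lemma share_mixed v x u : low v -> low x -> hi u -> share v x u = share2 v x u.
Proof. by rewrite /share => /negbTE-> /negbTE-> ->. Qed.

Lemma share_claim v x u : low v -> low x -> hi u -> 3 < demand v x u ->
  share v x u = demand v x u.
Proof. by move=> lv lx hu d; rewrite share_mixed // /share2 d. Qed.

Lemma share_ge v x u k : low v -> low x -> hi u -> k <= 3 ->
  demand x v u + k <= 6 -> k <= share v x u.
Proof.
move=> lv lx hu k3; rewrite share_mixed // /share2.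
by case: ltnP; last case: ltnP; lia.
Qed.

Lemma share_ge3 v x u : low v -> low x -> hi u -> demand x v u <= 3 ->
  3 <= share v x u.
Proof. by move=> lv lx hu d; apply: share_ge => //; lia. Qed.

Lemma share_ge2 v x u : low v -> low x -> hi u -> demand x v u <= 4 ->
  2 <= share v x u.
Proof. by move=> lv lx hu d; apply: share_ge => //; lia. Qed.

Lemma share_hi6 v x y : low v -> hi x -> hi y -> 6 <= share v x y.
Proof. by move=> lv hx hy; rewrite share_hi. Qed.

Lemma share_low2 v x y : low v -> low x -> low y -> 2 <= share v x y.
Proof. by move=> lv lx ly; rewrite share_low. Qed.

Lemma share_small_mixed v p u : low v -> low p -> hi u ->
  2 <= share v p u \/ good p /\
  ((exists c d, type2 p v u c d) \/ (strong p v u /\ 1 <= share v p u)).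
Proof.
move=> lv lp hu; have ge k := @share_ge v p u k lv lp hu; move: ge.
case: demandP => [c d g t _|g s ge|g f ge|_ ge].
- by right; split=> //; left; exists c, d.
- by right; split=> //; right; split=> //; apply: ge.
- by left; apply: ge.
- by left; apply: ge.
Qed.

(** Only claims of 5 and 6 sixths leave less than a third; this drives the case distinction in
    [good_weight]. *)
Lemma share_small v x y : E v x y -> low v -> 2 <= share v x y \/
  exists p u, [/\ same_pair x y p u, good p, hi u, low p &
     (exists c d, type2 p v u c d) \/ (strong p v u /\ 1 <= share v x y)].
Proof.
move=> e lv; case: (boolP (hi x)) => hx; case: (boolP (hi y)) => hy.
- by left; rewrite share_hi.
- rewrite share_sym; case: (share_small_mixed lv hy hx) => [|[g h]]; first by left.
  by right; exists y, x; split=> //; right.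
- case: (share_small_mixed lv hx hy) => [|[g h]]; first by left.
  by right; exists x, y; split=> //; left.
- by left; rewrite share_low.
Qed.

(** Degree at least three excludes [type1], and the remaining claims other than [centre] come with a
    unique high neighbour. *)
Lemma demand_two_hi v x u w1 w2 : hinb w1 v -> hinb w2 v -> w1 != w2 ->
  6 <= dg v -> 3 < demand v x u -> centre v x u.
Proof.
move=> h1 h2 w12 d6; have nd a b c d : ~ edges2 v a b c d.
  by move=> /edges2_dg; rewrite leqNgt (leq_trans _ d6).
have no w : ~ only_hi w v.
  by move=> o; move: w12; rewrite (o.2 _ h1) (o.2 _ h2) eqxx.
case: demandP => // [c d g t|g [c [w [t _ _]]]|g f] _.
- by case: (no _ (type2_only_hi t)).
- by case: t => _ [_ /nd].
case: f => [[c [d [c' [d' t]]]]|[[w t]|[[c [w [t _ _ _ _]]]|[[p [d pr]]|//]]]].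
- by case: (no _ (type3_only_hi t)).
- by case: t => _ [_ /nd].
- by case: t => _ [_ /nd].
- by case: (no _ (poor_only_hi pr)).
Qed.

Lemma demand_big v x u : 8 <= dg v \/ has1 v -> 3 < demand v x u ->
  centre v x u.
Proof.
move=> r d; apply: contrapT => nc; have [n1 lt] := demand_not_robust d nc.
by case: r => //; rewrite leqNgt lt.
Qed.

Lemma centre_leaf a v u c d p : type2 a v u c d -> centre p v u -> p != a ->
  exists a', E a v a' /\ type2A a' p u v a.
Proof.
move=> t [a' [d' [t' _ _]]] pa; have L := type2A_leaf_side t'.
have [e1 _] := type2_leaf t.
have [_ f2 _] : edges2 a' p u v d' by case: (t') => -[_].
case: (leaf_side_link L (x := a) ltac:(edge)) => ?; subst.
  by absurd_neq.
by exists a'; split=> //; edge.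
Qed.

(** A larger claim needs degree two, so the edges at [c] would be {c, v, u} and {c, a, d}: [type2]
    is excluded by [type2_twins], [type1] by {c, a, d} having no high vertex. *)
Lemma type2A_c_demand a v u c d : type2A a v u c d ->
  demand c v u <= 4 /\ (2 <= share v c u).
Proof.
move=> t; case: (t) => t2 [vc vd g].
case: (t2) => -[hu la lv lc ld] [e1 e2 eE].
have e3 : E c a d by edge.
suff d4 : demand c v u <= 4 by split=> //; apply: share_ge2.
case: demandP => // [c' d' gc tc|gc [c' [w [tc _ _]]]].
- case: (tc) => -[_ _ _ lc' ld'] [_ _ cE]; cases_at (cE _ _ e3).
  + by case: (type2_twins t2 tc).
  + by case: (type2_twins t2 (type2_flip tc)).
- by case: (tc) => -[_ hw _] [[_ _ lc'] [_ _ cE]]; cases_at (cE _ _ e3).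
Qed.

Lemma type2_kept p v u c d : good p -> low v -> type2 p v u c d ->
  exists x y, [/\ E v x y, 2 <= share v x y, low x & ~ same_pair x y p u].
Proof.
move=> g lv t; have np := good_self g.
case: (type2_cases t np) => [[c' [d' t']]|[d' t']].
  case: (t') => t2 [vc vd g']; case: (t2) => -[hu lp _ lc ld] [e1 e2 eE].
  exists c', u; split=> //; first by edge.
    by case: (type2A_c_demand t').
  by case=> -[? ?]; subst; absurd_neq.
case: (t') => -[hu lp _ _ ld] [e1 e2 eE].
exists p, d'; split=> //; first by edge.
  by rewrite share_low.
by case=> -[? ?]; subst; absurd_neq.
Qed.

Lemma asym_c_dg p v u c w : type1 p v u c w -> v != c -> E u v c ->
  ~~ E w v c -> exists t y, [/\ E u v t, E t y c, uniq [:: p; v; c; u; t],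
    y \notin [:: u; v; p] & star c [:: (p, w); (u, v); (t, y)]].
Proof.
move=> t1 vc g n; have L := type1_leaf_side t1 vc.
case: (t1) => -[hu hw uw] [[lp lv lc] [e1 e2 eE]].
case: (leaf_side_third L g) => [[t [y [g1 g2 U N]]]|[f _]]; last first.
  have f' : E w v c by edge.
  by rewrite f' in n.
exists t, y; split=> //; uniq_hyps.
by star_goal.
Qed.

Lemma asym_c_demand p v u c w : type1 p v u c w -> v != c -> E u v c ->
  ~~ E u c w -> ~~ E w v c -> demand c v u <= 3.
Proof.
move=> t1 vc g n1 n2; have L := type1_leaf_side t1 vc.
case: (t1) => -[hu hw uw] [[lp lv lc] [e1 e2 eE]].
have [t [y [_ _ _ _ /star_dg /= d6]]] := asym_c_dg t1 vc g n2.
have h1 : hinb u c by split=> //; exists v; edge.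
have h2 : hinb w c by split=> //; exists p; edge.
rewrite leqNgt; apply/negP => /(demand_two_hi h1 h2 uw d6) [a' [d' [t2 _ _]]].
case: (t2) => -[[_ la' _ _ _] [f1 f2 _]] _.
by case: (leaf_side_link L (x := a') ltac:(edge)) => ?; subst; absurd_neq.
Qed.

Lemma star_pair v x y p q : E v x y -> E v p q -> ~ same_pair p q x y ->
  star v [:: (x, y); (p, q)].
Proof.
move=> e f ns; have ns' : ~ same_pair x y p q.
  by case=> -[? ?]; apply: ns; [left|right].
apply: star_cons => //; first by star_goal.
apply/negP; rewrite /= !inE => /orP[] /eqP [? ?]; subst; apply: ns.
- by left.
- by right.
Qed.

Lemma second_edge v x y : ~ bad v -> E v x y -> hi x -> hi y ->
  exists p q, star v [:: (x, y); (p, q)].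
Proof.
move=> nb e hx hy; apply: contrapT => n; apply: (nbad_dominated nb).
have one p q : E v p q -> same_pair p q x y.
  move=> f; apply: contrapT => ns; apply: n; exists p, q; exact: star_pair.
move=> w [hw [z f]] p q f'.
by case: (one _ _ f) => -[? ?]; case: (one _ _ f') => -[? ?]; subst; auto.
Qed.

(* A vertex with an edge to two high vertices keeps that edge and one third of
   another one. *)
Lemma weight_has1 v : good v -> low v -> has1 v -> 16 <= weight v.
Proof.
move=> g lv [x [y [e hx hy]]].
have [p [q S]] := second_edge (good_self g) e hx hy.
have f : E v p q by have /andP[_ /= /and3P[]] := S.
have kept r z : E v r z -> 2 <= share v r z -> low r -> 16 <= weight v.
  move=> e' k lr; apply: (weight2 _ (share_hi6 lv hx hy) k) => //.
  have rx : r != x by neq.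
  have ry : r != y by neq.
  by star_goal.
case: (share_small f lv) => [k|[s [u [sp gs hu ls h]]]].
  exact: (weight2 S (share_hi6 lv hx hy) k).
have {f} f : E v s u by case: sp => -[? ?]; subst; edge.
case: h => [[c [d t]]|[[c [w [t vc h]]] k]].
  have [r [z [e' k lr _]]] := type2_kept gs lv t.
  exact: kept e' k lr.
have [ls' _ lc] := type1_low t.
have k' : 1 <= share v s u.
  by move: k; case: sp => -[-> ->] //; rewrite share_sym.
case: (t) => -[_ hw uw] [_ [e1 e2 eE]].
case: h => [h|[n1 h n2]]; last first.
  apply: (kept c u) => //; first by edge.
  exact: share_ge2 (leqW (asym_c_demand t vc h n1 n2)).
have N : ~~ E s v w by apply/negP => f'; cases_at (eE _ _ f').
have U3 : uniq [:: s; v; w] by uniq_goal.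
case: (sat U3 N) => -[p' [m [q' [U f1 f2]]]]; uniq_hyps.
- by cases_at (eE _ _ f1).
- by cases_at (eE _ _ f1).
case: (share_small f1 lv) => [k2|[s2 [u2 [sp2 gs2 hu2 ls2 h2]]]].
  by apply: (weight3 _ (share_hi6 lv hu hw) k' (ltnW k2)) => //; star_goal.
case: h2 => [[c' [d' t']]|[_ k2]].
  have [r [z [e' k2 lr _]]] := type2_kept gs2 lv t'.
  exact: kept e' k2 lr.
by apply: (weight3 _ (share_hi6 lv hu hw) k' k2) => //; star_goal.
Qed.

(** The natural candidate is an edge through [w]. If its other low vertex takes more than two thirds
    of it, the structure of that vertex provides a replacement. The last disjunct serves to tell the
    edge found from other edges at [v]. *)
Lemma kept_through v w u : good v -> low v -> ~ has1 v -> hinb w v -> w != u ->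
  hi u -> exists x y, [/\ E v x y, 2 <= share v x y, x != u, y != u &
    hi y \/ forall r s, E x r s -> r = v \/ s = v].
Proof.
move=> g lv n1 [hw [x e]] wu hu.
have lx : low x by apply/negP => hx; apply: n1; exists w, x; split.
have xu : x != u by neq.
have e' : E v x w by edge.
case: (share_small e' lv) => [k|[s [w' [sp gs hw' ls h]]]].
  by exists x, w; split=> //; left.
case: sp => -[? ?]; subst s w'; last by absurd_neq.
case: h => [[c [d t]]|[[c [w2 [t vc h]]] k]].
  case: (type2_cases t (good_self gs)) => [[c' [d' t']]|[d' t']].
    case: (t') => t2 [_ _ g']; case: (t2) => -[_ _ _ lc ld] _.
    exists c', w; split=> //; [by edge|by case: (type2A_c_demand t')|by neq|by
      left].
  case: (t') => -[_ _ _ _ ld] [e1 e2 eE].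
  exists x, d'; split=> //; first by edge.
  - by rewrite share_low.
  - by neq.
  - by right=> r s f; cases_at (eE _ _ f); auto.
have [_ _ lc] := type1_low t.
case: h => [h|[m1 h m2]].
  by case: n1; exists w, w2; case: (t) => -[? hw2 _] _; split=> //; edge.
exists c, w; split=> //; [by edge| |by neq|by left].
exact: share_ge2 (leqW (asym_c_demand t vc h m1 m2)).
Qed.

(** The charges add up to 1 + 3 + 2 + 2: from [p], [c] and a further vertex [s], each together with
    [u], and from an edge avoiding [u]. *)
Lemma weight_strong v p u : good v -> low v -> ~ has1 v -> good p -> strong p v u ->
  16 <= weight v.
Proof.
move=> g lv n1 gp [c [w [t vc h]]].
have L := type1_leaf_side t vc; case: (t) => -[hu hw uw] [[lp _ lc] [e1 e2 eE]].
case: h => [h|[m1 h m2]]; first by case: n1; exists u, w; split=> //; edge.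
have [w1 [hw1 w1u]] := leaf_side_second_hi L hu (good_self g).
have [x [y [f kf xu yu fP]]] := kept_through g lv n1 hw1 w1u hu.
have kc : 3 <= share v c u.
  exact: share_ge3 (asym_c_demand t vc h m1 m2).
have kp : 1 <= share v p u.
  case: (share_small_mixed lv lp hu) => [/ltnW//|[_ [[c' [d' t2]]|[]//]]].
  have o := type2_only_hi t2; have /o.2 ? : hinb w p by split=> //; exists c; edge.
  by subst; rewrite eqxx in uw.
have [s [z [g1 g2 U N S]]] := asym_c_dg t vc h m2.
uniq_hyps.
have ls : low s by apply/negP => hs; apply: n1; exists u, s; split=> //; edge.
case: (share_small_mixed lv ls hu) => [ks|[gs hs]].
  by apply: (weight4 _ kp kc ks kf) => //; star_goal.
(* Here [s] leaves too little of {v, s, u}. It then has degree two with known edges, and saturation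
   at {p, s, c} gives {v, z, c} as a substitute. *)
have third : E v z c.
  have sE : forall r r', E s r r' -> same_pair r r' v u \/ same_pair r r' z c.
    case: hs => [[c' [d' [_ [_ f2 fE]]]]|[[c' [w' [[_ [_ [_ f2 fE]]] _ _]]] _]]
      r r' f';
    have f3 : E s z c := ltac:(edge);
    by cases_at (fE _ _ f3); case: (fE _ _ f') => [|]; auto; move/same_pairC; auto.
  have M : ~~ E p s c by apply/negP => f'; cases_at (eE _ _ f').
  have U3 : uniq [:: p; s; c] by uniq_goal.
  case: (sat U3 M) => -[p' [m [q' [U' f1 f2]]]].
  - uniq_hyps; have f3 : E s m q' by edge.
    by cases_at (eE _ _ f1); cases_at (sE _ _ f3).
  - have g3 : E p c w by edge.
    have U2 : uniq [:: p; p'; m; q'; c] by uniq_hyps; uniq_goal.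
    case: (edge_meets_path U2 f1 f2 g3) => ?; subst; uniq_hyps;
    cases_at (eE _ _ f1).
    + absurd_edge.
    + absurd_edge.
  - have g3 : E s c z by edge.
    have U2 : uniq [:: s; p'; m; q'; c] by uniq_hyps; uniq_goal.
    case: (edge_meets_path U2 f1 f2 g3) => ?; subst; uniq_hyps;
    cases_at (sE _ _ f1).
    + by case: (leaf_side_link L (x := z) ltac:(edge)) => ?; subst;
        try absurd_neq; absurd_edge.
    + by edge.
have nz : ~~ hi z.
  apply/negP => hz; case: hs => [[c' [d' t2]]|[[c' [w' [t2 vc' hh]]] _]].
    have o := type2_only_hi t2; have /o.2 ? : hinb z s by split=> //; exists c;
      edge.
    by subst; absurd_neq.
  case: (t2) => -[_ hw' uw'] [[_ _ lc'] [_ _ fE]].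
  have f3 : E s c z by edge.
  cases_at (fE _ _ f3).
  case: hh => [h'|[_ _ h']]; first by apply: n1; exists u, w'; split=> //; edge.
  absurd_edge.
have kz := share_low2 lv nz lc.
have zu : z != u by neq.
have pz : p != z by neq.
have ns : ~ same_pair x y z c.
  move=> sp; case: fP => [hy|fP].
    by case: sp => -[? ?]; subst; absurd_neq.
  have f3 : E x s y by case: sp => -[Ex Ey]; rewrite Ex Ey; edge.
  by case: (fP _ _ f3) => ?; subst; absurd_neq.
have [xz xc] : (x != z) || (y != c) /\ (x != c) || (y != z).
  split; apply: contraT; rewrite negb_or !negbK => /andP[/eqP ? /eqP ?]; case: ns;
  by [left | right].
apply: (weight4 _ kp kc kz kf) => //.
by case/orP: xz => ?; case/orP: xc => ?; star_goal.
Qed.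

(** The edge {u, v, t} of [leaf_side_third] fails to give a third only if [t] is also a [type2]
    vertex with partner [v]. Saturation at {a, t, c} then gives an edge {v, x, c} or makes [a] and
    [t] twins over the same [u], [c], [d]. *)
Lemma type2A_third v a u c d : low v -> ~ has1 v ->
  (forall p w, good p -> ~ strong p v w) -> type2A a v u c d ->
  [\/ exists x r, [/\ low x, E v x c, E x c r & r != v],
      exists t y, [/\ E u v t, E t y c, uniq [:: a; v; c; u; t],
        y \notin [:: u; v; a] & 2 <= share v t u]
    | E u c d /\ exists t, type2A t v u c d /\ t != a].
Proof.
move=> lv n1 ns tA; have L := type2A_leaf_side tA; case: (tA) => t2 [vc vd g].
case: (t2) => -[hu la _ lc ld] [e1 e2 eE].
case: (leaf_side_third L g) => [[t [y [g1 g2 U N]]]|[f _]]; last first.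
  by constructor 1; exists d, a; split; first [edge | neq | by []].
have lt : low t by apply/negP => ht; apply: n1; exists u, t; split=> //; edge.
case: (share_small_mixed lv lt hu) => [k|[gt [[c2 [d2 t']]|[s _]]]]; last first.
- by case: (ns _ _ gt s).
- have {t'} tt : type2 t v u c y.
    case: (t') => -[_ _ _ lc2 ld2] [f1 f2 fE]; have f3 : E t y c by edge.
    uniq_hyps; cases_at (fE _ _ f3); first [exact: t' | exact: type2_flip t'].
  uniq_hyps; have ty : type2A t v u c y by split=> //; split=> //; neq.
  have L' := type2A_leaf_side ty; case: (tt) => -[_ _ _ _ ly] [f1 f2 fE].
  have M : ~~ E a t c.
    apply/negP => f; cases_at (eE _ _ f).
    have f3 : E d a c by edge.
    by cases_at (fE _ _ f3).
  have U3 : uniq [:: a; t; c] by uniq_goal.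
  have fin z : z = d \/ z = y -> E v z c \/ E u z c ->
     [\/ exists x r, [/\ low x, E v x c, E x c r & r != v],
      exists t y, [/\ E u v t, E t y c, uniq [:: a; v; c; u; t],
        y \notin [:: u; v; a] & 2 <= share v t u]
    | E u c d /\ exists t, type2A t v u c d /\ t != a].
    move=> zdy [h|h].
      constructor 1; case: zdy => Z; rewrite Z in h *.
        by exists d, a; split; first [edge | neq | by []].
      by exists y, t; split; first [edge | neq | by []].
    have z1 : z = d.
      case: (leaf_side_link L (x := z) ltac:(edge)) => // ?.
      by case: zdy => ?; subst; absurd_neq.
    have z2 : z = y.
      case: (leaf_side_link L' (x := z) ltac:(edge)) => // ?.
      by case: zdy => ?; subst; absurd_neq.
    constructor 3; split; first by rewrite -z1; edge.
    by exists t; split; [rewrite -z1 z2 | neq].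
  case: (sat U3 M) => -[p [m [q [U' h1 h2]]]].
  + uniq_hyps; have h3 : E t m q by edge.
    by cases_at (eE _ _ h1); cases_at (fE _ _ h3).
  + have g3 : E a c d by edge.
    have U2 : uniq [:: a; p; m; q; c] by uniq_hyps; uniq_goal.
    apply: (fin d); first by left.
    case: (edge_meets_path U2 h1 h2 g3) => Q; rewrite ?Q in h1 h2 U';
      uniq_hyps; cases_at (eE _ _ h1); by [left; edge | right; edge].
  + have g3 : E t c y by edge.
    have U2 : uniq [:: t; p; m; q; c] by uniq_hyps; uniq_goal.
    apply: (fin y); first by right.
    case: (edge_meets_path U2 h1 h2 g3) => Q; rewrite ?Q in h1 h2 U';
      uniq_hyps; cases_at (fE _ _ h1); by [left; edge | right; edge].
by constructor 2; exists t, y; split.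
Qed.

(** An edge at [a] and an edge at [t] share two vertices or none, so no loose path joins [a] to
    [t]. *)
Lemma forcing_twins a t v u c d : type2A a v u c d -> type2A t v u c d ->
  t != a -> forcing u a.
Proof.
move=> tA tB ta; case: (tA) => t2 [vc vd g]; case: (tB) => t2' _.
case: (t2) => -[hu la lv lc ld] [e1 e2 eE]; case: (t2') => -[_ lt _ _ _] [f1 f2 fE].
split; first exact: type2_only_hi t2.
split=> //; exists t; split=> //; try neq.
- apply: (ball_step (y := v) (w := u)) => //; last by edge.
  by apply: (ball_step (y := a) (w := u)) => //; apply: ball_refl.
- exact: type2_only_hi t2'.
case=> [p [m [q [U h1 h2]]]]; have h3 : E t m q by edge.
uniq_hyps; by cases_at (eE _ _ h1); cases_at (fE _ _ h3).
Qed.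

Lemma forcing_leaf_edge a v u c d : good a -> type2A a v u c d ->
  forcing u a -> ~ has1 v -> exists x w,
  [/\ E v x w, hi w, w != u, low x & E v u x].
Proof.
move=> ga tA fo n1; case: (tA) => t2 [vc vd g].
case: (t2) => -[hu la lv lc ld] [e1 e2 eE].
apply: contrapT => nx; apply: (nbad_forcing_leaf (good_self ga)).
exists u, v; split=> //; first exact: type2_leaf t2.
  by move=> z f; cases_at (eE _ _ f).
move=> x w f hw wu.
have lx : low x by apply/negP => hx; apply: n1; exists x, w.
split=> //; apply/negP => f'; apply: nx; exists x, w; split=> //.
Qed.

Lemma share_two_hi v x u w : low v -> low x -> hi u -> hinb w x -> w != u ->
  (forall p z, good p -> ~ strong p v z) -> 2 <= share v x u.
Proof.
move=> lv lx hu hw wu ns.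
case: (share_small_mixed lv lx hu) => [//|[gx [[c [d t]]|[s _]]]].
  by have := (type2_only_hi t).2 _ hw => ?; subst; absurd_neq.
by case: (ns _ _ gx s).
Qed.

Lemma type2A_no_centre a v u c d p : type2A a v u c d -> p != a ->
  ~ centre p v u.
Proof.
move=> [t2 [vc vd _]] pa ce; have [a' [e tA]] := centre_leaf t2 ce pa.
case: (t2) => -[hu la lv lc ld] [e1 e2 eE].
case: tA => -[-[_ la' _ _ _] _] _.
by cases_at (eE _ _ e).
Qed.

Lemma centre_share v a u c d : good v -> low v -> good a -> type2A a v u c d ->
  8 <= dg c -> 4 <= share v c u.
Proof.
move=> g lv ga tA d8; case: (tA) => -[-[hu la _ lc ld] _] _.
suff d4 : 3 < demand v c u by rewrite share_claim.
case: demandP => // n; have [_ _] := n g; case; do 4!right.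
by exists a, d; split=> //; apply: good_self.
Qed.

(** Nothing is left of {a, v, u}. The [centre] claim brings 4 from {v, c, u}; two more edges with 2
    each have to be found. *)
Lemma weight_type2A_dg8 v a u c d : good v -> low v -> ~ has1 v ->
  (forall p w, good p -> ~ strong p v w) -> good a -> type2A a v u c d ->
  8 <= dg c -> 16 <= weight v.
Proof.
move=> g lv n1 ns ga tA d8; have L := type2A_leaf_side tA.
case: (tA) => t2 [vc vd guvc]; case: (t2) => -[hu la _ lc ld] [e1 e2 eE].
have kc := centre_share g lv ga tA d8.
have [w1 [hw1 w1u]] := leaf_side_second_hi L hu (good_self g).
have [x0 [y0 [f kf xu yu fP]]] := kept_through g lv n1 hw1 w1u hu.
case: (type2A_third lv n1 ns tA) => [[x [r [lx e er rv]]]|[t [y [g1 g2 U N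
  kt]]]|[ucd [t [tB ta]]]].
- have k := share_low2 lv lx lc.
  have ns' : ~ same_pair x0 y0 x c.
    move=> sp; case: fP => [hy|fP].
      by case: sp => -[? ?]; subst; absurd_neq.
    case: sp => -[Ex Ey]; subst x0 y0.
    + by case: (fP _ _ er) => ?; subst; absurd_neq.
    + by case: (fP a d ltac:(edge)) => ?; subst; absurd_neq.
  have xu' : x != u by neq.
  have S : star v [:: (x, c); (c, u)] by star_goal.
  have S3 : star v [:: (x0, y0); (x, c); (c, u)].
    apply: star_cons => //; apply/negP; rewrite /= !inE /swap /= !xpair_eqE.
    rewrite (negbTE xu) (negbTE yu) !andbF !andFb /= !orbF.
    by case/orP => /andP[/eqP ? /eqP ?]; apply: ns'; [left | right].
  exact: (weight3 S3 kf k kc).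
- uniq_hyps; apply: (weight3 _ kc kt kf) => //; star_goal.
have [x [w [e hw wu lx ex]]] := forcing_leaf_edge ga tA (forcing_twins tA tB ta) n1.
have hwx : hinb w x by split=> //; exists v; edge.
have hux : hinb u x by split=> //; exists v; edge.
have k1 := share_two_hi lv lx hu hwx wu ns.
have uw : u != w by neq.
have k2 := share_two_hi lv lx hw hux uw ns.
case: (eqVneq x c) => [?|xc]; last by apply: (weight3 _ kc k1 k2) => //; star_goal.
(* The edge {v, x, u} is now the one already counted, so 4 + 2 is secured and one more edge is
   sought by saturation at {v, c, d}. *)
subst x; have S : star v [:: (c, u); (c, w)] by star_goal.
have fin r z : E v r z -> 2 <= share v r z -> ~ same_pair r z c u ->
    ~ same_pair r z c w -> 16 <= weight v.
  move=> e' k nu nw; have S3 : star v [:: (r, z); (c, u); (c, w)].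
    apply: star_cons => //; apply/negP; rewrite /= !inE /swap /=.
    by case/or4P => /eqP [Er Ez]; [apply: nu; left | apply: nw; left
      | apply: nu; right | apply: nw; right].
  exact: (weight3 S3 k kc k2).
case: (boolP (E v c d)) => M.
  by apply: (fin c d) => //; [exact: share_low2 | |]; case=> -[? ?]; subst;
    absurd_neq.
have U3 : uniq [:: v; c; d] by uniq_goal.
case: (tB) => tt _; case: (tt) => -[_ lt _ _ _] [f1 f2 fE].
case: (sat U3 M) => -[p [m [q [U h1 h2]]]].
- have q1 : E v c u by edge.
  have U2 : uniq [:: v; p; m; q; c] by uniq_hyps; uniq_goal.
  have meet1 := edge_meets_path U2 h1 h2 q1.
  have meet2 := edge_meets_path U2 h1 h2 e; uniq_hyps.
  have [Ep Eq] : p = u /\ q = w.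
    case: meet1 => Q1.
    + split=> //; case: meet2 => Q2 //.
      * by move: wu; rewrite -Q1 -Q2 eqxx.
      * by case: n1; exists u, w; rewrite -{1}Q1 -{1}Q2.
    + have h3 : E u c q by rewrite -Q1; edge.
      by case: (leaf_side_link L h3) => ?; subst; absurd_neq.
    + have h3 : E u c m by rewrite -Q1; edge.
      by case: (leaf_side_link L h3) => ?; subst; absurd_neq.
  subst p q; have lm : low m.
    by apply/negP => hm; apply: n1; exists u, m.
  have hwm : hinb w m by split=> //; exists c; edge.
  apply: (fin m u); [by edge|exact: share_two_hi hwm wu ns| |];
    by case=> -[? ?]; subst; absurd_neq.
- uniq_hyps; case: (share_small h1 lv) => [k|[s [z [sp gs hz ls h]]]].
    by apply: (fin p m) => //; case=> -[? ?]; subst; absurd_neq.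
  case: h => [[c2 [d2 t']]|[s' _]]; last by case: (ns _ _ gs s').
  case: (type2_cases t' (good_self gs)) => [[c' [d' tS]]|[d' tS]]; last first.
    case: (tS) => -[_ _ _ _ ld'] [q1 q2 qE].
    apply: (fin s d'); [by edge|exact: share_low2| |];
      by case=> -[? ?]; subst; absurd_neq.
  have [_ k'] := type2A_c_demand tS.
  case: (tS) => tS2 [vc' vd' g'].
  case: (tS2) => -[_ _ _ lc' ld'] [q1 q2 qE].
  case: (eqVneq c' c) => [?|c'c]; last first.
    by apply: (fin c' z) => //; [edge| |]; case=> -[? ?]; subst; absurd_neq.
  subst c'; case: (eqVneq z u) => [?|zu].
    subst z; case: sp => -[_ Em]; rewrite Em in h2.
    + have h3 : ~~ E u a d.
        by apply/negP => h3; have ? := (type2_leaf t2).2 d ltac:(edge); subst;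
          absurd_neq.
      have qa : q != a by apply/eqP => ?; subst; absurd_edge.
      have ? : v = q by apply: (@link_nbr_eq u c d a); first [edge|neq].
      by subst; absurd_neq.
    + by cases_at (qE _ _ h2).
  case: (eqVneq z w) => [?|zw]; last first.
    by apply: (fin c z) => //; [edge| |]; case=> -[? ?]; subst; absurd_neq.
  subst z; case: (type2A_third lv n1 ns tS) =>
    [[x [r [lx' ee er rv]]]|[t1 [y [g1 g2 U' N' kt]]]|[ucd' [t1 [tB' ta']]]].
  + by apply: (fin x c) => //; [exact: share_low2| |]; case=> -[? ?]; subst;
      absurd_neq.
  + uniq_hyps; have lt1 : low t1 by apply/negP => ht; apply: n1; exists w, t1;
      split=> //; edge.
    by apply: (fin t1 w) => //; [edge| |]; case=> -[? ?]; subst; absurd_neq.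
  (* Here [s] is forcing for [w], while [a], within distance 2 of it, has [u] as its only high
     neighbour. *)
  + case: (nbad_forcing (good_self gs)); exists w; split;
      first exact: forcing_twins tS tB' ta'.
    exists a; split=> //.
      apply: (fintype.subsetP (ball_leq _ (isT : 2 <= 3))).
      apply: (ball_step (y := v) (w := u)) => //; last by edge.
      apply: (ball_step (y := s) (w := w)) => //; exact: ball_refl.
    by move/(type2_only_hi t2).2 => ?; subst; absurd_neq.
have q1 : E c d a by edge.
have q2 : E c d t by edge.
have q3 : E c d u by edge.
have U2 : uniq [:: c; p; m; q; d] by uniq_hyps; uniq_goal.
have au : a != u by neq.
have tu : t != u by neq.
exfalso; clear fin kc kf k1 k2 tA tB L.
case: (edge_meets_path U2 h1 h2 q1) => Q1;
case: (edge_meets_path U2 h1 h2 q2) => Q2;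
case: (edge_meets_path U2 h1 h2 q3) => Q3; rewrite ?Q1 ?Q2 ?Q3 in h1 h2;
try (by move: ta; rewrite -Q1 -Q2 eqxx); try (by move: au; rewrite -Q1 -Q3 eqxx);
try (by move: tu; rewrite -Q2 -Q3 eqxx);
first [ have h3 : E a c t by edge | have h3 : E a c u by edge | have h3 : E t c
  u by edge ];
first [ by cases_at (eE _ _ h3) | by cases_at (fE _ _ h3) ].
Qed.

(** With [type2A_c_dg], [c] has exactly three edges, all of which can be identified. *)
Lemma weight_type2A_small v a u c d : good v -> low v -> ~ has1 v ->
  (forall p w, good p -> ~ strong p v w) -> good a -> type2A a v u c d ->
  dg c < 8 -> 16 <= weight v.
Proof.
move=> g lv n1 ns ga tA d8; have L := type2A_leaf_side tA.
have d6 := type2A_c_dg tA.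
case: (tA) => t2 [vc vd guvc]; case: (t2) => -[hu la _ lc ld] [e1 e2 eE].
have no s : star c s -> 4 <= size s -> False.
  move=> S s4; have := star_dg S; rewrite leqNgt (leq_trans d8) //.
  by rewrite (leq_mul2l 2 4).
have [w1 [hw1 w1u]] := leaf_side_second_hi L hu (good_self g).
have [x0 [y0 [f kf xu yu _]]] := kept_through g lv n1 hw1 w1u hu.
have [_ kc] := type2A_c_demand tA.
have [t [y [g1 g2 U N kt]]] : exists t y, [/\ E u v t, E t y c,
    uniq [:: a; v; c; u; t], y \notin [:: u; v; a] & 2 <= share v t u].
  (* The two other outcomes would give [c] a fourth edge. *)
  case: (type2A_third lv n1 ns tA) => [[x [r [lx e er rv]]]|//|[ucd _]].
    have xu' : x != u by neq.
    case: (leaf_side_third' L guvc) => [[t [y [h1 h2 U N]]]|h].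
      uniq_hyps; case: (no [:: (a, d); (u, v); (v, x); (t, y)]) => //.
      by star_goal.
    case: (no [:: (a, d); (u, v); (v, x); (u, d)]) => //.
    have ud : u != d by neq. have ua : u != a by neq.
    by star_goal.
  have ud : u != d by neq. have ua : u != a by neq.
  case: (leaf_side_third L guvc) => [[t [y [h1 h2 U N]]]|[h _]].
    uniq_hyps; case: (no [:: (a, d); (u, v); (u, d); (t, y)]) => //.
    by star_goal.
  by case: (no [:: (a, d); (u, v); (u, d); (v, d)]) => //; star_goal.
uniq_hyps.
have lt : low t by apply/negP => ht; apply: n1; exists u, t; split=> //; edge.
have Sc : star c [:: (a, d); (u, v); (t, y)] by star_goal.
have cE p q := star3_full (x := p) (y := q) Sc d8.
have huc : hinb u c by split=> //; exists v; edge.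
have hut : hinb u t by split=> //; exists v; edge.
have nct p : p != a -> ~ centre p v u := type2A_no_centre tA.
(* With [y] high, both [c] and [t] have two high neighbours and no claim against [v]: the charges
   are 3 + 3 + 2. *)
case: (boolP (hi y)) => hy.
  have hyc : hinb y c by split=> //; exists t; edge.
  have hyt : hinb y t by split=> //; exists c; edge.
  have uy : u != y by neq.
  have kc3 : 3 <= share v c u.
    apply: share_ge3 => //; rewrite leqNgt; apply/negP.
    move/(demand_two_hi huc hyc uy d6); apply: nct; neq.
  have kt3 : 3 <= share v t u.
    apply: (share_ge3 lv lt hu); case: demandP => [c2 d2 gt tt|gt s|gt fo|//].
    - by have := (type2_only_hi tt).2 _ hyt => ?; subst; absurd_neq.
    - by case: (ns _ _ gt s).
    case: fo => [[c2 [d2 [c3 [d3 tt]]]]|[[w tt]|[[c2 [w [tt vc2 _ _ [_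
      h]]]]|[[p [d2 pr]]|ce]]]].
    - by have := (type3_only_hi tt).2 _ hyt => ?; subst; absurd_neq.
    - case: tt => _ [_ [_ _ tE]]; have h : E t y c by edge.
      by cases_at (tE _ _ h).
    - case: tt => -[_ hw _] [[_ _ lc2] [_ _ tE]]; have h' : E t y c by edge.
      cases_at (tE _ _ h').
      have h3 : E c2 w v by edge.
      by cases3_at (cE _ _ h3).
    - by have := (poor_only_hi pr).2 _ hyt => ?; subst; absurd_neq.
    - by case: (nct t) => //; neq.
  apply: (weight3 _ kc3 kt3 kf) => //; star_goal.
have lc2 : low c := lc.
have oc : only_hi u c.
  split=> // w [hw [z e]].
  by cases3_at (cE _ _ e).
have ac : a != c by neq.
(* With [y] low, [u] is the only high neighbour of [c], and no loose path joins [a] to [c]; so [c]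
   is the second vertex that [forcing] asks for. *)
have fo : forcing u a.
  split; first exact: type2_only_hi t2.
  split=> //; exists c; split=> //.
  - apply: (ball_step (y := v) (w := u)) => //; last by edge.
    by apply: (ball_step (y := a) (w := u)) => //; apply: ball_refl.
  case=> [p [m [q [U h1 h2]]]].
  have q1 : E a c d by edge.
  have meet := edge_meets_path U h1 h2 q1.
  have h3 : E c m q by edge.
  uniq_hyps; cases_at (eE _ _ h1); cases3_at (cE _ _ h3);
  by case: meet => Q; subst; absurd_neq.
have [x [w [e hw wu lx ex]]] := forcing_leaf_edge ga tA fo n1.
have hwx : hinb w x by split=> //; exists v; edge.
have hux : hinb u x by split=> //; exists v; edge.
have uw : u != w by neq.
have k1 := share_two_hi lv lx hu hwx wu ns.
have k2 := share_two_hi lv lx hw hux uw ns.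
have xc : x != c.
  apply/eqP => ?; subst x; have h : E c v w by edge.
  by cases3_at (cE _ _ h).
case: (eqVneq x t) => [?|xt]; last first.
  apply: (weight4 _ kc kt k1 k2) => //; star_goal.
subst x; have St : star t [:: (v, u); (v, w); (y, c)] by star_goal.
have t6 := star_dg St.
have k1' : 3 <= share v t u.
  apply: share_ge3 => //; rewrite leqNgt; apply/negP.
  move/(demand_two_hi hut hwx uw t6); apply: nct; neq.
case: (leqP (demand t v w) 3) => [|/(demand_two_hi hut hwx uw t6)].
  move/(share_ge3 lv lt hw) => k2'.
  apply: (weight3 _ kc k1' k2') => //; star_goal.
(* [t] claims from {v, t, w} as a [centre] only; the vertex [a'] behind this claim lies in the low
   edge {a', v, d'}, a further third for [v]. *)
case=> a' [d' [tA' _ _]]; case: (tA') => -[-[_ la' _ _ ld'] [q1 q2 qE]] _.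
have kx := share_low2 lv la' ld'.
have a'u : a' != u by neq. have d'u : d' != u by neq.
have a'w : a' != w by neq. have d'w : d' != w by neq.
apply: (weight4 _ kc kt k2 kx) => //; star_goal.
Qed.

Lemma weight_type2A v a u c d : good v -> low v -> ~ has1 v ->
  (forall p w, good p -> ~ strong p v w) -> good a -> type2A a v u c d ->
  16 <= weight v.
Proof.
move=> g lv n1 ns ga tA; case: (leqP 8 (dg c)).
  exact: weight_type2A_dg8 tA.
exact: weight_type2A_small tA.
Qed.

Lemma star_more v s : star v s -> 2 * size s < dg v ->
  exists p q, star v ((p, q) :: s).
Proof.
move=> S lt; apply: contrapT => n.
have sub : [pred xy : T * T | E v xy.1 xy.2] \subset s ++ map swap s.
  apply/fintype.subsetP => -[x y]; rewrite inE /= => e.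
  by apply: contraT => nin; case: n; exists x, y; apply: star_cons.
have := leq_trans lt (subset_leq_card sub).
move/leq_trans => /(_ _ (card_size _)).
by rewrite size_cat size_map addnn -mul2n ltnn.
Qed.

Lemma weight_except v (s : seq (T * T)) :
  (forall x y, E v x y -> (x, y) \notin s -> 2 <= share v x y) ->
  2 * (dg v - size s) <= weight v.
Proof.
move=> k; rewrite /weight (bigID (fun xy => xy \in s)) /=.
apply: leq_trans (leq_addl _ _); rewrite mulnC.
apply: (@leq_trans (\sum_(xy : T * T | E v xy.1 xy.2 && (xy \notin s)) 2)).
  rewrite sum_nat_const leq_mul2r /= leq_subLR.
  have -> : dg v = #|[pred xy : T * T | E v xy.1 xy.2]| by [].
  rewrite -(cardID (mem s) [pred xy : T * T | E v xy.1 xy.2]).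
  rewrite leq_add //.
    apply: leq_trans (card_size s); apply: subset_leq_card.
    by apply/fintype.subsetP => xy; rewrite inE => /andP[].
  apply: subset_leq_card; apply/fintype.subsetP => xy.
  by rewrite !inE => /andP[n e]; apply/andP.
by apply: leq_sum => -[x y] /andP[/= e n]; apply: k.
Qed.

(** All edges at [a1] and [a2] contain [v], so no path completes {a1, v, a2} and it is an edge. This
    determines both neighbourhoods, and {a1, u1, a2} (if u1 = u2) or {a1, u2, v} is a non-edge that
    no path completes. *)
Lemma type2B_unique v a1 a2 u1 u2 d1 d2 : type2 a1 v u1 v d1 ->
  type2 a2 v u2 v d2 -> a1 = a2.
Proof.
move=> t1 t2; apply/eqP/negP => /negP a12;
  case: (t1) => -[hu1 la1 lv _ ld1] [e1 e1' E1].
case: (t2) => -[hu2 la2 _ _ ld2] [e2 e2' E2].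
have e : E a1 v a2.
  apply: contraT => M; have U3 : uniq [:: a1; v; a2] by uniq_goal.
  case: (sat U3 M) => -[p [m [q [U h1 h2]]]]; uniq_hyps.
  - by cases_at (E1 _ _ h1).
  - by cases_at (E1 _ _ h1).
  - by have h3 : E a2 m q := ltac:(edge); cases_at (E2 _ _ h3).
have e' : E a2 v a1 by edge.
have D1 : d1 = a2 by cases_at (E1 _ _ e).
have D2 : d2 = a1 by cases_at (E2 _ _ e').
subst d1 d2; case: (eqVneq u1 u2) => [?|u12].
  subst u2; have M : ~~ E a1 u1 a2 by apply/negP => f; cases_at (E1 _ _ f).
  have U3 : uniq [:: a1; u1; a2] by uniq_goal.
  case: (sat U3 M) => -[p [m [q [U h1 h2]]]]; uniq_hyps.
  - by cases_at (E1 _ _ h1).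
  - by cases_at (E1 _ _ h1).
  - by have h3 : E a2 m q := ltac:(edge); cases_at (E2 _ _ h3).
have M : ~~ E a1 u2 v by apply/negP => f; cases_at (E1 _ _ f).
have U3 : uniq [:: a1; u2; v] by uniq_goal.
case: (sat U3 M) => -[p [m [q [U h1 h2]]]].
- by uniq_hyps; cases_at (E1 _ _ h1).
- by uniq_hyps; cases_at (E1 _ _ h1).
have g : E u2 v a2 by edge.
have U' : uniq [:: u2; p; m; q; v] by uniq_hyps; uniq_goal.
case: (edge_meets_path U' h1 h2 g) => Q; rewrite ?Q in h1 h2 U; uniq_hyps.
- by have h3 : E a2 u2 m := ltac:(edge); cases_at (E2 _ _ h3).
- by have h3 : E a2 q v := ltac:(edge); cases_at (E2 _ _ h3).
- by have h3 : E a2 m v := ltac:(edge); cases_at (E2 _ _ h3).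
Qed.

Lemma type2B_reach a v u d : type2 a v u v d -> only_hi u v -> ~ bad v ->
  exists y, [/\ E u d y, y != v & y != a].
Proof.
move=> t ov nv; have lf := type2_leaf t; case: (t) => -[hu la lv _ ld] [e1 e2 eE].
have [x [m [y [U f1 f2]]]] := nbad_only_hi_lpath nv ov.
have ? := leaf_path lf U f1 f2; subst y; uniq_hyps.
have f3 : E a v m by edge.
by cases_at (eE _ _ f3); exists x; split; first [edge|neq].
Qed.

(** By [type2B_dg], [v] has exactly four edges. If {v, u, d} is among them, saturation at {a, u, d}
    and the path from [u] to [v] identify the rest; if not, [link_nbr_eq] leads to a
    contradiction. *)
Lemma type2B_dg4 a v u d : type2 a v u v d -> ~ bad a -> ~ bad v -> low v ->
  ~ has1 v -> dg v < 10 -> exists q y,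
  [/\ E v u d, E v u q, E u d q, E q y d
    & uniq [:: a; d; v; u; q; y]].
Proof.
move=> t na nv lv n1 d10; have lf := type2_leaf t; have oa := type2_only_hi t.
case: (t) => -[hu la _ _ ld] [e1 e2 eE].
have lowu x : E v u x -> low x.
  by move=> e; apply/negP => hx; apply: n1; exists u, x.
have [x ex [xa xd]] : exists2 x, E v u x & x != a /\ (x = d \/ ~~ E v u d).
  case: (boolP (E v u d)) => h; first by exists d => //; split; [neq | left].
  by have [x ex xa] := nbad_leaf_second na oa lf lv; exists x => //;
    split=> //; right.
have S3 : star v [:: (a, u); (a, d); (u, x)].
  have ad : a != d by neq. have ud : u != d by neq.
  by star_goal.
have [p [q S4]] := star_more S3 (ltnW (type2B_dg t na)).
have eP : E v p q by have /andP[_ /= /andP[]] := S4.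
have vE y z : E v y z -> [\/ same_pair y z a u, same_pair y z a d
    | same_pair y z u x \/ same_pair y z p q].
  move/(star_full_lt S4 d10); rewrite /= !inE /swap /=.
  case/or4P => [h|h|h|]; last case/or4P => [h|h|h|/orP[h|h]].
  - by constructor 3; right; apply: same_pairE; rewrite h.
  - by constructor 1; apply: same_pairE; rewrite h.
  - by constructor 2; apply: same_pairE; rewrite h.
  - by constructor 3; left; apply: same_pairE; rewrite h.
  - by constructor 3; right; apply: same_pairE; rewrite h orbT.
  - by constructor 1; apply: same_pairE; rewrite h orbT.
  - by constructor 2; apply: same_pairE; rewrite h orbT.
  - by constructor 3; left; apply: same_pairE; rewrite h orbT.
have new y z : same_pair y z p q -> [/\ ~ same_pair y z a u, ~ same_pair y z a d
    & ~ same_pair y z u x].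
  have /andP[U _] := S4; move=> sp; split=> sp'; move: U; case: sp => -[? ?];
    case: sp' => -[? ?]; subst; rewrite /= !inE /swap /= !eqxx ?orbT ?andbF //.
have [pa qa] : p != a /\ q != a.
  have [m1 m2 _] := new p q (or_introl (conj erefl erefl)).
  split; apply/eqP => ?; subst.
  - by have h : E a v q := ltac:(edge); cases_at (eE _ _ h);
      [case: m1 | case: m2]; left.
  - by have h : E a v p := ltac:(edge); cases_at (eE _ _ h);
      [case: m1 | case: m2]; right.
case: (eqVneq x d) => [?|xnd].
  subst x; clear xd.
  have N : ~~ E a u d by apply/negP => f; cases_at (eE _ _ f).
  have U3 : uniq [:: a; u; d] by uniq_goal.
  case: (sat U3 N) => -[p' [m [q' [U h1 h2]]]].
  - by uniq_hyps; cases_at (eE _ _ h1).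
  - by uniq_hyps; cases_at (eE _ _ h1).
  have U' : uniq [:: u; p'; m; q'; d] by uniq_hyps; uniq_goal.
  have g : E u d v by edge.
  have meet := edge_meets_path U' h1 h2 g.
  have [m' [y [g1 g2 m'a Uy]]] : exists m' y, [/\ E v u m', E m' y d, m' != a &
    uniq [:: a; d; v; u; m'; y]].
    uniq_hyps; case: meet => ?; subst.
    + by exists m, q'; split; [edge|edge|neq|uniq_goal].
    + have h3 : E v u p' by edge. have h4 : E v q' d by edge.
      case: (vE _ _ h3) => [[] [? ?]|[] [? ?]|[[] [? ?]|Q1]]; subst; try absurd_neq.
      case: (vE _ _ h4) => [[] [? ?]|[] [? ?]|[[] [? ?]|Q2]]; subst; try absurd_neq.
      by case: Q1 => -[? ?]; case: Q2 => -[? ?]; subst; absurd_neq.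
    + have ? : a = p' by apply: (@link_nbr_eq u v m d); first [edge|neq].
      by subst; absurd_neq.
  uniq_hyps; have lm := lowu _ g1.
  have Q : same_pair u m' p q.
    by case: (vE _ _ g1) => [[] [? ?]|[] [? ?]|[[] [? ?]|//]]; subst; absurd_neq.
  have ov : only_hi u v.
    split; first by split=> //; exists a; edge.
    move=> w [hw [z e]].
    case: (vE _ _ e) => [[] [? ?]|[] [? ?]|[[] [? ?]|Q']]; subst;
      try absurd_neq; try by [].
    by case: Q => -[? ?]; case: Q' => -[? ?]; subst => //; absurd_neq.
  have [y2 [k1 k2 k3]] := type2B_reach t ov nv.
  have ? : m' = y2 by apply: (@link_nbr_eq u v d a); first [edge|neq].
  subst y2; exists m', y; split=> //; uniq_goal.
case: xd => [/eqP|nE]; first by rewrite (negbTE xnd).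
have lx := lowu _ ex.
exfalso; case: (boolP (u \in [:: p; q])) => uin.
  have [x2 [ex2 x2x x2a]] : exists x2, [/\ E v u x2, x2 != x & x2 != a].
    have [m1 m2 m3] := new p q (or_introl (conj erefl erefl)).
    move: uin; rewrite !inE => /orP[] /eqP ?; subst.
    - exists q; split=> //; apply/eqP => ?; subst; apply: m3; by left.
    - exists p; split=> //; first by edge.
      apply/eqP => ?; subst; apply: m3; by right.
  have lx2 := lowu _ ex2.
  have ov : only_hi u v.
    split; first by split=> //; exists a; edge.
    move=> w [hw [z e]].
    case: (vE _ _ e) => [[] [? ?]|[] [? ?]|[[] [? ?]|Q']]; subst;
      try absurd_neq; try by [].
    have : same_pair u x2 p q.
      by case: (vE _ _ ex2) => [[] [? ?]|[] [? ?]|[[] [? ?]|//]]; subst; absurd_neq.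
    by case=> -[? ?]; case: Q' => -[? ?]; subst => //; absurd_neq.
  have [y2 [k1 k2 k3]] := type2B_reach t ov nv.
  have x2d : x2 != d by apply/eqP => ?; subst; absurd_edge.
  have ? : x = y2 by apply: (@link_nbr_eq u v d a); first [edge|neq].
  have ? : x2 = y2 by apply: (@link_nbr_eq u v d a); first [edge|neq].
  by subst; absurd_neq.
move: uin; rewrite !inE negb_or => /andP[up uq].
have N : ~~ E a v x by apply/negP => f; cases_at (eE _ _ f).
have U3 : uniq [:: a; v; x] by uniq_goal.
case: (sat U3 N) => -[p' [m [q' [U h1 h2]]]].
- by uniq_hyps; cases_at (eE _ _ h1).
- by uniq_hyps; cases_at (eE _ _ h1).
have U' : uniq [:: v; p'; m; q'; x] by uniq_hyps; uniq_goal.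
have g : E v x u by edge.
have meet := edge_meets_path U' h1 h2 g; uniq_hyps.
have Q : same_pair p' m p q.
  by case: (vE _ _ h1) => [[] [? ?]|[] [? ?]|[[] [? ?]|//]]; subst; absurd_neq.
have [p'u mu] : p' != u /\ m != u by case: Q => -[-> ->]; split; neq.
case: meet => ?; subst; try absurd_neq.
have ? : a = x by apply: (@link_nbr_eq u v m p'); first [edge|neq].
by subst; absurd_neq.
Qed.

Lemma share_small_type2B v x y : E v x y -> low v ->
  (forall p w, good p -> ~ strong p v w) ->
  (forall p w c d, good p -> ~ type2A p v w c d) ->
  2 <= share v x y \/
  exists p w d, [/\ same_pair x y p w, good p & type2 p v w v d].
Proof.
move=> e lv ns n2; case: (share_small e lv) => [|[p [w [sp gp hw lp h]]]].
  by left.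
right; case: h => [[c [d t]]|[/ns []//]].
case: (type2_cases t (good_self gp)) => [[c' [d' t']]|[d' t']].
  by case: (n2 _ _ _ _ gp t').
by exists p, w, d'.
Qed.

(** Only {a, v, u} is lost. Five edges leave four thirds; with four edges the charges are 2 + 3 + 3,
    from {a, d}, {d, u} and {q, u}. *)
Lemma weight_type2B v a u d : good v -> low v -> ~ has1 v ->
  (forall p w, good p -> ~ strong p v w) ->
  (forall p w c d', good p -> ~ type2A p v w c d') ->
  good a -> type2 a v u v d -> 16 <= weight v.
Proof.
move=> g lv n1 ns n2 ga t; case: (leqP 10 (dg v)) => [d10|d10].
  apply: leq_trans (weight_except (s := [:: (a, u); (u, a)]) _).
    by rewrite /= (leq_mul2l 2 8) /= leq_subRL // (leq_trans _ d10).
  move=> x y e; case: (share_small_type2B e lv ns n2) =>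
    [//|[p [w [d' [sp gp t']]]]].
  have ? := type2B_unique t t'; subst p.
  have ? : w = u by apply: (type2_only_hi t).2;
    case: t' => -[hw _ _ _ _] [f _ _]; split=> //; exists v; edge.
  subst w; rewrite !inE negb_or !xpair_eqE.
  by case: sp => -[-> ->]; rewrite !eqxx ?andbF.
have [q [y [e3 e4 e5 e6 U]]] := type2B_dg4 t (good_self ga) (good_self g) lv n1 d10.
case: (t) => -[hu la _ _ ld] [e1 e2 eE].
have lq : low q by apply/negP => hq; apply: n1; exists u, q.
uniq_hyps; have k1 := share_low2 lv la ld.
have da : d != a by neq.
have k2 : 3 <= share v d u.
  apply: share_ge3 => //; rewrite leqNgt; apply/negP => D.
  have Sd : star d [:: (a, v); (v, u); (u, q); (q, y)] by star_goal.
  have [a' [f [[[_ la' _ _ _] [f1 f2 fE]] _]]] :=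
    centre_leaf t (demand_big (or_introl (star_dg Sd)) D) da.
  by cases_at (eE _ _ f).
have h : E q u d by edge.
have k3 : 3 <= share v q u.
  apply: (share_ge3 lv lq hu); case: demandP =>
    [c2 d2 gq [[_ _ _ lc ld2] [_ _ qE]]|gq /ns|gq|//].
  - by cases_at (qE _ _ h).
  - by [].
  case=> [[c [d2 [c' [d2' [[_ _ _ lc ld2] [lc' ld2' _ qE]]]]]]|].
    by cases3_at (qE _ _ h).
  case=> [[w [[_ hw uw] [_ [_ _ qE]]]]|]; first by cases_at (qE _ _ h).
  case=> [[c [w [[[_ hw uw] [[_ _ lc] [_ _ qE]]] _ _ _ _]]]|].
    by cases_at (qE _ _ h).
  case=> [[p [d2 [_ lf [lp _ ld2 _] _ qE]]]|ce].
    cases3_at (qE _ _ h).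
    by have ? := lf.2 v ltac:(edge); subst; absurd_neq.
  have qa : q != a by neq.
  have [a' [f tA]] := centre_leaf t ce qa.
  have [t2 _] := tA; have lf := type2_leaf t2; case: (t2) => -[_ la' _ _ _] _.
  cases_at (eE _ _ f).
  by have ? := lf.2 v ltac:(edge); subst; absurd_neq.
apply: (weight3 _ k1 k2 k3) => //; star_goal.
Qed.

(** * Vertices that receive at least a third of every edge *)

Section Vertex.

Variable v : T.
Hypotheses (g : good v) (lv : low v) (n1 : ~ has1 v).
Hypothesis kept : forall x y, E v x y -> 2 <= share v x y.

Lemma weight_dg8 : 8 <= dg v -> 16 <= weight v.
Proof.
move=> d8; apply: leq_trans (weight_except (s := [::]) _).
  by rewrite subn0 (leq_mul2l 2 8).
by move=> x y e _; apply: kept.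
Qed.

Lemma low_of_hi x u : E v x u -> hi u -> low x.
Proof. by move=> e hu; apply/negP => hx; apply: n1; exists x, u. Qed.

Lemma claimant x u : dg v < 8 -> E v x u -> 3 < demand x v u ->
  (exists c d c' d', type3 x v u c d c' d') /\
  ((exists d y, poor x v u d y) \/ (exists y y' w, three_hi x v u y y' w)).
Proof.
move=> d8 e D; have e' : E x v u by edge.
by case: (demand_partner D e') => // -[|//]; rewrite leqNgt d8.
Qed.

Lemma demand_dg6 x u : dg v < 6 -> E v x u -> demand x v u <= 3.
Proof.
move=> d6 e; rewrite leqNgt; apply/negP => D.
have [_ h] := claimant (leq_trans d6 (isT : 6 <= 8)) e D.
have no s : star v s -> size s = 3 -> False.
  by move=> /star_dg + s3; rewrite s3 leqNgt d6.
by case: h => [[d [y [_ _ _ S _]]]|[y [y' [w [_ _ S _]]]]]; apply: (no _ S).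
Qed.

Lemma share_strong x u : hi u -> low x -> strong v x u -> 5 <= share v x u.
Proof.
move=> hu lx /(strong_demand g) d; rewrite share_claim //.
exact: leq_trans d.
Qed.

Lemma share_four x u : hi u -> low x -> four v x u -> 4 <= share v x u.
Proof. by move=> hu lx /(four_demand g) d; rewrite share_claim. Qed.

(** The charges are 4 + 4 if the partners coincide or in the [balanced] case, and 5 + 3 otherwise;
    the edge that decides exists because [v] is not [bad_type1]. *)
Lemma weight_type1 x u c w : dg v < 6 -> type1 v x u c w -> star v [:: (x, u);
  (c, w)] ->
  16 <= weight v.
Proof.
move=> d6 t S; have tS := type1_swap t; case: (t) =>
  -[hu hw uw] [[_ lx lc] [e f eE]].
case: (eqVneq x c) => [?|xc].
  subst c; apply: (weight2 S (k1 := 4) (k2 := 4)) => //; apply: share_four => //.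
    by right; left; exists w.
  by right; left; exists u.
have cx : c != x by neq.
have [k3 k3'] : 3 <= share v x u /\ 3 <= share v c w.
  by split; apply: share_ge3 => //; apply: demand_dg6.
have rt : reached_type1 x u c w.
  by apply: contrapT => n; apply: (nbad_type1 (good_self g)); exists x, u, c, w.
have SL : strong v x u -> 16 <= weight v.
  by move=> s; apply: (weight2 S (share_strong hu lx s) k3').
have SR : strong v c w -> 16 <= weight v.
  by move=> s; apply: (weight2 S k3 (share_strong hw lc s)).
case: (boolP (E u x w)) => [h|A1]; first by apply: SL; exists c, w; split=> //;
  left.
case: (boolP (E u c w)) => [h|A2].
  by apply: SR; exists x, u; split=> //; left; edge.
case: (boolP (E u x c)) => [h|A3]; case: (boolP (E w x c)) => [h'|A4].
- apply: (weight2 S (k1 := 4) (k2 := 4)) => //; apply: share_four => //.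
    by do 2!right; left; exists c, w.
  do 2!right; left; exists x, u; split=> //; last by split; edge.
  - by apply: contra A2 => ?; edge.
  - by apply: contra A1 => ?; edge.
- by apply: SL; exists c, w; split=> //; right.
- apply: SR; exists x, u; split=> //; right; split; last 1 first.
  - by apply: contra A3 => ?; edge.
  - by apply: contra A1 => ?; edge.
  - by edge.
by case: rt => h; absurd_edge.
Qed.

Lemma weight_dg_lt6 : dg v < 6 -> 16 <= weight v.
Proof.
move=> d6; have nb := good_self g.
have [u [hu [x e]]] : exists u, hinb u v.
  (* A vertex without high neighbours is vacuously [bad_dominated]. *)
  apply: contrapT => n; apply: (nbad_dominated nb) => w hw.
  by case: n; exists w.
have {}e : E v x u by edge.
have [p [q [f pu qu]]] := edge_missing nb n1 hu.
have lx := low_of_hi e hu.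
have S : star v [:: (x, u); (p, q)] by star_goal.
have E2 : edges2 v x u p q by split=> // y z; apply: star2_full.
case: (boolP (hi q)) => hq; last case: (boolP (hi p)) => hp.
- have lp := low_of_hi f hq; apply: (weight_type1 d6 _ S).
  by split; first by split=> //; neq.
- have f' : E v q p by edge.
  have S' : star v [:: (x, u); (q, p)] by star_goal.
  apply: (weight_type1 d6 _ S'); split; first by split=> //; neq.
  by split=> //; apply: edges2_flip.
have t : type2 v x u p q by split.
apply: (weight2 S (k1 := 6) _ (share_low2 lv hp hq)) => //.
have d := type2_demand g t; rewrite share_claim //.
exact: leq_trans d.
Qed.

(** A [poor] vertex collects 2 + 2 + 4 by passing the claim on. In the [three_hi] case there is no
    second claimant: [three_hi_twins] excludes [y], and [z] would need another edge at [v] through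
    [w]. The charges are then 2 + 3 + 3. *)
Lemma weight_claimed x u : dg v < 8 -> E v x u -> hi u -> 3 < demand x v u ->
  16 <= weight v.
Proof.
move=> d8 e hu D; have lx := low_of_hi e hu; have gx := demand_good D.
have [[c [d [c' [d' tx]]]] h] := claimant d8 e D.
case: h => [[d0 [y pr]]|[y [z [w th]]]].
  case: (pr) => _ _ [_ _ ld ly] S _; have /andP[_ /= /and4P[e1 e2 e3 _]] := S.
  have k : 4 <= share v y u.
    by apply: share_four => //; do 3!right; left; exists x, d0.
  by apply: (weight3 S (kept e1) (share_low2 lv lx ld) k).
case: (th) => -[_ hw wu] [_ ly lz] S vE.
have /andP[U /= /and4P[e1 e2 e3 _]] := S.
apply: (weight3 S (kept e1) (k2 := 3) (k3 := 3)) => //; apply: share_ge3 => //;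
  rewrite leqNgt; apply/negP => D'.
  have [[s [r [s' [r' ty]]]] _] := claimant d8 e2 D'.
  exact: (three_hi_twins th tx ty (good_self gx)).
have gz := demand_good D'.
have [[s [r [s' [r' tz]]]] _] := claimant d8 e3 D'.
have [y' h y'z] := nbad_leaf_second (good_self gz) (type3_only_hi tz)
  (type3_leaf tz) lv.
by cases3_at (vE _ _ h).
Qed.

Lemma weight_unclaimed : 6 <= dg v -> dg v < 8 ->
  (forall x u, E v x u -> hi u -> demand x v u <= 3) -> 16 <= weight v.
Proof.
move=> d6 d8 nc; have nb := good_self g.
have [u [hu [x e]]] : exists u, hinb u v.
  apply: contrapT => n; apply: (nbad_dominated nb) => w hw.
  by case: n; exists w.
have {}e : E v x u by edge.
have [p [q [f pu qu]]] := edge_missing nb n1 hu.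
have lx := low_of_hi e hu.
have S : star v [:: (x, u); (p, q)] by star_goal.
have k1 y w : E v y w -> hi w -> 3 <= share v y w.
  by move=> e' hw; apply: share_ge3 => //; [exact: low_of_hi e' hw | exact: nc].
have k3 y w : E v y w -> hi y || hi w -> 3 <= share v y w.
  by move=> e' /orP[h|h]; [rewrite share_sym; apply: k1 => //; edge | apply: k1].
have [r [s S3]] := star_more S (ltnW d6).
have /andP[_ /= /and4P[e1 _ _ _]] := S3.
case: (boolP (hi p || hi q)) => h1.
  by apply: (weight3 S3 (kept e1) (k1 _ _ e hu) (k3 _ _ f h1)).
case: (boolP (hi r || hi s)) => h2.
  by apply: (weight3 S3 (k3 _ _ e1 h2) (k1 _ _ e hu) (kept f)).
move: h1 h2; rewrite !negb_or => /andP[lp lq] /andP[lr ls].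
apply: (weight3 S3 (kept e1) (k2 := 4) _ (kept f)) => //.
apply: share_four => //; left; exists r, s, p, q; split=> //; split=> //.
  have /andP[U A] := S3; rewrite /star; apply/andP; split.
    move: U; rewrite -(perm_uniq (s1 := [:: (x, u); (r, s);
      (p, q)] ++ map swap [:: (x, u); (r, s); (p, q)])) //.
    by apply/permP => a; rewrite /= addnCA [in X in _ + (_ + (_ + X))]addnCA.
  by move: A => /= /and4P[-> -> ->].
move=> y z /(star3_full S3 d8)[]; by [constructor 2|constructor 1|constructor 3].
Qed.

Lemma weight_dg_lt8 : dg v < 8 -> 16 <= weight v.
Proof.
move=> d8; case: (ltnP (dg v) 6) => [|d6]; first exact: weight_dg_lt6.
case: (pselect (exists x u, [/\ E v x u, hi u & 3 < demand x v u])) =>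
  [[x [u [e hu D]]]|n].
  exact: weight_claimed e hu D.
apply: weight_unclaimed => // x u e hu; rewrite leqNgt; apply/negP => D.
by apply: n; exists x, u.
Qed.

End Vertex.

Theorem good_weight v : good v -> low v -> 16 <= weight v.
Proof.
move=> g lv; case: (pselect (has1 v)) => [h|n1]; first exact: weight_has1.
case: (pselect (exists p u, good p /\ strong p v u)) => [[p [u [gp s]]]|ns].
  exact: weight_strong s.
have {}ns p w : good p -> ~ strong p v w by move=> gp s; apply: ns; exists p, w.
case: (pselect (exists p u c d, good p /\ type2A p v u c d)) =>
  [[p [u [c [d [gp t]]]]]|nA].
  exact: weight_type2A t.
have {}nA p w c d : good p -> ~ type2A p v w c d.
  by move=> gp s; apply: nA; exists p, w, c, d.
case: (pselect (exists p u d, good p /\ type2 p v u v d)) =>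
  [[p [u [d [gp t]]]]|nB].
  exact: weight_type2B t.
have kept x y : E v x y -> 2 <= share v x y.
  move=> e; case: (share_small_type2B e lv ns nA) => // -[p [w [d [_ gp t]]]].
  by case: nB; exists p, w, d.
case: (leqP 8 (dg v)); first exact: weight_dg8.
exact: weight_dg_lt8.
Qed.

(** * Bad vertices are few *)

Lemma ball_low n x y : low x -> y \in ball n x -> low y.
Proof.
move=> lx; elim: n y => [|n IH] y /=; first by rewrite inE => /eqP->.
by rewrite inE => /exists_inP[z /IH lz /orP[/eqP<-//|/and3P[]]].
Qed.

Lemma ball_trans m n x y z :
  y \in ball m x -> z \in ball n y -> z \in ball (m + n) x.
Proof.
move=> yB; elim: n z => [|n IH] z /=; first by rewrite inE addn0 => /eqP->.
rewrite addnS inE => /exists_inP[t /IH tB h].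
by rewrite inE; apply/exists_inP; exists t.
Qed.

Lemma ball1 x y w : low x -> low y -> E x y w -> y \in ball 1 x.
Proof. by move=> lx ly; apply: ball_step => //; apply: ball_refl. Qed.

Lemma ball_sym n x y : y \in ball n x -> x \in ball n y.
Proof.
elim: n y => [|n IH] y /=; first by rewrite !inE eq_sym.
rewrite inE => /exists_inP[z /IH xB h].
apply: (ball_trans (m := 1) _ xB); case/orP: h =>
  [/eqP->|/and3P[lz ly /existsP[w e]]].
  exact: ball_refl.
by apply: (ball1 (w := w)) => //; edge.
Qed.

Lemma ball_mono m n x y : m <= n -> y \in ball m x -> y \in ball n x.
Proof. by move=> mn; apply: (fintype.subsetP (ball_leq _ mn)). Qed.

Lemma far_edge p q x : low p -> low q -> q \notin ball 1 p -> ~~ E p q x.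
Proof. by move=> lp lq; apply: contra; apply: ball1. Qed.

Lemma far_hi p q x m y : low p -> low q -> q \notin ball 2 p -> E p x m ->
  E m y q -> hi m.
Proof.
move=> lp lq far e f; apply: contraT => lm; case/negP: far.
apply: (ball_trans (m := 1) (n := 1) (y := m));
  first by apply: (ball1 (w := x)) => //; edge.
by apply: (ball1 (w := y)) => //; edge.
Qed.

Lemma far_sym n x y : y \notin ball n x -> x \notin ball n y.
Proof. by apply: contra; apply: ball_sym. Qed.

Lemma far_le m n x y : m <= n -> y \notin ball n x -> y \notin ball m x.
Proof. by move=> mn; apply: contra; apply: ball_mono. Qed.

Lemma far_neq n x y : y \notin ball n x -> x != y.
Proof. by apply: contraNneq => ->; apply: ball_refl. Qed.

Lemma far_left m n x y z : y \notin ball (m + n) x -> z \in ball m x ->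
  y \notin ball n z.
Proof. by move=> far zB; apply: contra far; apply: ball_trans. Qed.

Lemma far_right m n x y z : y \notin ball (n + m) x -> z \in ball m y ->
  z \notin ball n x.
Proof.
move=> far zB; apply: contra far => zx; apply: ball_trans zx _.
exact: ball_sym.
Qed.

(* Of three vertices far apart, the path supplied by saturation joins two, and
   its middle vertex must be high. *)
Lemma far_share x y z : low x -> low y -> low z ->
  y \notin ball 2 x -> z \notin ball 2 x -> z \notin ball 2 y -> exists w,
  [\/ hinb w x /\ hinb w y, hinb w x /\ hinb w z | hinb w y /\ hinb w z].
Proof.
move=> lx ly lz xy xz yz.
have U3 : uniq [:: x; y; z].
  by rewrite /= !inE negb_or !(far_neq xy, far_neq xz, far_neq yz).
have N := far_edge z lx ly (far_le (isT : 1 <= 2) xy).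
have mk p q p' m q' : low p -> low q -> q \notin ball 2 p -> E p p' m -> E m q' q ->
    hinb m p /\ hinb m q.
  move=> lp lq far e f; have hm := far_hi lp lq far e f.
  by split; split=> //; [exists p' | exists q']; edge.
by case: (sat U3 N) => -[p [m [q [U e f]]]]; exists m;
  [constructor 1 | constructor 2 | constructor 3]; apply: mk e f.
Qed.

(** Every edge at [x] or [y] contains [w], so no path completes {x, y, w}. *)
Lemma bad_dominated_far x y w : low x -> low y -> hinb w x -> hinb w y ->
  bad_dominated x -> bad_dominated y -> y \notin ball 1 x -> False.
Proof.
move=> lx ly hx hy bx by_ far; have N := far_edge w lx ly far.
have wx : w != x by case: hx => hw _; neq.
have wy : w != y by case: hy => hw _; neq.
have xy := far_neq far; have U3 : uniq [:: x; y; w] by uniq_goal.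
case: (sat U3 N) => -[p [m [q [U e f]]]]; uniq_hyps.
- by case: (bx _ hx _ _ e) => ?; subst; absurd_neq.
- by case: (bx _ hx _ _ e) => ?; subst; absurd_neq.
- by case: (by_ _ hy _ _ e) => ?; subst; absurd_neq.
Qed.

Lemma bad_unreached_far x y w : low x -> low y -> hinb w x -> hinb w y ->
  bad_unreached x -> bad_unreached y -> y \notin ball 2 x -> False.
Proof.
move=> lx ly hx hy [u [ox nx]] [u' [oy ny]] far.
have N := far_edge w lx ly (far_le (isT : 1 <= 2) far).
have ? := ox.2 _ hx; have ? := oy.2 _ hy; subst u u'.
have wx : w != x by case: hx => hw _; neq.
have wy : w != y by case: hy => hw _; neq.
have xy := far_neq far; have U3 : uniq [:: x; y; w] by uniq_goal.
case: (sat U3 N) => [[p [m [q [U e f]]]]|P|P].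
- have hm := far_hi lx ly far e f.
  have /ox.2 ? : hinb m x by split=> //; exists p; edge.
  by subst; uniq_hyps; absurd_neq.
- by apply: nx; exact: path3_lpath (path3_sym P).
- by apply: ny; exact: path3_lpath (path3_sym P).
Qed.

(** Saturation at {x, b, y}: a path to [y] has middle vertex [w], but the edges {x, w, p} and {b, w,
    p} are all equal to {x, b, w}. *)
Lemma bad_leaf_far x y w : low x -> low y -> hinb w x -> hinb w y ->
  bad_leaf x -> bad_leaf y -> y \notin ball 3 x -> False.
Proof.
move=> lx ly hx hy [u [b [ox lf lb bE]]] [u' [b' [oy _ _ _]]] far.
have ? := ox.2 _ hx; have ? := oy.2 _ hy; subst u u'.
have hw : hi w by case: hx. have e0 := lf.1.
have xb : b \in ball 1 x by apply: ball1 e0.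
have far2 := far_le (isT : 2 <= 3) far.
have farb := far_left (m := 1) (n := 2) far xb.
have N : ~~ E x b y.
  by have := far_edge b lx ly (far_le (isT : 1 <= 3) far); apply: contra => ?; edge.
have ? := far_neq far; have ? := far_neq farb.
have U3 : uniq [:: x; b; y] by uniq_goal.
case: (sat U3 N) => -[p [m [q [U e f]]]].
- have U' : uniq [:: x; p; m; q; b] by uniq_hyps; uniq_goal.
  case: (edge_meets_path U' e f e0) => ?; subst; uniq_hyps.
  + by have ? := lf.2 m ltac:(edge); subst; absurd_neq.
  + by have ? := lf.2 p ltac:(edge); subst; absurd_neq.
  + by have ? := bE m ltac:(edge); subst; absurd_neq.
- have hm := far_hi lx ly far2 e f.
  have /ox.2 ? : hinb m x by split=> //; exists p; edge.
  by subst; have ? := lf.2 p ltac:(edge); subst; uniq_hyps; absurd_neq.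
- have hm := far_hi lb ly farb e f.
  have /oy.2 ? : hinb m y by split=> //; exists q; edge.
  by subst; have ? := bE p ltac:(edge); subst; uniq_hyps; absurd_neq.
Qed.

Lemma bad_type1_swap a : bad_type1 a -> forall w, hinb w a ->
  exists b c v, [/\ type1 a b w c v, b != c & ~ reached_type1 b w c v].
Proof.
case=> b [u [c [v [t bc nr]]]] w [hw [x e]].
case: (t) => -[hu hv uv] [[la lb lc] [e1 e2 eE]].
cases_at (eE _ _ e); first by exists b, c, v.
exists c, b, u; split; [exact: type1_swap|neq|].
case=> h; apply: nr; [constructor 2|constructor 1|constructor 4|constructor 3];
  edge.
Qed.

Lemma type1_unreached a b u c w : type1 a b u c w -> b != c ->
  ~ reached_type1 b u c w -> ~ lpath u a.
Proof.
move=> t bc nr lp; apply: nr.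
case: (leaf_side_lpath (type1_leaf_side t bc) lp) => h.
  by constructor 3.
by constructor 1; edge.
Qed.

(** Neither vertex is reached from [w], so saturation at {w, x, y} shows that they share their
    second high neighbour [v] too. Saturation at {w, b, y} then gives an edge {b, p, v}, which
    closes a triangle with {v, c, x} and {x, w, b}. *)
Lemma bad_type1_far x y w : low x -> low y -> hinb w x -> hinb w y ->
  bad_type1 x -> bad_type1 y -> y \notin ball 3 x -> False.
Proof.
move=> lx ly hx hy /bad_type1_swap /(_ _ hx) [b [c [v [t bc nr]]]].
move=> /bad_type1_swap /(_ _ hy) [b' [c' [v' [t' bc' nr']]]] far.
have nx := type1_unreached t bc nr; have ny := type1_unreached t' bc' nr'.
have lf := type1_leaf t bc.
case: (t) => -[hw hv wv] [[_ lb lc] [e1 e2 eE]].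
case: (t') => -[_ hv' wv'] [[_ lb' lc'] [e1' e2' eE']].
have far2 := far_le (isT : 2 <= 3) far.
have xb : b \in ball 1 x by apply: ball1 e1.
have farb := far_left (m := 1) (n := 2) far xb.
have xy := far_neq far; have by_ := far_neq farb.
have hiy m q : hi m -> E m q y -> m != w -> m = v'.
  move=> hm f mw; have f' : E y m q by edge.
  by cases_at (eE' _ _ f').
have N1 : ~~ E w x y by have := far_edge w lx ly (far_le (isT : 1 <= 3) far);
  apply: contra => ?; edge.
have U1 : uniq [:: w; x; y] by uniq_goal.
have vv : v = v'.
  case: (sat U1 N1) => [P|P|[p [m [q [U e f]]]]].
  - by case: nx; apply: path3_lpath P.
  - by case: ny; apply: path3_lpath P.
  have hm := far_hi lx ly far2 e f; uniq_hyps.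
  have -> : v = m by cases_at (eE _ _ e).
  by apply: hiy hm f _; neq.
subst v'.
have N2 : ~~ E w b y by have := far_edge w lb ly (far_le (isT : 1 <= 2) farb);
  apply: contra => ?; edge.
have U2 : uniq [:: w; b; y] by uniq_goal.
case: (sat U2 N2) => [[p [m [q [U e f]]]]|P|[p [m [q [U e f]]]]].
- have U' : uniq [:: w; p; m; q; b] by uniq_hyps; uniq_goal.
  have ? := leaf_path lf U' e f; subst q; uniq_hyps.
  have f' : E x m b by edge.
  by cases_at (eE _ _ f').
- by case: ny; apply: path3_lpath P.
have hm := far_hi lb ly farb e f; uniq_hyps.
have mw : m != w by neq.
have ? := hiy _ _ hm f mw; subst m.
case: (eqVneq p c) => [?|pc].
  by apply: nr; constructor 4; subst; edge.
case: (eqVneq p x) => [?|px].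
  by subst; have f' : E x b v := ltac:(edge); cases_at (eE _ _ f').
apply: (notri (a := b) (x := p) (b := v) (y := c) (c := x) (z := w));
  first [edge|uniq_goal].
Qed.

Lemma forcing_far a u z : forcing u a -> low z -> z \notin ball 4 a -> hinb u z.
Proof.
move=> [oa [la [q [lq qB oq aq np]]]] lz far.
have far2 := far_le (isT : 2 <= 4) far.
have farq := far_left (m := 2) (n := 2) far qB.
have N : ~~ E a q z.
  by have := far_edge q la lz (far_le (isT : 1 <= 4) far); apply: contra => ?; edge.
have ? := far_neq far; have ? := far_neq farq.
have U3 : uniq [:: a; q; z] by uniq_goal.
case: (sat U3 N) => [P|[p [m [r [U e f]]]]|[p [m [r [U e f]]]]].
- by case: np; apply: path3_lpath P.
- have hm := far_hi la lz far2 e f.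
  have /oa.2 <- : hinb m a by split=> //; exists p; edge.
  by split=> //; exists r; edge.
- have hm := far_hi lq lz farq e f.
  have /oq.2 <- : hinb m q by split=> //; exists p; edge.
  by split=> //; exists r; edge.
Qed.

Lemma bad_forcing_far x y w : low x -> low y -> hinb w x -> hinb w y ->
  bad_forcing x -> bad_forcing y -> y \notin ball 7 x -> False.
Proof.
move=> lx ly hx hy [u [fx _]] [u' [[oy _] [z [lz zB nz]]]] far.
case: (fx) => ox _; have ? := ox.2 _ hx; have ? := oy.2 _ hy; subst u u'.
apply: nz; apply: forcing_far fx lz _.
exact: (far_right (m := 3) (n := 4) far zB).
Qed.

(** Saturation at {w, b, b'} yields a path b, p, m, q, b' with [m] high. By [forcing_far], [p] and
    [q] are neighbours of [w]; triangle-freeness turns the edges concerned into {p, w, m} and {q, w,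
    m}, and [link_nbr_eq] gives the absurd x = q. *)
Lemma bad_forcing_leaf_far x y w : low x -> low y -> hinb w x -> hinb w y ->
  bad_forcing_leaf x -> bad_forcing_leaf y -> y \notin ball 7 x -> False.
Proof.
move=> lx ly hx hy [u [b [fx lf lb one bE]]] [u' [b' [fy lf' lb' one' bE']]] far.
case: (fx) => ox _; case: (fy) => oy _.
have ? := ox.2 _ hx; have ? := oy.2 _ hy; subst u u'.
have hw : hi w by case: hx. have e0 := lf.1. have e0' := lf'.1.
have xb : b \in ball 1 x by apply: ball1 e0.
have yb : b' \in ball 1 y by apply: ball1 e0'.
have farb := far_left (m := 1) (n := 6) far xb.
have farb' := far_right (m := 1) (n := 6) far yb.
have farbb := far_right (m := 1) (n := 5) farb yb.
have N : ~~ E w b b'.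
  by have := far_edge w lb lb' (far_le (isT : 1 <= 5) farbb);
    apply: contra => ?; edge.
have ? := far_neq farbb.
have U3 : uniq [:: w; b; b'] by uniq_goal.
case: (sat U3 N) => -[p [m [q [U e f]]]].
- have U' : uniq [:: w; p; m; q; b] by uniq_hyps; uniq_goal.
  have ? := leaf_path lf U' e f; subst q; uniq_hyps.
  by have ? := one m ltac:(edge); subst; absurd_neq.
- have U' : uniq [:: w; p; m; q; b'] by uniq_hyps; uniq_goal.
  have ? := leaf_path lf' U' e f; subst q; uniq_hyps.
  by have ? := one' m ltac:(edge); subst; absurd_neq.
have hm := far_hi lb lb' (far_le (isT : 2 <= 5) farbb) e f; uniq_hyps.
have mw : m != w by neq.
have f' : E b' q m by edge.
have [lp np] := bE _ _ e hm mw.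
have [lq nq] := bE' _ _ f' hm mw.
have pB : p \in ball 2 x.
  by apply: ball_step xb lb lp e.
have qB : q \in ball 2 y by apply: ball_step yb lb' lq f'.
have [_ [p' ep]] : hinb w p.
  apply: forcing_far fy lp _; apply: far_sym.
  exact: (far_left (m := 2) (n := 4) (far_le (isT : 6 <= 7) far) pB).
have [_ [q' eq]] : hinb w q.
  apply: forcing_far fx lq _.
  exact: (far_right (m := 2) (n := 4) (far_le (isT : 6 <= 7) far) qB).
have far4 := far_left (m := 2) (n := 5) far pB.
have farpq := far_right (m := 2) (n := 3) far4 qB.
have ? := far_neq farpq.
have through r r' s : leaf w s r -> E w r s -> low r -> E r r' m -> ~~ E r w r' ->
   (forall d, E s r d -> d = w) -> forall t, E r' w t -> r' != s -> t = m.
  move=> l es lr er n o t et rs; apply/eqP/negP => /negP tm.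
  have tr : t != r by apply/eqP => ?; subst; absurd_edge.
  have ms : m != s by apply/eqP => ?; subst; have ? := o r' ltac:(edge); subst;
    absurd_neq.
  have ts : t != s.
    by apply/eqP => ?; subst; have ? := l.2 r' ltac:(edge); subst; absurd_neq.
  apply: (notri (a := w) (x := s) (b := r) (y := m) (c := r') (z := t));
    first [edge|uniq_goal].
have e1 : E w b x by edge. have e1' : E w b' y by edge.
have px : p != x by apply/eqP => ?; subst; have ? := one m ltac:(edge); subst;
  absurd_neq.
have qy : q != y by apply/eqP => ?; subst; have ? := one' m ltac:(edge); subst;
  absurd_neq.
have ? := through b p x lf e1 lb e np one _ ep px; subst p'.
have ? := through b' q y lf' e1' lb' f' nq one' _ eq qy; subst q'.
have xm : x != m by neq.
have xq : x != q.
  apply: (far_neq (n := 5)); exact: (far_right (m := 2) (n := 5) far qB).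
case/negP: xq; apply/eqP.
have bq : q != b.
  by rewrite eq_sym; apply: (far_neq (n := 4));
    exact: (far_right (m := 2) (n := 4) farb qB).
by apply: (@link_nbr_eq w b m p); first [edge|neq].
Qed.

(** * Counting bad vertices under a degree bound *)

Section BoundedDegree.

Variable D : nat.
Hypothesis low_dg : forall v, low v -> dg v <= D.

Lemma card_nbrs z : #|[set y | [&& low z, low y & [exists w, E z y w]]]| <= D.
Proof.
case: (boolP (low z)) => [lz|_]; last first.
  by rewrite (_ : [set y | _] = set0) ?cards0 //; apply/setP => y; rewrite !inE.
apply: leq_trans (low_dg lz).
apply: leq_trans (leq_imset_card (fun xy : T * T => xy.1) _).
apply: subset_leq_card; apply/fintype.subsetP => y.
rewrite inE => /and3P[_ _ /existsP[w e]].
by apply/imsetP; exists (y, w).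
Qed.

Lemma card_ball n x : #|ball n x| <= D.+1 ^ n.
Proof.
elim: n => [|n IH] /=; first by rewrite cards1.
rewrite expnS; apply: leq_trans (leq_mul (leqnn _) IH).
set B := ball n x; pose F z := z |: [set y | [&& low z, low y & [exists w, E z
  y w]]].
apply: (@leq_trans #|\bigcup_(z in B) F z|).
  apply: subset_leq_card; apply/fintype.subsetP => y.
  rewrite inE => /exists_inP[z zB h]; apply/bigcupP; exists z => //.
  by rewrite /F !inE eq_sym.
apply: card_bigcup_leq => z _; rewrite /F cardsU1 -add1n leq_add ?card_nbrs //.
by case: (_ \notin _).
Qed.

(** Two balls of radius 7 cover the set: a vertex outside both would yield three distant vertices,
    contrary to [far_share]. The radius is the largest one in the preceding lemmas. *)
Lemma card_sparse (P : T -> Prop) :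
  (forall x y w, low x -> low y -> hinb w x -> hinb w y -> P x -> P y ->
     y \notin ball 7 x -> False) ->
  #|[set x | low x & `[< P x >]]| <= 2 * D.+1 ^ 7.
Proof.
move=> far; set A := [set x | _ & _].
have AP x : x \in A -> low x /\ P x by rewrite inE => /andP[lx /asboolP].
case: (set_0Vmem A) => [->|[x xA]]; first by rewrite cards0.
have [lx px] := AP _ xA; rewrite mul2n -addnn.
case: (boolP (A \subset ball 7 x)) => [s|/subsetPn[y yA xy]].
  apply: leq_trans (leq_addl _ _); exact: leq_trans (subset_leq_card s)
    (card_ball _ _).
have [ly py] := AP _ yA.
apply: leq_trans (leq_add (card_ball 7 x) (card_ball 7 y)).
apply: leq_trans (leq_card_setU _ _); apply: subset_leq_card.
apply/fintype.subsetP => z zA; rewrite inE; apply: contraT;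
  rewrite negb_or => /andP[xz yz].
have [lz pz] := AP _ zA.
have le u v : v \notin ball 7 u -> v \notin ball 2 u by apply: far_le.
have [w [[h1 h2]|[h1 h2]|[h1 h2]]] := far_share lx ly lz (le _ _ xy) (le _ _
  xz) (le _ _ yz).
- by case: (far x y w).
- by case: (far x z w).
- by case: (far y z w).
Qed.

Definition bad_low : {set T} := [set x | low x & `[< bad x >]].

Lemma card_bad_low : #|bad_low| <= 12 * D.+1 ^ 7.
Proof.
pose A (P : T -> Prop) := [set x | low x & `[< P x >]].
have sub : bad_low \subset A (bad_dominated) :|: (A (bad_unreached) :|:
    (A (bad_leaf) :|: (A (bad_type1) :|: (A (bad_forcing) :|:
     A (bad_forcing_leaf))))).
  apply/fintype.subsetP => x; rewrite !inE => /andP[-> /asboolP b] /=.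
  by case: b => [|[|[|[|[]]]]] /asboolP ->; rewrite ?orbT.
have c P : (forall x y w, low x -> low y -> hinb w x -> hinb w y -> P x -> P y ->
     y \notin ball 7 x -> False) -> #|A P| <= 2 * D.+1 ^ 7 by apply: card_sparse.
apply: leq_trans (subset_leq_card sub) _.
have -> : 12 * D.+1 ^ 7 = 2 * D.+1 ^ 7 + (2 * D.+1 ^ 7 + (2 * D.+1 ^ 7 +
    (2 * D.+1 ^ 7 + (2 * D.+1 ^ 7 + 2 * D.+1 ^ 7)))) by rewrite -!mulnDl.
have u (B C : {set T}) k l : #|B| <= k -> #|C| <= l -> #|B :|: C| <= k + l.
  by move=> Bk Cl; apply: leq_trans (leq_card_setU _ _) _; apply: leq_add.
apply: (u _ _ _ _ (c _ _) (u _ _ _ _ (c _ _) (u _ _ _ _ (c _ _)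
  (u _ _ _ _ (c _ _) (u _ _ _ _ (c _ _) (c _ _)))))) => x y w lx ly hx hy px py far.
- exact (bad_dominated_far lx ly hx hy px py (far_le (isT : 1 <= 7) far)).
- exact: (bad_unreached_far lx ly hx hy px py (far_le (isT : 2 <= 7) far)).
- exact: (bad_leaf_far lx ly hx hy px py (far_le (isT : 3 <= 7) far)).
- exact: (bad_type1_far lx ly hx hy px py (far_le (isT : 3 <= 7) far)).
- exact: (bad_forcing_far lx ly hx hy px py far).
- exact: (bad_forcing_leaf_far lx ly hx hy px py far).
Qed.

Lemma card_not_good :
  #|[set x | low x & `[< ~ good x >]]| <= D.+1 ^ 4 * (12 * D.+1 ^ 7).
Proof.
apply: leq_trans (leq_mul (leqnn _) card_bad_low).
apply: (@leq_trans #|\bigcup_(q in bad_low) ball 4 q|); last first.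
  by apply: card_bigcup_leq => q _; apply: card_ball.
apply: subset_leq_card; apply/fintype.subsetP => x;
  rewrite inE => /andP[lx /asboolP ng].
have [q [qB bq]] : exists q, q \in ball 4 x /\ bad q.
  by apply: contrapT => n; apply: ng => q qB b; apply: n; exists q.
apply/bigcupP; exists q; last exact: ball_sym.
by rewrite inE (ball_low lx qB); apply/asboolP.
Qed.

End BoundedDegree.

End Structure.

(** * Double counting of edges and charges *)

Section Counting.

Variables (T : finType) (H : hypergraph T).
Hypothesis notri : loose_triangle_free H.
Hypothesis sat : triangle_saturated H.
Local Notation E := (edge3 H).
Local Notation dg := (dg H).

Lemma edge3_count : \sum_v dg v <= 6 * #|H|.
Proof.
pose Et := [pred t : T * (T * T) | E t.1 t.2.1 t.2.2].
have -> : \sum_v dg v = #|Et|.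
  rewrite -sum1_card; under eq_bigr => v _ do rewrite /dg -sum1_card.
  by rewrite pair_big_dep.
pose st (t : T * (T * T)) := [set t.1; t.2.1; t.2.2].
rewrite -[#|Et|]sum1_card (partition_big st (mem H)) /=; last first.
  by move=> [x [y z]] /and4P[].
rewrite mulnC -sum_nat_const; apply: leq_sum => e eH.
rewrite sum1_card; case: (pickP (fun t => Et t && (st t == e))) =>
  [[a [b c]]|n]; last first.
  by rewrite eq_card0.
move=> /andP[_ /eqP Ee]; set s := [:: (a, (b, c)); (a, (c, b)); (b, (a, c));
  (b, (c, a)); (c, (a, b)); (c, (b, a))].
apply: (@leq_trans #|s|); last exact: card_size.
apply: subset_leq_card; apply/fintype.subsetP => -[x [y z]].
rewrite inE => /andP[xyz0 /eqP E2]; have {}xyz0 : E x y z := xyz0.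
have m w : w \in [set x; y; z] -> w \in [set a; b;
  c] by rewrite -/(st (a, (b, c))) Ee -E2.
have := m x; have := m y; have := m z; rewrite !inE !eqxx ?orbT -!orbA /=.
by do 3![move/(_ isT)/or3P; case=> /eqP ?]; subst;
  first [absurd_neq | by rewrite !eqxx ?orbT].
Qed.

Variable hi : pred T.
Local Notation weight := (weight H hi).

(** Averaging over the three rotations of an ordered triple brings together the three shares of one
    edge, which [share_edge] bounds by 6. *)
Lemma weight_count : \sum_v weight v <= 12 * #|H|.
Proof.
pose Et (t : T * (T * T)) := E t.1 t.2.1 t.2.2.
pose f (t : T * (T * T)) := share H hi t.1 t.2.1 t.2.2.
pose rot (t : T * (T * T)) := (t.2.1, (t.2.2, t.1)).
have rot_inj : injective rot.
  by move=> [x [y z]] [x' [y' z']] [-> -> ->].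
have -> : \sum_v weight v = \sum_(t | Et t) f t by rewrite /weight pair_big_dep.
have rE g : \sum_(t | Et t) g t = \sum_(t | Et t) g (rot t).
  rewrite (reindex_inj rot_inj); apply: eq_bigl => -[x [y z]].
  by rewrite /Et /= [RHS]edge3_rot.
have : \sum_(t | Et t) (f t + (f (rot t) + f (rot (rot t)))) <= \sum_(t | Et t) 6.
  apply: leq_sum => -[x [y z]] /= e.
  by rewrite addnA; apply: share_edge e.
rewrite 2!big_split /= -(rE (fun t => f (rot t))) -(rE f).
have : \sum_(t | Et t) 6 <= 36 * #|H|.
  rewrite -[36]/(6 * 6) -mulnA sum_nat_const mulnC leq_mul2l /=.
  apply: leq_trans edge3_count.
  rewrite -sum1_card; under [leqRHS]eq_bigr => v _ do rewrite /dg -sum1_card.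
  by rewrite pair_big_dep.
move=> h2 h1; rewrite -(leq_pmul2l (isT : 0 < 3)) mulnA.
by apply: leq_trans h2; rewrite !mulSn mul0n addn0.
Qed.

End Counting.

Lemma saturated_lower_bound K : exists C, forall (T : finType) (H : hypergraph T),
  saturated3 loose_cycle3 H -> 4 * K * #|T| <= (3 * K + 24) * #|H| + C.
Proof.
exists (4 * K * (K.+1 ^ 4 * (12 * K.+1 ^ 7))) => T H SH.
have notri := saturated3_triangle_free SH.
have sat := saturated3_triangle_saturated SH.
pose hi : pred T := [pred v | K < dg H v].
have lowK v : ~~ hi v -> dg H v <= K by rewrite /= -leqNgt.
have B := card_not_good notri sat lowK.
set X := _ * _ in B *; set N := [set v | _ & _] in B.
(* Multiplied by 4, this is the source of the term 24 in the bound. *)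
have hiK : #|[set v | hi v]| * K <= 6 * #|H|.
  apply: leq_trans (edge3_count H).
  rewrite [leqRHS](bigID hi) /=; apply: leq_trans (leq_addr _ _).
  rewrite cardsE -sum_nat_const; apply: leq_sum => v; exact: ltnW.
have W : 16 * #|[set v | ~~ hi v & v \notin N]| <= 12 * #|H|.
  apply: leq_trans (weight_count notri sat hi).
  rewrite mulnC cardsE -sum_nat_const [leqRHS](bigID [pred v | ~~ hi v & v
    \notin N]) /=.
  apply: leq_trans (leq_addr _ _); apply: leq_sum => v /andP[lv].
  rewrite inE negb_and lv /= => /asboolPn g.
  by apply: good_weight => //; apply: contrapT.
have c : #|T| <= #|[set v | hi v]| + (#|N| + #|[set v | ~~ hi v & v \notin N]|).
  rewrite -cardsT.
  apply: (@leq_trans #|[set v | hi v] :|: (N :|: [set v | ~~ hi v & v \notin N])|).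
    apply: subset_leq_card; apply/fintype.subsetP => v _.
    by rewrite !inE; case: (hi v) => //=; case: `[<_>].
  apply: leq_trans (leq_card_setU _ _) _; rewrite leq_add2l.
  exact: leq_card_setU.
have {}B : 4 * K * #|N| <= 4 * K * X by rewrite leq_mul2l B orbT.
have {}c : 4 * K * #|T| <= 4 * (#|[set v | hi v]| * K) + (4 * K * #|N| +
    4 * K * #|[set v | ~~ hi v & v \notin N]|).
  have := leq_mul (leqnn (4 * K)) c; rewrite !mulnDr; congr (is_true (_ <= _)).
  by rewrite -!mulnA [K * #|_|]mulnC.
have {}W : 4 * K * #|[set v | ~~ hi v & v \notin N]| <= 3 * K * #|H|.
  have W4 : 4 * #|[set v | ~~ hi v & v \notin N]| <= 3 * #|H|.
    by rewrite -(leq_pmul2l (isT : 0 < 4)) !mulnA.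
  by have := leq_mul (leqnn K) W4; rewrite !mulnA [K * 4]mulnC [K * 3]mulnC.
rewrite mulnDl; lia.
Qed.

(** * Flowers *)

(* A vertex is coded by (0, i) in the core, where 0 and 1 are the two hubs, and
   by (j.+1, r) with r < 4 in the petal j. *)
Definition code : Type := nat * nat.
Definition triple : Type := code * code * code.

(** Six edges on four new vertices: the ratio 3/2. Sharing the hubs joins vertices of different
    petals by loose paths through a hub. *)
Definition petal (j : nat) : seq triple :=
  let p := (0, 0) in let q := (0, 1) in
  let a := (j.+1, 0) in let b := (j.+1, 1) in
  let c := (j.+1, 2) in let d := (j.+1, 3) in
  [:: (p, a, b); (p, a, c); (p, a, d); (q, a, d); (q, b, d); (q, c, d)].

Definition core_triple (t : nat * nat * nat) : triple :=
  ((0, t.1.1), (0, t.1.2), (0, t.2)).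

Definition flower (core : seq (nat * nat * nat)) (k : nat) : seq triple :=
  map core_triple core ++ flatten [seq petal j | j <- iota 0 k].

Definition orders (t : triple) : seq triple :=
  let: (u, v, w) := t in
  [:: (u, v, w); (u, w, v); (v, u, w); (v, w, u); (w, u, v); (w, v, u)].

Definition triples (L : seq triple) : seq triple := flatten (map orders L).

Definition link (L : seq triple) (u : code) : seq (code * code) :=
  [seq (t.1.2, t.2) | t <- triples L & t.1.1 == u].

Definition vertices c k : seq code :=
  [seq (0, i) | i <- iota 0 c] ++
  flatten [seq [seq (j.+1, r) | r <- iota 0 4] | j <- iota 0 k].

Definition linked (L : seq triple) (p q r : code) : bool :=
  let Q := link L q in
  has (fun xv => has (fun yv =>
    (xv.2 == yv.2) && uniq [:: p; xv.1; xv.2; yv.1; q; r]) Q) (link L p).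

Definition no_triangle (L : seq triple) : bool :=
  all (fun t => all (fun yc => all (fun za =>
      (za.2 == t.1.1) ==> ~~ uniq [:: t.1.1; t.1.2; t.2; yc.1; yc.2; za.1])
    (link L yc.2)) (link L t.2)) (triples L).

(** Codes (1, r) are those of petal 0; triples meeting another petal are reduced to this case by
    relabelling. *)
Definition all_linked (L : seq triple) (V : seq code) : bool :=
  all (fun x => all (fun y => all (fun z => uniq [:: x; y; z] ==>
    [|| (y, z) \in link L x, linked L x y z, linked L x z y | linked L y z x])
   V) V) [seq (1, r) | r <- iota 0 4].

Definition within (L : seq triple) (V : seq code) : bool :=
  all (fun t => [&& t.1.1 \in V, t.1.2 \in V & t.2 \in V]) (triples L).

Lemma triplesP L u v w :
  reflect (exists2 t, t \in L & (u, v, w) \in orders t) ((u, v, w) \in triples L).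
Proof. exact: flatten_mapP. Qed.

Lemma mem_link L u v w : ((v, w) \in link L u) = ((u, v, w) \in triples L).
Proof.
apply/mapP/idP => [[[[u' v'] w']]|i]; last by exists (u, v, w) => //;
  rewrite mem_filter eqxx.
by rewrite mem_filter => /andP[/eqP /= -> i] [-> ->].
Qed.

Lemma triples_map L (f : code -> code) t u v w : (u, v, w) \in orders t ->
  (f t.1.1, f t.1.2, f t.2) \in L -> (f u, f v, f w) \in triples L.
Proof.
move=> i tL; apply/triplesP; exists (f t.1.1, f t.1.2, f t.2) => //.
case: t i {tL} => -[a b] c; rewrite !inE.
by do ![case/orP]; move=> /eqP[-> -> ->]; rewrite eqxx ?orbT.
Qed.

Lemma triples_orders L u v w u' v' w' : (u, v, w) \in triples L ->
  (u', v', w') \in orders (u, v, w) -> (u', v', w') \in triples L.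
Proof.
case/triplesP => -[[a b] c] tL i o; apply/triplesP; exists (a, b, c) => //.
move: i o; rewrite !inE.
by do ![case/orP]; move=> /eqP[-> -> ->];
  do ![case/orP]; move=> /eqP[-> -> ->]; rewrite eqxx ?orbT.
Qed.

Lemma mem_vertices c k j r :
  ((j, r) \in vertices c k) = (if j is i.+1 then (i < k) && (r < 4) else r < c).
Proof.
rewrite /vertices mem_cat; apply/orP/idP => [[/mapP[i]|/flatten_mapP[i]]|].
- by rewrite mem_iota => /andP[_ ic] [-> ->].
- by rewrite mem_iota => /andP[_ ik] /mapP[s];
    rewrite mem_iota => /andP[_ s4] [-> ->]; rewrite ik.
case: j => [rc|j /andP[jk r4]]; [left | right].
  by apply/mapP; exists r => //; rewrite mem_iota.
apply/flatten_mapP; exists j; first by rewrite mem_iota.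
by apply/mapP; exists r => //; rewrite mem_iota.
Qed.

(** * Reduction to the flower with three petals *)

Definition relabel (f : nat -> nat) (u : code) : code :=
  if u.1 is j.+1 then ((f j).+1, u.2) else u.

Lemma relabel_triples core f k m u v w : (forall j, j < k -> f j < m) ->
  (u, v, w) \in triples (flower core k) ->
  (relabel f u, relabel f v, relabel f w) \in triples (flower core m).
Proof.
move=> fk /triplesP[t tL i]; apply: triples_map i _.
move: tL; rewrite !mem_cat => /orP[/mapP[s sc ->]|/flatten_mapP[j]].
  by apply/orP; left; apply/mapP; exists s.
rewrite mem_iota => /andP[_ jk] tj; apply/orP; right; apply/flatten_mapP.
exists (f j); first by rewrite mem_iota fk.
by move: tj; rewrite !inE; do ![case/orP]; move=> /eqP->; rewrite eqxx ?orbT.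
Qed.

Lemma triples_petal core k u v w : 0 < k -> (u, v, w) \in triples (flower core k) ->
  exists2 j, j < k & forall x, x \in [:: u; v; w] -> x.1 \in [:: 0; j.+1].
Proof.
move=> k0 /triplesP[t]; rewrite mem_cat => /orP[/mapP[s sc ->]|/flatten_mapP[j]].
  move=> i; exists 0 => // x; rewrite !inE; move: i; rewrite !inE.
  by do ![case/orP]; move=> /eqP[-> -> ->]; case/or3P => /eqP->.
rewrite mem_iota => /andP[_ jk] tj i; exists j => // x; move: tj i; rewrite !inE.
by do ![case/orP]; move=> /eqP->; rewrite !inE; do ![case/orP];
  move=> /eqP[-> -> ->]; case/or3P => /eqP->; rewrite /= ?eqxx.
Qed.

Lemma no_triangleP L a x b y c z : no_triangle L -> (a, x, b) \in triples L ->
  (b, y, c) \in triples L -> (c, z, a) \in triples L -> ~~ uniq [:: a; x; b; y;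
    c; z].
Proof.
move=> /allP n e1; rewrite -!mem_link => e2 e3.
by move/allP: (n _ e1) => /(_ _ e2)/allP/(_ _ e3); rewrite /= eqxx.
Qed.

Lemma flower_no_triangle core k a x b y c z : 0 < k ->
  no_triangle (flower core 3) ->
  (a, x, b) \in triples (flower core k) -> (b, y, c) \in triples (flower core k) ->
  (c, z, a) \in triples (flower core k) -> ~~ uniq [:: a; x; b; y; c; z].
Proof.
move=> k0 n e1 e2 e3.
have [j1 _ p1] := triples_petal k0 e1; have [j2 _ p2] := triples_petal k0 e2.
have [j3 _ p3] := triples_petal k0 e3.
(* Each edge meets one petal at most, so three labels suffice; the minimum keeps [f] below 3 outside
   [s] as well. *)
pose s := undup [:: j1; j2; j3]; pose f j := minn (index j s) 2.
have ss : size s <= 3 by apply: size_undup.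
have f3 j : j < k -> f j < 3 by rewrite ltnS geq_minr.
have finj : {in s &, injective f}.
  have fs i : i \in s -> f i = index i s.
    by move=> iS; apply/minn_idPl; rewrite -ltnS (leq_trans _ ss) // index_mem.
  by move=> i j iS jS; rewrite !fs //; apply: index_inj.
have := no_triangleP n (relabel_triples f3 e1) (relabel_triples f3 e2)
  (relabel_triples f3 e3).
apply: contra => U; have := U; rewrite -(map_inj_in_uniq (f := relabel f)) //.
have sm u : u \in [:: a; x; b; y; c; z] -> u.1 = 0 \/ exists2 j, j \in s & u.1
  = j.+1.
  have mk j : j \in [:: j1; j2; j3] -> u.1 \in [:: 0; j.+1] ->
      u.1 = 0 \/ exists2 j, j \in s & u.1 = j.+1.
    move=> js; rewrite !inE => /orP[/eqP->|/eqP->]; first by left.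
    by right; exists j; rewrite // mem_undup.
  rewrite !inE => h.
  have [h'|h'|h'] : [\/ u \in [:: a; x; b], u \in [:: b; y; c] | u \in [:: c;
    z; a]].
    case/or4P: h => [h|h|h|/or3P[h|h|h]];
      [constructor 1|constructor 1|constructor 1|constructor 2|constructor
      2|constructor 3];
    by rewrite !inE h ?orbT.
  - by apply: (mk j1); [rewrite !inE eqxx | apply: p1].
  - by apply: (mk j2); [rewrite !inE eqxx orbT | apply: p2].
  - by apply: (mk j3); [rewrite !inE eqxx !orbT | apply: p3].
move=> [j1' r1] [j2' r2] /sm /= h1 /sm /= h2; rewrite /relabel /=.
case: h1 => [->|[i1 s1 ->]]; case: h2 => [->|[i2 s2 ->]] //.
by case=> /(finj _ _ s1 s2) -> ->.
Qed.

Definition flower_path (L : seq triple) p q r := exists x v y,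
  [/\ uniq [:: p; x; v; y; q; r], (p, x, v) \in triples L & (q, y, v) \in
    triples L].

Lemma linkedP L p q r : linked L p q r -> flower_path L p q r.
Proof.
case/hasP => -[x v] e1 /hasP[[y v'] e2 /andP[/eqP /= vv U]]; subst v'.
by exists x, v, y; split=> //; rewrite -mem_link.
Qed.

Lemma all_linkedP L V r y z : all_linked L V -> r < 4 -> y \in V -> z \in V ->
  uniq [:: (1, r); y; z] -> (((1, r), y, z) \in triples L) \/
  [\/ flower_path L (1, r) y z, flower_path L (1, r) z y | flower_path L y z
    (1, r)].
Proof.
move=> /allP al r4 yV zV U.
have i : (1, r) \in [seq (1, r) | r <- iota 0 4].
  by apply/mapP; exists r; rewrite // mem_iota.
move/allP: (al _ i) => /(_ _ yV)/allP/(_ _ zV)/implyP/(_ U).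
case/or4P; first by rewrite mem_link; left.
- by move/linkedP; right; constructor 1.
- by move/linkedP; right; constructor 2.
- by move/linkedP; right; constructor 3.
Qed.

(** Pads the petals in question to exactly three. [i1] stays first because [all_linked] tests only
    the first petal. *)
Lemma three_petals k i1 i2 i3 : 3 <= k -> i1 < k -> i2 < k -> i3 < k ->
  exists m2 m3, [/\ uniq [:: i1; m2; m3], m2 < k, m3 < k,
    i2 \in [:: i1; m2; m3] & i3 \in [:: i1; m2; m3]].
Proof.
move=> k3 h1 h2 h3.
have third a b : exists t, [/\ t < k, t != a & t != b].
  exists (if (0 != a) && (0 != b) then 0 else if (1 != a) && (1 != b) then 1
    else 2).
  by case: a => [|[|[|a]]]; case: b => [|[|[|b]]]; split=> //=; lia.
have [m2 [m2k m2i c2]] : exists m2, [/\ m2 < k, m2 != i1 &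
    i2 \in [:: i1; m2] /\ (i3 \in [:: i1; m2] \/ m2 = i2)].
  case: (eqVneq i2 i1) => [->|n2]; last by exists i2; rewrite !inE eqxx orbT;
    split=> //; split=> //; right.
  case: (eqVneq i3 i1) => [->|n3].
    by have [t [tk ti _]] := third i1 i1; exists t; rewrite !inE eqxx;
      split=> //; split=> //; left.
  by exists i3; rewrite !inE !eqxx orbT; split=> //; split=> //; left.
have [m3 [m3k m31 m32 c3]] : exists m3, [/\ m3 < k, m3 != i1, m3 != m2 & i3 \in
  [:: i1; m2; m3]].
  case: (boolP (i3 \in [:: i1; m2])) => h.
    have [t [tk t1 t2]] := third i1 m2; exists t; split=> //.
    by move: h; rewrite !inE => /orP[->|->]; rewrite ?orbT.
  exists i3; split=> //; move: h; rewrite !inE ?eqxx ?orbT // negb_or; by case/andP.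
exists m2, m3; split=> //.
  by rewrite /= !inE !negb_or eq_sym m2i eq_sym m31 eq_sym m32.
by case: c2 => + _; rewrite !inE => /orP[->|->]; rewrite ?orbT.
Qed.

Lemma flower_linked core c k x y z : 3 <= k ->
  within (flower core 3) (vertices c 3) ->
  all_linked (flower core 3) (vertices c 3) ->
  x \in vertices c k -> y \in vertices c k -> z \in vertices c k -> x.1 != 0 ->
  uniq [:: x; y; z] -> ((x, y, z) \in triples (flower core k)) \/
  [\/ flower_path (flower core k) x y z, flower_path (flower core k) x z y
    | flower_path (flower core k) y z x].
Proof.
move=> k3 W al xV yV zV x0 U.
(* For a core vertex the predecessor is 0, a harmless choice of petal. *)
have pk u : u \in vertices c k -> u.1.-1 < k.
  by case: u => [[|j] r]; rewrite mem_vertices /=; [move=> _;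
    apply: leq_trans k3 | case/andP].
have [m2 [m3 [Us h2 h3 yi zi]]] := three_petals k3 (pk _ xV) (pk _ yV) (pk _ zV).
set s := [:: x.1.-1; m2; m3] in Us yi zi; pose f j := nth 0 s j.
have f3 j : j < 3 -> f j < k.
  have /allP sk : all (fun i => i < k) s by rewrite /= pk // h2 h3.
  by move=> j3; apply: sk; apply: mem_nth.
have back u : u \in vertices c k -> u.1.-1 \in s ->
    exists2 u', u' \in vertices c 3 & relabel f u' = u.
  case: u => [[|j] r] uV us; first by exists (0, r) => //; move: uV;
    rewrite !mem_vertices.
  exists ((index j s).+1, r); last by rewrite /relabel /f /= nth_index.
  by move: uV; rewrite !mem_vertices -index_mem /= in us *; rewrite us => /andP[].
have [y' y'V yE] := back _ yV yi; have [z' z'V zE] := back _ zV zi.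
have xE : relabel f (1, x.2) = x by case: (x) x0 @s @f {Us yi zi f3 back yE zE}
  => [[|j] r].
have r4 : x.2 < 4 by case: (x) xV x0 => [[|j] r] //;
  rewrite mem_vertices => /andP[].
have U' : uniq [:: (1, x.2); y'; z'].
  by apply: (@map_uniq _ _ (relabel f)); rewrite /= xE yE zE.
have rinj : {in vertices c 3 &, injective (relabel f)}.
  move=> [[|j] r] [[|j'] r']; rewrite !mem_vertices /relabel //= =>
    /andP[j3 _] /andP[j3' _] [E ->].
  by have /eqP := E; rewrite nth_uniq // => /eqP->.
have path p q r : p \in vertices c 3 -> q \in vertices c 3 -> r \in vertices c 3 ->
    flower_path (flower core 3) p q r ->
    flower_path (flower core k) (relabel f p) (relabel f q) (relabel f r).
  move=> pV qV rV [u [v [w [Up e1 e2]]]].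
  exists (relabel f u), (relabel f v), (relabel f w); split.
  - have /and3P[_ uV vV] := allP W _ e1; have /and3P[_ wV _] := allP W _ e2.
    rewrite -/(map (relabel f) [:: p; u; v; w; q; r]) map_inj_in_uniq // => a b.
    have sub : {subset [:: p; u; v; w; q; r] <= vertices c 3}.
      by apply/allP; rewrite /= pV uV vV wV qV rV.
    by move=> /sub aV /sub bV; apply: rinj.
  - exact: relabel_triples f3 e1.
  - exact: relabel_triples f3 e2.
have x'V : (1, x.2) \in vertices c 3 by rewrite mem_vertices.
case: (all_linkedP al r4 y'V z'V U') => [e|[P|P|P]].
- by left; rewrite -xE -yE -zE; apply: relabel_triples f3 e.
- by right; constructor 1; rewrite -xE -yE -zE; apply: path.
- by right; constructor 2; rewrite -xE -yE -zE; apply: path.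
- by right; constructor 3; rewrite -xE -yE -zE; apply: path.
Qed.

Lemma within_flower core c k : 0 < k -> within (flower core 3) (vertices c 3) ->
  within (flower core k) (vertices c k).
Proof.
move=> k0 W; apply/allP => -[[u v] w] e.
have [j jk p] := triples_petal k0 e.
have /and3P[/= uV vV wV] := allP W _ (relabel_triples (f := fun=> 0) (m := 3)
  (fun _ _ => isT) e).
have up x : x \in [:: u; v; w] -> relabel (fun=> 0) x \in vertices c 3 ->
  x \in vertices c k.
  case: x => [[|i] r] xi; rewrite /relabel !mem_vertices //= => /= ->.
  by have := p _ xi; rewrite !inE /= => /eqP[->]; rewrite jk.
by rewrite /= !up ?inE ?eqxx ?orbT.
Qed.

(** * The flower as a hypergraph, and its saturated extension *)

Section Host.

Variables (core : seq (nat * nat * nat)) (c k : nat).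
Hypothesis k3 : 3 <= k.
Hypothesis core_free : no_triangle (flower core 3).
Hypothesis core_within : within (flower core 3) (vertices c 3).
Hypothesis core_linked : all_linked (flower core 3) (vertices c 3).

Local Notation V := 'I_(c + 4 * k).

Definition decode (x : V) : code :=
  if x < c then (0, val x) else (((x - c) %/ 4).+1, (x - c) %% 4).

Lemma decode_inj : injective decode.
Proof.
move=> x y; rewrite /decode; case: (ltnP x c) => xc; case: (ltnP y c) => yc //.
  by case=> /val_inj.
case=> d m; apply: val_inj; rewrite /= -(subnK xc) -(subnK yc).
by rewrite (divn_eq (x - c) 4) d m -divn_eq.
Qed.

Lemma decode_vertices x : decode x \in vertices c k.
Proof.
rewrite /decode; case: (ltnP x c) => xc; rewrite mem_vertices // ltn_mod andbT.
by rewrite ltn_divLR // ltn_subLR // [k * 4]mulnC.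
Qed.

Lemma decode_onto u : u \in vertices c k -> exists x, decode x = u.
Proof.
case: u => [[|j] r]; rewrite mem_vertices => h.
  have lt : r < c + 4 * k by rewrite ltn_addr.
  by exists (Ordinal lt); rewrite /decode /= h.
case/andP: h => jk r4.
have lt : c + (j * 4 + r) < c + 4 * k.
  rewrite ltn_add2l; apply: (@leq_trans (j.+1 * 4));
    first by rewrite mulSn addnC ltn_add2r.
  by rewrite mulnC leq_mul2l.
exists (Ordinal lt); rewrite /decode /= ltnNge leq_addr /= addKn.
by rewrite divnMDl // modnMDl divn_small // modn_small // addn0.
Qed.

(** The filter makes the hypergraph uniform by definition, without checking that the codes of a
    triple are distinct. *)
Definition host : hypergraph V :=
  [set e in [set:: [seq [set x | decode x \in [:: t.1.1; t.1.2; t.2]]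
    | t <- flower core k]] | #|e| == 3].

Lemma host_edge x y z : uniq [:: x; y; z] ->
  edge3 host x y z = ((decode x, decode y, decode z) \in triples (flower core k)).
Proof.
move=> U; have Ud : uniq (map decode [:: x; y; z]) by rewrite map_inj_uniq //;
  apply: decode_inj.
have -> : edge3 host x y z = ([set x; y; z] \in host).
  move: U; rewrite /edge3 /= !inE negb_or andbT => /andP[/andP[-> ->] ->]; by [].
rewrite inE card_set3 // eqxx andbT inE; apply/mapP/triplesP => -[t tL h];
  exists t => //.
  have m w : w \in [set x; y; z] -> decode w \in [:: t.1.1; t.1.2; t.2].
    by rewrite h inE.
  move: Ud; have := m x; have := m y; have := m z.
  rewrite ![_ \in [set _; _; _]]inE !inE !eqxx ?orbT /=.
  case: t {tL h m} => -[u v] w /=; rewrite !inE !negb_or !xpair_eqE.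
  by do 3![move/(_ isT)/or3P; case=> /eqP->]; rewrite ?eqxx ?andbF ?orbT //= ?andbF.
apply/setP => w; rewrite !inE; case: t {tL} h => -[u v] t /= h.
rewrite -!(inj_eq decode_inj); move: h; rewrite !inE.
by do ![case/orP]; move=> /eqP[-> -> ->];
  case: (decode w == u); case: (decode w == v); case: (decode w == t).
Qed.

Lemma card_host : #|host| <= size core + 6 * k.
Proof.
rewrite /host; set s := map _ _; apply: (@leq_trans #|s|).
  by apply: subset_leq_card; apply/fintype.subsetP => e;
    rewrite inE => /andP[]; rewrite inE.
apply: leq_trans (card_size _) _; rewrite size_map size_cat size_map leq_add2l.
rewrite size_flatten /shape -map_comp sumnE big_map.
by rewrite (eq_bigr (fun=> 6)) // big_const_seq count_predT size_iota iter_addn_0.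
Qed.

Lemma host_free : ~~ contains loose_cycle3 host.
Proof.
apply/negP => /contains_loose_cycle3P[a [x [b [y [d [z [U e1 e2 e3]]]]]]].
have mk u v w : uniq [:: u; v; w] -> [set u; v; w] \in host ->
    (decode u, decode v, decode w) \in triples (flower core k).
  move=> U3 e; rewrite -host_edge // /edge3 e andbT.
  by move: U3; rewrite /= !inE negb_or andbT => /andP[/andP[-> ->] ->].
have Ud : uniq (map decode [:: a; x; b; y; d; z]) by rewrite map_inj_uniq //;
  apply: decode_inj.
have k0 : 0 < k by apply: leq_trans k3.
suff : ~~ uniq (map decode [:: a; x; b; y; d; z]) by rewrite Ud.
apply: (flower_no_triangle k0 core_free); apply: mk => //; uniq_hyps; uniq_goal.
Qed.

Lemma flower_path_host p q r :
  flower_path (flower core k) (decode p) (decode q) (decode r) -> path3 host p q r.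
Proof.
case=> u [v [w [U e1 e2]]].
have W := within_flower (leq_trans (isT : 0 < 3) k3) core_within.
have /and3P[/= _ uV vV] := allP W _ e1; have /and3P[/= _ wV _] := allP W _ e2.
have [x ?] := decode_onto uV; have [t ?] := decode_onto vV;
  have [y ?] := decode_onto wV.
subst u v w; exists x, t, y.
have Ux : uniq [:: p; x; t; y; q; r] by rewrite -(map_inj_uniq decode_inj).
split=> //; rewrite host_edge.
- by [].
- uniq_hyps; uniq_goal.
- apply: triples_orders e2 _; rewrite !inE eqxx ?orbT //.
- uniq_hyps; uniq_goal.
Qed.

(** A maximal triangle-free extension of [host] is saturated. By [flower_linked], a new edge meeting
    a petal would close a triangle, so the new edges are among the 2 ^ c subsets of the core. *)
Lemma flower_saturated : exists2 H : hypergraph V, saturated3 loose_cycle3 H &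
  #|H| <= size core + 6 * k + 2 ^ c.
Proof.
pose P (H : hypergraph V) := [&& host \subset H, uniform3 H & ~~ contains
  loose_cycle3 H].
have P0 : P host.
  rewrite /P fintype.subxx host_free andbT; apply/forall_inP => e.
  by rewrite inE => /andP[].
have [H /maxsetP[/and3P[hH H3 HF] Hmax] _] := maxset_exists P0.
have SH : saturated3 loose_cycle3 H.
  rewrite /saturated3 H3 HF; apply/forallP => e.
  apply/implyP => /andP[e3 eH]; apply: contraT => eF.
  have PeH : P (e |: H).
    apply/and3P; split=> //; first exact: fintype.subset_trans hH (subsetUr _ _).
    by apply/forall_inP => d /setU1P[-> //|]; apply: (forall_inP H3).
  by move: eH; rewrite -(Hmax _ PeH (subsetUr _ _)) setU11.
exists H => //; have notri := saturated3_triangle_free SH.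
pose C := [set x : V | x < c].
have lift u v w : edge3 host u v w -> edge3 H u v w.
  by case/and4P => uv uw vw e; apply/and4P; split=> //; apply: (fintype.subsetP hH).
have cover : H \subset host :|: powerset C.
  apply/fintype.subsetP => e eH; rewrite in_setU powersetE; apply: contraT.
  rewrite negb_or => /andP[nh /subsetPn[x xe xC]].
  have e3 : #|e| = 3 by apply/eqP; apply: (forall_inP H3).
  have c2 : #|e :\ x| == 2 by rewrite -(eqn_add2l 1) -[X in X + _]/(nat_of_bool
    true) -xe -cardsD1 e3.
  have [y [z [yz E2]]] := elimT (cards2P _) c2.
  have xyz : uniq [:: x; y; z].
    have : x \notin e :\ x by rewrite !inE eqxx.
    by rewrite E2 /= !inE !negb_or => ->; rewrite yz.
  have eE : e = [set x; y; z] by rewrite -(setD1K xe) E2 finset.setUA.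
  have ex : edge3 H x y z.
    move: xyz; rewrite /edge3 -eE eH /= !inE negb_or andbT =>
      /andP[/andP[-> ->] ->].
    by [].
  have x0 : (decode x).1 != 0.
    by move: xC; rewrite inE /decode -leqNgt ltnNge => ->.
  have Ud : uniq (map decode [:: x; y; z]) by rewrite map_inj_uniq //;
    apply: decode_inj.
  have no p q r : path3 host p q r -> edge3 H p q r -> False.
    case=> u [v [w [U /lift f1 /lift f2]]] f; apply: (notri p u v w q r) => //.
    by edge.
  case: (flower_linked k3 core_within core_linked (decode_vertices x)
    (decode_vertices y)
    (decode_vertices z) x0 Ud) => [h|[h|h|h]].
  - by move: h; rewrite -host_edge // => /and4P[_ _ _]; rewrite -eE (negbTE nh).
  - by case: (no x y z (flower_path_host h) ex).
  - by case: (no x z y (flower_path_host h)); edge.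
  - by case: (no y z x (flower_path_host h)); edge.
apply: leq_trans (subset_leq_card cover) _.
apply: leq_trans (leq_card_setU _ _) _; rewrite leq_add ?card_host // card_powerset.
rewrite leq_exp2l // cardE -(size_map val (enum C)).
apply: (@leq_trans (size (iota 0 c))); last by rewrite size_iota.
apply: uniq_leq_size; first by rewrite map_inj_uniq ?enum_uniq //; apply: val_inj.
by move=> i /mapP[x]; rewrite mem_enum inE mem_iota => xc ->.
Qed.

End Host.

(* Cores on 5, 6, 7 and 8 vertices, found by computer search: every residue of
   n modulo 4 occurs. *)
Definition core5 := [:: (1, 3, 4); (0, 3, 4); (0, 2, 4); (1, 2, 3)].
Definition core6 :=
  [:: (2, 4, 5); (2, 3, 4); (1, 3, 5); (1, 2, 4); (1, 2, 3); (1, 2, 5)].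
Definition core7 :=
  [:: (1, 3, 5); (3, 5, 6); (0, 2, 4); (0, 2, 5); (1, 4, 5); (2, 4, 5);
      (1, 5, 6); (1, 2, 5)].
Definition core8 :=
  [:: (0, 2, 3); (2, 3, 6); (3, 5, 6); (2, 4, 7); (0, 3, 5); (1, 2, 4);
      (2, 3, 5); (1, 2, 3); (1, 2, 7); (0, 3, 6)].

Definition core_ok c core : bool :=
  [&& no_triangle (flower core 3), within (flower core 3) (vertices c 3)
    & all_linked (flower core 3) (vertices c 3)].

Lemma core5_ok : core_ok 5 core5. Proof. by vm_compute. Qed.
Lemma core6_ok : core_ok 6 core6. Proof. by vm_compute. Qed.
Lemma core7_ok : core_ok 7 core7. Proof. by vm_compute. Qed.
Lemma core8_ok : core_ok 8 core8. Proof. by vm_compute. Qed.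

Lemma sat3_flower c core k : 3 <= k -> core_ok c core ->
  sat3 (c + 4 * k) loose_cycle3 <= size core + 6 * k + 2 ^ c.
Proof.
move=> k3 /and3P[h1 h2 h3]; have [H SH cH] := flower_saturated k3 h1 h2 h3.
exact: leq_trans (sat3_le SH) cH.
Qed.

Lemma sat3_upper_bound n : 17 <= n -> 2 * sat3 n loose_cycle3 <= 3 * n + 532.
Proof.
move=> n17; set k := (n - 5) %/ 4.
have k3 : 3 <= k by rewrite leq_divRL // leq_subRL ?(leq_trans _ n17).
have nE : n = 5 + (n - 5) %% 4 + 4 * k.
  by rewrite -addnA mulnC [_ %% _ + _]addnC -divn_eq subnKC // (leq_trans _ n17).
(* The constant 532 is 2 * (10 + 256), from the largest core. *)
have fin c core : core_ok c core -> size core <= 10 -> 2 ^ c <= 256 ->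
    2 * sat3 (c + 4 * k) loose_cycle3 <= 3 * (c + 4 * k) + 532.
  by move=> /(sat3_flower k3); lia.
have : (n - 5) %% 4 < 4 by rewrite ltn_mod.
rewrite {2 3}nE; case: (_ %% 4) => [|[|[|[|//]]]] _.
- exact: fin core5_ok _ _.
- exact: fin core6_ok _ _.
- exact: fin core7_ok _ _.
- exact: fin core8_ok _ _.
Qed.

(* Asymptotic form of the bounds *)
From mathcomp Require Import all_boot all_order all_algebra.
From mathcomp Require Import all_classical all_reals all_analysis.
From mathcomp Require Import ring lra.
Import Order.TTheory GRing.Theory Num.Theory.
Import numFieldNormedType.Exports.
Local Open Scope classical_set_scope.
Local Open Scope ring_scope.

Lemma sat3_lower_bound (R : realType) (e : R) : 0 < e ->
  \forall n \near \oo, (4 / 3 - e) * n%:R <= (sat3 n loose_cycle3)%:R :> R.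
Proof.
(* (3K + 24)(4/3 - e) = 4K + 32 - 3Ke - 24e. Since Ke > 32, one Ke absorbs the 32, and a second one
   the constant [C] once C <= e n. *)
move=> e0; pose K := (Num.trunc (32 / e)).+1.
have [C HC] := saturated_lower_bound K.
near=> n.
have F0 : loose_cycle3 != finset.set0.
  apply/finset.set0Pn; eexists; apply/finset.setUP; left; apply/finset.setUP; left.
  exact: finset.set11.
have [H SH ->] := sat3_attained n F0.
have := HC _ H SH; rewrite card_ord => le.
have {le} le : 4 * K%:R * n%:R <= (3 * K%:R + 24) * #|H|%:R + C%:R :> R.
  by rewrite -!natrM -!natrD -!natrM -natrD ler_nat.
have Ke : 32 / e < K%:R by rewrite truncnS_gt.
have {}Ke : 32 < K%:R * e by rewrite -ltr_pdivrMr.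
have nC : C%:R <= e * n%:R :> R.
  rewrite mulrC -ler_pdivrMr //; near: n; exact: nbhs_infty_ger.
have n0 : 0 <= n%:R :> R by [].
have h0 : 0 <= #|H|%:R :> R by [].
set x : R := n%:R in le nC n0 *; set s : R := #|H|%:R in le h0 *.
set k : R := K%:R in le Ke *.
have k1 : 1 <= k by rewrite ler1n.
rewrite leNgt; apply/negP => lt.
have p : 0 < 3 * k + 24 by lra.
have h1 : 32 * x <= k * e * x by rewrite ler_wpM2r // ltW.
have h2 : e * x <= k * e * x by rewrite ler_wpM2r // ler_peMl // ltW.
have h3 : 0 <= e * x by rewrite mulr_ge0 // ltW.
have h4 : (3 * k + 24) * s < (3 * k + 24) * ((4 / 3 - e) * x) by rewrite ltr_pM2l.
have h5 : (3 * k + 24) * ((4 / 3 - e) * x) =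
    4 * k * x + 32 * x - 3 * (k * e * x) - 24 * (e * x) by field.
rewrite h5 in h4; lra.
Unshelve. all: by end_near.
Qed.

Theorem theorem1p1 (R : realType) :
  (exists eps : nat -> R,
     eps =o_\oo (fun=> 1 : R) /\
     \forall n \near \oo,
       (4 / 3 + eps n) * n%:R <= (sat3 n loose_cycle3)%:R) /\
  (exists b : nat -> R,
     b =O_\oo (fun=> 1 : R) /\
     \forall n \near \oo,
       (sat3 n loose_cycle3)%:R <= 3 / 2 * n%:R + b n).
Proof.
split.
  pose s n : R := (sat3 n loose_cycle3)%:R.
  (* The cut at 0 is needed for the convergence: the ratio may stay above 4/3. *)
  exists (fun n => Num.min 0 (s n / n%:R - 4 / 3)); split.
    apply/eqoP => e e0; near=> n.
    have n0 : 0 < n%:R :> R by rewrite ltr0n; near: n; exact: nbhs_infty_gt.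
    have le : (4 / 3 - e) * n%:R <= s n by near: n; exact: sat3_lower_bound.
    rewrite normr1 mulr1 ler_norml; apply/andP; split;
      last by rewrite ge_min (ltW e0).
    by rewrite le_min oppr_le0 (ltW e0) /= lerBrDl ler_pdivlMr.
  near=> n.
  have n0 : 0 < n%:R :> R by rewrite ltr0n; near: n; exact: nbhs_infty_gt.
  by rewrite -ler_pdivlMr // -lerBrDl ge_min lexx orbT.
exists (fun=> 266); split.
  apply/eqOP; near=> k; near=> n.
  rewrite normr1 mulr1; near: k; apply: nbhs_pinfty_ge; exact: num_real.
near=> n.
have n17 : (17 <= n)%N by near: n; exact: nbhs_infty_ge.
have : 2 * (sat3 n loose_cycle3)%:R <= 3 * n%:R + 532 :> R.
  by rewrite -!natrM -natrD ler_nat; apply: sat3_upper_bound.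
lra.
Unshelve. all: by end_near.
Qed.
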